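(* Let $\mathcal K$ be a compact subset of the parameter space $\{(h,s):h>0,\ s>0\}$, where $h$ is an inner product on the Heisenberg algebra $\mathfrak g$. There are $\varepsilon,C,\eta>0$ with the following property. Consider expanding invariant vacuum data $(h,s,\mathcal A)$ with $(h,s)\in\mathcal K$ and $|\mathcal A|_h\le\varepsilon$, and in the maximal homogeneous vacuum development choose past proper time $t$ to vanish at the singularity or horizon (past end). Let $t_{\mathrm{ref}}>0$ be the time of the slice carrying the datum. For $\mathcal A\ne0$, choose $h$-unit horizontal eigenvectors $X_-,X_+$ of $\mathcal A$ for its negative and positive eigenvalues, respectively, and extend them as invariant vector fields; at $\mathcal A=0$ any $h$-orthonormal pair in $H_h$ may be used. Set $$\ell_\pm(t)=\sqrt{h_t(X_\pm,X_\pm)},\qquad B_{\mathrm H}(h,s)=\frac{n(h)}{\sqrt{n(h)^2+s^2}} .$$ The quantity $B_{\mathrm H}$ is the limiting horizontal length at the horizon of the development of $(h,s,0)$. With $r$ and $p_\pm$ as in the context, $$\left|\log\frac{\ell_\pm(t)}{B_{\mathrm H}}-p_\pm\log\frac t{t_{\mathrm{ref}}}\right|\le C\left(r+\left(\frac t{t_{\mathrm{ref}}}\right)^\eta\right),\qquad 0<t\le t_{\mathrm{ref}} .$$ The constants are independent of the direction of $\mathcal A$. Moreover, for every $0<\lambda_0<\lambda_1<\infty$ there is a constant $C_{\lambda_0,\lambda_1}$ such that, when $r>0$, $$\sup_{\lambda_0\le\lambda\le\lambda_1}\left(\left|\frac{\ell_-(t_{\mathrm{ref}}e^{-\lambda/r})}{B_{\mathrm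 H}}-e^\lambda\right|+\left|\frac{\ell_+(t_{\mathrm{ref}}e^{-\lambda/r})}{B_{\mathrm H}}-e^{-\lambda}\right|\right)\le C_{\lambda_0,\lambda_1}\left(r+e^{-\eta\lambda_0/r}\right).$$
   Context: $\mathfrak g$ is the three-dimensional Heisenberg Lie algebra with center $\mathfrak z$; for an inner product $h$ on $\mathfrak g$ (identified with a left-invariant metric), $H_h=\mathfrak z^{\perp_h}$ and $n(h)>0$ is defined by $R(h)=-n(h)^2/2$. For $h>0$, $s>0$ and $\mathcal A$ a trace-free $h$-self-adjoint endomorphism of $H_h$, the expanding invariant vacuum datum $(h,s,\mathcal A)$ is the pair $(h,K)$ with $L=h^{-1}K$ given by $L|_{H_h}=\frac s2\operatorname{Id}+\mathcal A$, $L|_{\mathfrak z}=\alpha\operatorname{Id}$, $\alpha=\frac{n(h)^2-s^2+2|\mathcal A|_h^2}{4s}$ (with $L$ preserving $\mathfrak z$ and $H_h$); here $K=\frac12\partial_th$ in proper time and these are exactly the invariant solutions of the vacuum constraints with $\operatorname{tr}_hK>0$. $|\mathcal A|_h$ is the Hilbert–Schmidt norm. The maximal homogeneous vacuum development is the Ricci-flat metric $-\mathrm dt^2+h_t$, $h_t$ left-invariant on $H_3$, with this datum on one slice, on its maximal proper-time interval; its past proper-time length is finite. Put $$r=\frac{\sqrt2|\mathcal A|_h}{\sqrt{4\alpha^2+n(h)^2}},\qquad u=\sqrt{1+r^2},\qquad p_-=\frac{u-r-1}{2u-1},\qquad p_+=\frac{u+r-1}{2u-1}.$$ *)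

(* Defs.v *)
From HB Require Import structures.
From mathcomp Require Import all_boot all_order all_algebra.
From mathcomp Require Import all_classical all_reals all_analysis.

Set Implicit Arguments.
Unset Strict Implicit.
Unset Printing Implicit Defensive.

Import Order.TTheory GRing.Theory Num.Theory.
Import numFieldNormedType.Exports.

Local Open Scope classical_set_scope.
Local Open Scope ring_scope.

(* Levi-Civita curvature of a metric in a frame E_0, ..., E_(n-1) whose
   brackets [E_a, E_b] = \sum_k c a b k E_k have constant coefficients, for a
   metric whose components g t a b = g(E_a, E_b) depend on a single real
   variable t, on which the frame acts by E_a f = w a * f'.  With w = 0 and g
   constant this is the curvature of a left-invariant metric on a Lie group. *)
Section FrameCurvature.
Variables (R : realType) (n : nat).
Variables (w : 'I_n -> R) (c : 'I_n -> 'I_n -> 'I_n -> R) (g : R -> 'M[R]_n).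

(* Koszul formula for g(\nabla_{E_a} E_b, E_d) *)
Definition koszul (a b d : 'I_n) (t : R) : R :=
  2^-1 * (w a * derive1 (fun x => g x b d) t
          + w b * derive1 (fun x => g x a d) t
          - w d * derive1 (fun x => g x a b) t
          + \sum_k (c a b k * g t k d - c a d k * g t k b - c b d k * g t k a)).

(* \nabla_{E_a} E_b = \sum_e connection a b e E_e *)
Definition connection (a b e : 'I_n) (t : R) : R :=
  \sum_d koszul a b d t * invmx (g t) d e.

(* R(E_a, E_b) E_d = \sum_e riemann a b d e E_e, where
   R(X, Y) = \nabla_X \nabla_Y - \nabla_Y \nabla_X - \nabla_[X, Y] *)
Definition riemann (a b d e : 'I_n) (t : R) : R :=
  w a * derive1 (connection b d e) t - w b * derive1 (connection a d e) t
  + \sum_k (connection b d k t * connection a k e t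
            - connection a d k t * connection b k e t
            - c a b k * connection k d e t).

Definition ricci (b d : 'I_n) (t : R) : R := \sum_a riemann a b d a t.

Definition scalar_curvature (t : R) : R :=
  \sum_b \sum_d invmx (g t) b d * ricci b d t.

End FrameCurvature.

Section Heisenberg.
Variable R : realType.
Implicit Types (h A L K : 'M[R]_3) (x y z v : 'cV[R]_3).

(* Structure constants of the basis e_0, e_1, e_2 with [e_0, e_1] = e_2.
   Elements of the Lie algebra are coordinate columns, endomorphisms act on
   the left, and bilinear forms are given by their Gram matrices. *)
Definition heis (i j k : 'I_3) : R :=
  [&& val i == 0%N, val j == 1%N & val k == 2%N]%:R
  - [&& val i == 1%N, val j == 0%N & val k == 2%N]%:R.

Definition bracket x y : 'cV[R]_3 :=
  \col_k \sum_i \sum_j heis i j k * x i 0 * y j 0.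

Definition central z := forall y, bracket z y = 0.

Definition form h x y : R := (x^T *m h *m y) 0 0.

Definition inner_product h :=
  h^T = h /\ forall x, x != 0 -> 0 < form h x x.

Definition horizontal h v := forall z, central z -> form h v z = 0.

Definition scal h : R := scalar_curvature (fun=> 0) heis (fun=> h) 0.

(* positive solution n of scal h = - n ^+ 2 / 2 (scal h < 0 for h > 0) *)
Definition nH h : R := Num.sqrt (- 2 * scal h).

(* sqrt (tr (A^* A)), where A^* = h^-1 A^T h is the h-adjoint *)
Definition hs_norm h A : R := Num.sqrt (\tr (invmx h *m A^T *m h *m A)).

(* An endomorphism of the horizontal plane is represented by its extension by
   zero on the center, which has the same trace and Hilbert-Schmidt norm. *)
Definition tracefree_selfadjoint h A :=
  [/\ forall z, central z -> A *m z = 0,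
      forall v, horizontal h v -> horizontal h (A *m v),
      \tr A = 0
    & forall v v', horizontal h v -> horizontal h v' ->
        form h (A *m v) v' = form h v (A *m v')].

Definition alpha h (s : R) A : R :=
  (nH h ^+ 2 - s ^+ 2 + 2 * hs_norm h A ^+ 2) / (4 * s).

Definition second_fundamental_form h (s : R) A K :=
  exists L, [/\ K = h *m L,
    forall v, horizontal h v -> L *m v = (s / 2) *: v + A *m v
  & forall z, central z -> L *m z = alpha h s A *: z].

Definition spacetime_metric (h_ : R -> 'M[R]_3) (t : R) : 'M[R]_(1 + 3) :=
  block_mx (- 1%:M) 0 0 (h_ t).

(* brackets of the frame (d/dt, e_0, e_1, e_2) *)
Definition spacetime_bracket (a b d : 'I_(1 + 3)) : R :=
  match fintype.split a, fintype.split b, fintype.split d with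
  | inr i, inr j, inr k => heis i j k
  | _, _, _ => 0
  end.

Definition time_component (a : 'I_(1 + 3)) : R := (val a == 0%N)%:R.

Definition ricci_flat_at (h_ : R -> 'M[R]_3) (t : R) :=
  forall a b, ricci time_component spacetime_bracket (spacetime_metric h_) a b t
              = 0.

(* The values of h_ outside the open interval ]a, b[ are irrelevant. *)
Definition vacuum_development (a b : \bar R) (h_ : R -> 'M[R]_3) :=
  forall t : R, (a < t%:E)%E -> (t%:E < b)%E ->
  [/\ inner_product (h_ t),
      forall i j, derivable (fun u => h_ u i j) t 1,
      forall i j, derivable (derive1 (fun u => h_ u i j)) t 1
    & ricci_flat_at h_ t].

Definition maximal_vacuum_development (a b : \bar R) (h_ : R -> 'M[R]_3) :=
  vacuum_development a b h_ /\
  forall (a' b' : \bar R) (h'_ : R -> 'M[R]_3),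
    (a' <= a)%E -> (b <= b')%E -> vacuum_development a' b' h'_ ->
    (forall t : R, (a < t%:E)%E -> (t%:E < b)%E -> h'_ t = h_ t) ->
    a' = a /\ b' = b.

(* Maximal development of the datum (h, s, A), with proper time normalized to
   vanish at the past end, and the datum carried by the slice t = tref. *)
Definition development_of h (s : R) A (tref : R) (h_ : R -> 'M[R]_3) :=
  exists (b : \bar R) K,
    [/\ maximal_vacuum_development 0%E b h_,
        0 < tref /\ (tref%:E < b)%E,
        second_fundamental_form h s A K,
        h_ tref = h
      & forall i j, 2^-1 * derive1 (fun t => h_ t i j) tref = K i j].

Definition unit_horizontal h v := horizontal h v /\ form h v v = 1.

Definition principal_pair h A (Xm Xp : 'cV[R]_3) :=
  [/\ unit_horizontal h Xm, unit_horizontal h Xp,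
      A != 0 -> (exists2 mu : R, mu < 0 & A *m Xm = mu *: Xm) /\
                (exists2 mu : R, 0 < mu & A *m Xp = mu *: Xp)
    & A = 0 -> form h Xm Xp = 0].

Definition len (h_ : R -> 'M[R]_3) x (t : R) : R := Num.sqrt (form (h_ t) x x).

Definition BH h (s : R) : R := nH h / Num.sqrt (nH h ^+ 2 + s ^+ 2).

Definition rpar h (s : R) A : R :=
  Num.sqrt 2 * hs_norm h A / Num.sqrt (4 * alpha h s A ^+ 2 + nH h ^+ 2).

Definition p_minus (r : R) : R :=
  let u := Num.sqrt (1 + r ^+ 2) in (u - r - 1) / (2 * u - 1).

Definition p_plus (r : R) : R :=
  let u := Num.sqrt (1 + r ^+ 2) in (u + r - 1) / (2 * u - 1).

Definition parameter_space : set ('M[R]_3 * R) :=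
  [set q | inner_product q.1 /\ 0 < q.2].

(* the data, developments and eigenvectors over which the constants of the
   estimates are uniform *)
Definition admissible (KK : set ('M[R]_3 * R)) (eps : R) h (s : R) A
    (tref : R) (h_ : R -> 'M[R]_3) (Xm Xp : 'cV[R]_3) :=
  [/\ KK (h, s), tracefree_selfadjoint h A, hs_norm h A <= eps,
      development_of h s A tref h_ & principal_pair h A Xm Xp].

End Heisenberg.

(* Main.v *)
(** The momentum constraint makes the centre an eigenline of the Weingarten map
    [L = h^-1 K], so the horizontal plane does not move. With [V = sqrt (det h)],
    [be = V * L_zz] and [P] the projection onto the centre, the matrix
    [V L + be (1 - 2 P)] is then constant: the metric stays diagonal in the frame
    [(X_-, X_+, z)] and the vacuum equations reduce to a scalar system, which
    integrates explicitly in the variable [y = (E - 2 be) / h(z, z)], where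
    [E^2 = 4 be^2 + h(z, z)^2] is conserved: [y' = E y / V] and
    [h(X_s, X_s) = (y / y0)^(u + s r - 1) (1 + y^2) / (1 + y0^2)], [s = -1, 1].
    For [m = (y / y0)^(u - 1/2)] and the primitive [Phi] of [sqrt (1 + y^2)] with
    respect to [m] vanishing at [0], [Phi(m)] is affine in proper time. It is
    proportional to [t]: otherwise the explicit solution would continue the
    development past [t = 0], against maximality. The estimates follow from
    [m <= Phi(m) <= m sqrt (1 + y^2)] and from [y0 = s / n + O(r)], where
    [BH = (1 + (s / n)^2)^(-1/2)]. *)

Require Import Defs.
From HB Require Import structures.
From mathcomp Require Import all_boot all_order all_algebra.
From mathcomp Require Import all_classical all_reals all_analysis.
From mathcomp Require Import ring lra.
Import Order.TTheory GRing.Theory Num.Theory.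
Import numFieldNormedType.Exports.
Local Open Scope classical_set_scope.
Local Open Scope ring_scope.
Set Implicit Arguments.
Unset Strict Implicit.
Unset Printing Implicit Defensive.

(** A development is given only pointwise, as inner products that are Ricci flat at each time, and
    no existence or uniqueness theorem for differential equations is invoked: every closed formula
    comes from a quantity whose derivative vanishes on an interval. Since maximality speaks about
    arbitrary vacuum metrics, integrating the equations is not enough. The closed formulas must also
    be shown, conversely, to satisfy every component of the Einstein equations on the longer
    interval, which is why the Ricci tensor is computed for general invariant metrics and then used
    in both directions. The exponents [p_minus] and [p_plus] are quotients: a length carries the
    power [(u + s r - 1) / 2] of [y / y0], proper time essentially the power [u - 1/2]. All errors
    are measured on logarithms, where they split into a part of order [r] (shift of [y0], and
    bounded offset of the clock times [p]) and a part of order [y^2], hence of order [t / tref]. The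
    case [A = 0] is never separated after the choice of the eigenvectors, so uniformity near it is
    automatic. *)

Local Notation form := Defs.form.
Local Notation i0 := (@Ordinal 3 0 isT).
Local Notation i1 := (@Ordinal 3 1 isT).
Local Notation i2 := (@Ordinal 3 2 isT).

(** * Curvature of homogeneous metrics on the Heisenberg group *)

Section ThreeByThree.

Lemma ord3P (P : 'I_3 -> Prop) : P i0 -> P i1 -> P i2 -> forall i, P i.
Proof.
move=> P0 P1 P2 [[|[|[|k]]] ki] //.
- by rewrite (_ : Ordinal ki = i0) //; apply: val_inj.
- by rewrite (_ : Ordinal ki = i1) //; apply: val_inj.
- by rewrite (_ : Ordinal ki = i2) //; apply: val_inj.
Qed.

Lemma sum3 (V : nmodType) (F : 'I_3 -> V) : \sum_i F i = F i0 + F i1 + F i2.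
Proof.
rewrite !big_ord_recl big_ord0 addr0 addrA.
by congr (_ + _ + _); congr F; apply: val_inj.
Qed.

Lemma det_mx22 (R : comPzRingType) (A : 'M[R]_2) :
  \det A = A ord0 ord0 * A ord_max ord_max - A ord0 ord_max * A ord_max ord0.
Proof.
rewrite (expand_det_row _ ord0) !big_ord_recl big_ord0 addr0 /cofactor !det_mx11 !mxE /=.
have -> : lift (ord0 : 'I_2) ord0 = ord_max by apply: val_inj.
have -> : lift (ord_max : 'I_2) ord0 = ord0 by apply: val_inj.
by rewrite expr0 mul1r expr1 mulN1r mulrN.
Qed.

Lemma det_mx33 (R : comPzRingType) (A : 'M[R]_3) :
  \det A = A i0 i0 * (A i1 i1 * A i2 i2 - A i1 i2 * A i2 i1)
         - A i0 i1 * (A i1 i0 * A i2 i2 - A i1 i2 * A i2 i0)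
         + A i0 i2 * (A i1 i0 * A i2 i1 - A i1 i1 * A i2 i0).
Proof.
rewrite (expand_det_row _ i0) sum3 /cofactor !det_mx22 !mxE.
have -> : lift i0 ord0 = i1 by apply: val_inj.
have -> : lift i0 ord_max = i2 by apply: val_inj.
have -> : lift i1 ord0 = i0 by apply: val_inj.
have -> : lift i1 ord_max = i2 by apply: val_inj.
have -> : lift i2 ord0 = i0 by apply: val_inj.
have -> : lift i2 ord_max = i1 by apply: val_inj.
by rewrite /= !add0n expr0 expr1 sqrrN expr1n !mul1r mulN1r mulrN.
Qed.

End ThreeByThree.

(** The adjugate of a symmetric matrix. Only the upper triangle is used, so that equal entries agree
    syntactically for [ring] and [field]; the nested lists let [/=] extract an entry. *)
Definition adj3_entry (R : realType) (h : 'M[R]_3) (i j : nat) : R :=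
  nth 0 (nth [::] [:: [:: h i1 i1 * h i2 i2 - h i1 i2 * h i1 i2;
                    h i0 i2 * h i1 i2 - h i0 i1 * h i2 i2;
                    h i0 i1 * h i1 i2 - h i0 i2 * h i1 i1];
                 [:: h i0 i2 * h i1 i2 - h i0 i1 * h i2 i2;
                    h i0 i0 * h i2 i2 - h i0 i2 * h i0 i2;
                    h i0 i1 * h i0 i2 - h i0 i0 * h i1 i2];
                 [:: h i0 i1 * h i1 i2 - h i0 i2 * h i1 i1;
                    h i0 i1 * h i0 i2 - h i0 i0 * h i1 i2;
                    h i0 i0 * h i1 i1 - h i0 i1 * h i0 i1]] i) j.

Definition adj3 (R : realType) (h : 'M[R]_3) : 'M[R]_3 :=
  \matrix_(i, j) adj3_entry h i j.

Section SymmetricInverse.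
Variables (R : realType) (h : 'M[R]_3).
Hypothesis hsym : h^T = h.

Lemma sym_entry i j : h i j = h j i.
Proof. by rewrite -[in LHS]hsym mxE. Qed.

Lemma mul_adj3 (B : 'M[R]_3) (d : R) (du : d != 0) : h *m B = d%:M ->
  h \in unitmx -> invmx h = d^-1 *: B.
Proof.
move=> hB hu; apply: (can_inj (mulKmx hu)).
by rewrite mulmxV // -scalemxAr hB scale_scalar_mx mulVf.
Qed.

Hypothesis hu : h \in unitmx.

Lemma det_neq0 : \det h != 0.
Proof. by move: hu; rewrite unitmxE unitfE. Qed.

Lemma inv3 : invmx h = (\det h)^-1 *: adj3 h.
Proof.
apply: mul_adj3 => //; first exact: det_neq0.
apply/matrixP; elim/ord3P; elim/ord3P;
  rewrite !mxE sum3 /adj3 !mxE /adj3_entry /= det_mx33 ?(sym_entry i1 i0) ?(sym_entry i2 i0) ?(sym_entry i2 i1);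
  rewrite ?mulr1n ?mulr0n; ring.
Qed.

Lemma inv_sym i j : invmx h i j = invmx h j i.
Proof. by rewrite -[in LHS]hsym -trmx_inv mxE. Qed.
End SymmetricInverse.

Section HeisenbergRicci.
Variables (R : realType) (h : 'M[R]_3).
Hypothesis hsym : h^T = h.
Hypothesis hu : h \in unitmx.
Let H := invmx h.

(** Brackets are central, so the structure constants reduce to the symplectic form [heis _ _ i2] on
    the horizontal plane. *)
Lemma heisE i j k : heis R i j k = (k == i2)%:R * heis R i j i2.
Proof.
by rewrite /heis; elim/ord3P: i; elim/ord3P: j; elim/ord3P: k => /=; ring.
Qed.

Definition hconn := connection (fun=> 0 : R) (@heis R) (fun=> h).

Lemma koszul_heis i j d t : koszul (fun=> 0 : R) (@heis R) (fun=> h) i j d t =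
  2^-1 * (heis R i j i2 * h i2 d - heis R i d i2 * h i2 j - heis R j d i2 * h i2 i).
Proof.
rewrite /koszul !mul0r subr0 !add0r sum3 (heisE i j i0) (heisE i j i1).
by rewrite (heisE i d i0) (heisE i d i1) (heisE j d i0) (heisE j d i1) /=; congr (_ * _); ring.
Qed.

Lemma hconnE i j k t : hconn i j k t =
  \sum_d (2^-1 * (heis R i j i2 * h i2 d - heis R i d i2 * h i2 j - heis R j d i2 * h i2 i)) * H d k.
Proof. by apply: eq_bigr => d _; rewrite koszul_heis. Qed.

(** The bracket form with its second index raised by the metric; the two last terms of the Koszul
    formula turn into it. *)
Let J (i k : 'I_3) : R :=
  heis R i i0 i2 * H i0 k + heis R i i1 i2 * H i1 k.

Lemma eta_inv k : \sum_d h i2 d * H d k = (k == i2)%:R.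
Proof.
by have := congr1 (fun B : 'M[R]_3 => B i2 k) (mulmxV hu); rewrite !mxE eq_sym.
Qed.

Lemma hconnJ i j k t : hconn i j k t =
  2^-1 * (heis R i j i2 * (k == i2)%:R - J i k * h i2 j - J j k * h i2 i).
Proof.
rewrite hconnE -eta_inv !sum3 /J; have z l : heis R l i2 i2 = 0.
  by rewrite /heis; elim/ord3P: l => /=; ring.
by rewrite !z; ring.
Qed.

Hypothesis h22 : h i2 i2 != 0.

(** Eliminating the central entries of the inverse makes the curvature identities below rational
    identities in independent variables, so that [field] never has to know that [H] inverts [h]. *)
Lemma inv_i2 i : i != i2 -> H i i2 = - (H i i0 * h i2 i0 + H i i1 * h i2 i1) / h i2 i2.
Proof.
move=> ii2; have := eta_inv i; rewrite (negPf ii2) mulr0n sum3 => /eqP.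
rewrite !(@inv_sym _ h hsym _ i) -/H addr_eq0 => /eqP e.
by apply: (mulIf h22); rewrite mulfVK // mulrC -[LHS]opprK -e; ring.
Qed.

Ltac expandJ := rewrite !(sum3,hconnJ) /J /heis /= (@inv_i2 i0 isT) (@inv_i2 i1 isT)
   -?/H ?(inv_sym hsym i1 i0) -?/H.

(** The group is unimodular, so left-invariant fields are divergence free. *)
Lemma hconn_trace i t : \sum_j hconn j i j t = 0.
Proof. elim/ord3P: i; expandJ; by field. Qed.

Let inv_i2i2 : H i2 i2 = (1 - H i0 i2 * h i2 i0 - H i1 i2 * h i2 i1) / h i2 i2.
Proof.
have := eta_inv i2; rewrite sum3 eqxx => /eqP.
rewrite mulr1n -(inj_eq (addrI (- (h i2 i0 * H i0 i2 + h i2 i1 * H i1 i2)))) addKr => /eqP e.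
by apply: (mulfI h22); rewrite mulrCA mulfV // e; ring.
Qed.

Section WithSymmetricForm.
Variable v : 'M[R]_3.
Hypothesis vs : v^T = v.

Ltac expandM := rewrite !(sum3, mxE, hconnJ) /J /heis /= -/H inv_i2i2
  ?(inv_sym hsym i1 i0) ?(inv_sym hsym i2 i0) ?(inv_sym hsym i2 i1) -/H
  (@inv_i2 i0 isT) (@inv_i2 i1 isT)
  ?(sym_entry vs i1 i0) ?(sym_entry vs i2 i0) ?(sym_entry vs i2 i1)
  ?(inv_sym hsym i1 i0) -/H.

(** Covariant differentiation along an invariant field is skew for the metric, while [v *m H] is
    self-adjoint; the trace of such a product vanishes. *)
Lemma trM_heis i t : \sum_a \sum_k (v *m H) a k * hconn i k a t = 0.
Proof. elim/ord3P: i; expandM; by field. Qed.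

(** The connection is torsion free: exchanging its first two indices costs a bracket, and the
    exchanged sum is the vanishing trace above. *)
Lemma trM_heis' i t : \sum_a \sum_k hconn a i k t * (v *m H) k a =
  - \sum_k heis R i k i2 * (v *m H) i2 k.
Proof. elim/ord3P: i; expandM; by field. Qed.
End WithSymmetricForm.

Let ricci_heis_aux b d t :
  \sum_a \sum_k (hconn b d k t * hconn a k a t - hconn a d k t * hconn b k a t
     - heis R a b k * hconn k d a t)
  = 2^-1 * (H i0 i0 * H i1 i1 - H i0 i1 ^+ 2) * h i2 b * h i2 d
    + 2^-1 * h i2 i2 * (J d i0 * heis R i0 b i2 + J d i1 * heis R i1 b i2).
Proof.
elim/ord3P: b; elim/ord3P: d; expandJ; by field.
Qed.

(** With [n^2 = h22^2 / det h] and the covector [theta = h(e_2, .)], the right-hand side is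
    [n^2 (theta theta / h22 - h / 2)]: the Ricci eigenvalue is [n^2 / 2] on the centre and
    [- n^2 / 2] on the horizontal plane. *)
Lemma ricci_heis b d t :
  \sum_a \sum_k (hconn b d k t * hconn a k a t - hconn a d k t * hconn b k a t
     - heis R a b k * hconn k d a t)
  = h i2 i2 / \det h * (h i2 b * h i2 d - 2^-1 * h i2 i2 * h b d).
Proof.
rewrite ricci_heis_aux.
have D0 := det_neq0 hu.
have sym3 := (sym_entry hsym i1 i0, sym_entry hsym i2 i0, sym_entry hsym i2 i1).
(* Jacobi's formula: a two-by-two minor of the inverse is the complementary entry divided by the
   determinant. *)
have -> : H i0 i0 * H i1 i1 - H i0 i1 ^+ 2 = h i2 i2 / \det h.
  have := det_mx33 h; rewrite !sym3 => e.
  have -> : h i2 i2 / \det h = (h i2 i2 * \det h) / \det h ^+ 2 by field.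
  by rewrite {1}e /H (inv3 hsym hu) /adj3 !mxE /adj3_entry /=; field.
rewrite /J /H (inv3 hsym hu) /adj3 /adj3_entry.
by elim/ord3P: b; elim/ord3P: d; rewrite !mxE /= /heis /=; do ?rewrite sym3; field.
Qed.

(** In the contraction [theta theta] contributes [h22] and the metric contributes 3, leaving
    [h22 - 3/2 h22]. This identifies [nH h] with [h22 / sqrt (det h)]. *)
Lemma scalE : scal h = - (h i2 i2 ^+ 2 / \det h) / 2.
Proof.
rewrite /scal /scalar_curvature.
under eq_bigr => b _ do under eq_bigr => d _ do
  [rewrite /ricci /riemann; under eq_bigr => a _ do rewrite !mul0r subrr add0r; rewrite -/hconn ricci_heis].
have D0 := det_neq0 hu.
rewrite -/H.
have tr : \sum_b \sum_d H b d * h b d = 3.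
  rewrite -[RHS](mxtrace1 R 3) -(mulVmx hu).
  by apply: eq_bigr => b _; rewrite mxE; apply: eq_bigr => d _; rewrite (sym_entry hsym b).
have ee : \sum_b \sum_d H b d * (h i2 b * h i2 d) = h i2 i2.
  rewrite exchange_big (bigD1 i2) //= [X in _ + X]big1 ?addr0.
    transitivity ((\sum_b h i2 b * H b i2) * h i2 i2).
      by rewrite mulr_suml; apply: eq_bigr => b _; ring.
    by rewrite eta_inv eqxx mul1r.
  move=> d di; transitivity ((\sum_b h i2 b * H b d) * h i2 d).
    by rewrite mulr_suml; apply: eq_bigr => b _; ring.
  by rewrite eta_inv (negPf di) mul0r.
transitivity (h i2 i2 / \det h * (h i2 i2 - 2^-1 * h i2 i2 * 3)); last by field.
rewrite -tr -[X in X - _]ee mulr_sumr -sumrB mulr_sumr; apply: eq_bigr => b _.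
rewrite mulr_sumr -sumrB mulr_sumr; apply: eq_bigr => d _.
by ring.
Qed.
End HeisenbergRicci.

(** * Differentiation of scalar and matrix functions *)

Section ScalarDerivatives.
Variable R : realType.
Implicit Types (f g : R -> R) (t : R).

Lemma is_deriveD1 f g t (a b : R) : is_derive t 1 f a -> is_derive t 1 g b ->
  is_derive t 1 (fun x => f x + g x) (a + b).
Proof. by move=> fa gb; exact: is_deriveD. Qed.

Lemma is_deriveB1 f g t (a b : R) : is_derive t 1 f a -> is_derive t 1 g b ->
  is_derive t 1 (fun x => f x - g x) (a - b).
Proof. by move=> fa gb; exact: is_deriveB. Qed.

Lemma is_deriveM1 f g t (a b : R) : is_derive t 1 f a -> is_derive t 1 g b ->
  is_derive t 1 (fun x => f x * g x) (a * g t + f t * b).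
Proof.
move=> fa gb; apply: is_derive_eq (is_deriveM fa gb) _.
by rewrite addrC; congr (_ + _); exact: mulrC.
Qed.

Lemma is_deriveV1 f t (a : R) : f t != 0 -> is_derive t 1 f a ->
  is_derive t 1 (fun x => (f x)^-1) (- a / f t ^+ 2).
Proof.
move=> f0 fa; apply: is_derive_eq (is_deriveV f0 fa) _.
by rewrite scaleNr mulNr; congr (- _); exact: mulrC.
Qed.

Lemma is_derive_sum1 n (F : 'I_n -> R -> R) t (a : 'I_n -> R) :
  (forall i, is_derive t 1 (F i) (a i)) ->
  is_derive t 1 (fun x => \sum_i F i x) (\sum_i a i).
Proof.
move=> Fa; have := is_derive_sum Fa.
by rewrite (_ : \sum_i F i = fun x => \sum_i F i x) // funeqE => x; rewrite fct_sumE.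
Qed.

Lemma is_derive_cst1 (a t : R) : is_derive t 1 (fun=> a) 0.
Proof. exact: is_derive_cst. Qed.

Lemma is_derive_comp1 (f g : R -> R) t (a b : R) : is_derive t 1 f a ->
  is_derive (f t) 1 g b -> is_derive t 1 (fun x => g (f x)) (a * b).
Proof.
by move=> fa gb; apply: is_derive_eq (is_derive1_comp gb fa) _; exact: mulrC.
Qed.

Lemma is_derive_ln1 f t (a : R) : 0 < f t -> is_derive t 1 f a ->
  is_derive t 1 (fun x => ln (f x)) (a / f t).
Proof. by move=> f0 fa; apply: is_derive_comp1 => //; exact: is_derive1_ln. Qed.

Lemma is_derive_sqrt1 f t (a : R) : 0 < f t -> is_derive t 1 f a ->
  is_derive t 1 (fun x => Num.sqrt (f x)) (a / (2 * Num.sqrt (f t))).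
Proof. by move=> f0 fa; apply: is_derive_comp1 => //; exact: is_derive1_sqrt. Qed.

Lemma is_derive_val1 f t (a b : R) : is_derive t 1 f a -> a = b -> is_derive t 1 f b.
Proof. by move=> ? <-. Qed.

Lemma is_derive1E f t (a : R) : is_derive t 1 f a -> derive1 f t = a.
Proof. by move=> fa; rewrite derive1E derive_val. Qed.

Lemma derivable_is_derive f t : derivable f t 1 -> is_derive t 1 f (derive1 f t).
Proof. by move=> ?; rewrite derive1E; exact: DeriveDef. Qed.

Lemma is_derive_near f g t (a : R) : (\forall x \near t, f x = g x) ->
  is_derive t 1 f a -> is_derive t 1 g a.
Proof. exact: near_eq_is_derive. Qed.

Lemma is_derive_uniq f t (a b : R) : is_derive t 1 f a -> is_derive t 1 f b -> a = b.
Proof. by move=> /is_derive1E <- /is_derive1E <-. Qed.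

End ScalarDerivatives.

Section MatrixDerivatives.
Variable R : realType.

Definition is_mderive m n (A : R -> 'M[R]_(m, n)) (t : R) (A' : 'M[R]_(m, n)) :=
  forall i j, is_derive t 1 (fun x => A x i j) (A' i j).

Lemma is_mderive_cst m n (A : 'M[R]_(m, n)) t : is_mderive (fun=> A) t 0.
Proof. by move=> i j; rewrite mxE; exact: is_derive_cst1. Qed.

Lemma is_mderiveD m n (A B : R -> 'M[R]_(m, n)) t A' B' :
  is_mderive A t A' -> is_mderive B t B' -> is_mderive (fun x => A x + B x) t (A' + B').
Proof.
move=> hA hB i j; rewrite mxE.
by under eq_fun do rewrite mxE; exact: is_deriveD1.
Qed.

Lemma is_mderiveZ m n (f : R -> R) (B : R -> 'M[R]_(m, n)) (t f' : R) B' :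
  is_derive t 1 f f' -> is_mderive B t B' ->
  is_mderive (fun x => f x *: B x) t (f' *: B t + f t *: B').
Proof.
move=> hA hB i j; rewrite !mxE.
by under eq_fun do rewrite mxE; exact: is_deriveM1.
Qed.

Lemma is_mderiveM m n p (A : R -> 'M[R]_(m, n)) (B : R -> 'M[R]_(n, p)) t A' B' :
  is_mderive A t A' -> is_mderive B t B' ->
  is_mderive (fun x => A x *m B x) t (A' *m B t + A t *m B').
Proof.
move=> hA hB i j; rewrite !mxE -big_split /=.
under eq_fun do rewrite mxE.
by apply: is_derive_sum1 => k; exact: is_deriveM1.
Qed.

Lemma is_mderive_uniq m n (A : R -> 'M[R]_(m, n)) t A' B' :
  is_mderive A t A' -> is_mderive A t B' -> A' = B'.
Proof. by move=> hA hB; apply/matrixP => i j; apply: is_derive_uniq (hA i j) (hB i j). Qed.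

Lemma is_mderive_val m n (A : R -> 'M[R]_(m, n)) t A' B' :
  is_mderive A t A' -> A' = B' -> is_mderive A t B'.
Proof. by move=> ? <-. Qed.

Lemma is_mderive_near m n (A B : R -> 'M[R]_(m, n)) t A' :
  (\forall x \near t, A x = B x) -> is_mderive A t A' -> is_mderive B t A'.
Proof.
move=> AB hA i j; apply: is_derive_near (hA i j).
by near=> x; have -> : A x = B x by near: x.
Unshelve. all: by end_near. Qed.

Lemma is_derive_det3 (A : R -> 'M[R]_3) t A' :
  is_mderive A t A' -> A t \in unitmx -> (A t)^T = A t -> A'^T = A' ->
  is_derive t 1 (fun x => \det (A x)) (\det (A t) * \tr (invmx (A t) *m A')).
Proof.
move=> hA Au As As'; under eq_fun do rewrite det_mx33.
apply: is_derive_val1.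
  by apply: is_deriveD1; [apply: is_deriveB1|]; apply: is_deriveM1 => //;
    apply: is_deriveB1; apply: is_deriveM1.
rewrite /mxtrace sum3 !mxE !sum3 (inv3 As Au) /adj3 !mxE /adj3_entry /=.
rewrite ?(sym_entry As i1 i0) ?(sym_entry As i2 i0) ?(sym_entry As i2 i1).
rewrite ?(sym_entry As' i1 i0) ?(sym_entry As' i2 i0) ?(sym_entry As' i2 i1).
by field; exact: det_neq0.
Qed.

(** The adjugate formula serves only to show that the entries of the inverse are differentiable; the
    value is then forced by differentiating [A *m invmx A = 1]. *)
Lemma is_mderive_inv (A : R -> 'M[R]_3) t A' :
  is_mderive A t A' ->
  (\forall x \near t, (A x)^T = A x /\ A x \in unitmx) ->
  is_mderive (fun x => invmx (A x)) t (- (invmx (A t) *m A' *m invmx (A t))).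
Proof.
move=> hA Ax; have [As Au] := nbhs_singleton Ax.
have dd : derivable (fun x => \det (A x)) t 1.
  suff [d] : exists d, is_derive t 1 (fun x => \det (A x)) d by case.
  eexists; under eq_fun do rewrite det_mx33.
  by apply: is_deriveD1; [apply: is_deriveB1|]; apply: is_deriveM1 => //;
    apply: is_deriveB1; apply: is_deriveM1.
have dV := is_deriveV1 (det_neq0 Au) (derivable_is_derive dd).
have dH i j : derivable (fun x => invmx (A x) i j) t 1.
  suff [d] : exists d, is_derive t 1 (fun x => invmx (A x) i j) d by case.
  have nE : \forall x \near t, (\det (A x))^-1 * adj3 (A x) i j = invmx (A x) i j.
    near=> x; have [xs xu] : (A x)^T = A x /\ A x \in unitmx by near: x.
    by rewrite (inv3 xs xu) [RHS]mxE.
  suff [d hd] : exists d, is_derive t 1 (fun x => adj3 (A x) i j) d.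
    by eexists; apply: is_derive_near nE (is_deriveM1 dV hd).
  have aE : (fun x => adj3 (A x) i j) = (fun x => adj3_entry (A x) i j).
    by apply/funext => x; rewrite /adj3 mxE.
  rewrite aE; elim/ord3P: i {nE aE}; elim/ord3P: j; rewrite /adj3_entry /=; eexists;
    apply: is_deriveB1; apply: is_deriveM1; exact: hA.
have hH : is_mderive (fun x => invmx (A x)) t (\matrix_(i, j) derive1 (fun x => invmx (A x) i j) t).
  by move=> i j; rewrite mxE; exact: derivable_is_derive.
have e := is_mderiveM hA hH.
have e1 : is_mderive (fun x => A x *m invmx (A x)) t 0.
  apply: is_mderive_near (is_mderive_cst 1%:M t).
  by near=> x; rewrite mulmxV //; have [] : (A x)^T = A x /\ A x \in unitmx by near: x.
have := is_mderive_uniq e e1; move/eqP; rewrite addrC addr_eq0 => /eqP /(congr1 (mulmx (invmx (A t)))).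
by rewrite mulKmx // => e2; rewrite -mulmxA -mulmxN -e2.
Unshelve. all: by end_near. Qed.

End MatrixDerivatives.

(** * The Ricci tensor of a homogeneous spacetime *)

Local Notation tm := (@lshift 1 3 ord0).
Local Notation sp i := (@rshift 1 3 i).

Section SpacetimeRicci.
Variables (R : realType) (h_ : R -> 'M[R]_3).

(* The second fundamental form [K]. *)
Definition velocity (x : R) : 'M[R]_3 :=
  \matrix_(i, j) (2^-1 * derive1 (fun u => h_ u i j) x).

Lemma is_mderive_velocity t : (forall i j, derivable (fun x => h_ x i j) t 1) ->
  is_mderive h_ t (2 *: velocity t).
Proof.
move=> hd i j; rewrite !mxE mulrA divff // mul1r.
exact: derivable_is_derive.
Qed.

Local Notation g := (spacetime_metric h_).
Local Notation w := (@time_component R).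
Local Notation c := (@spacetime_bracket R).
Local Notation conn := (connection w c g).
Local Notation M x := (velocity x *m invmx (h_ x)).

Let wt : w tm = 1. Proof. by []. Qed.
Let ws i : w (sp i) = 0. Proof. by []. Qed.

Let ctl b d : c tm b d = 0.
Proof. by rewrite /spacetime_bracket -/(unsplit (inl ord0)) unsplitK. Qed.
Let ctm a d : c a tm d = 0.
Proof.
rewrite /spacetime_bracket -/(unsplit (inl ord0)) unsplitK.
by case: (fintype.split a).
Qed.
Let ctr a b : c a b tm = 0.
Proof.
rewrite /spacetime_bracket -/(unsplit (inl ord0)) unsplitK.
by case: (fintype.split a) => // ?; case: (fintype.split b).
Qed.
Let csp i j k : c (sp i) (sp j) (sp k) = heis R i j k.
Proof.
rewrite /spacetime_bracket.
have s l : fintype.split (sp l) = inr l by exact: (unsplitK (inr l)).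
by rewrite !s.
Qed.
Let cE := (ctl, ctm, ctr, csp).

Let gtt x : g x tm tm = -1.
Proof. by rewrite /spacetime_metric block_mxEul !mxE mulr1n. Qed.
Let gts x i : g x tm (sp i) = 0.
Proof. by rewrite /spacetime_metric block_mxEur mxE. Qed.
Let gst x i : g x (sp i) tm = 0.
Proof. by rewrite /spacetime_metric block_mxEdl mxE. Qed.
Let gss x i j : g x (sp i) (sp j) = h_ x i j.
Proof. by rewrite /spacetime_metric block_mxEdr. Qed.

Let dtt x : derive1 (fun u => g u tm tm) x = 0.
Proof. by under eq_fun do rewrite gtt; rewrite derive1_cst. Qed.
Let dts x i : derive1 (fun u => g u tm (sp i)) x = 0.
Proof. by under eq_fun do rewrite gts; rewrite derive1_cst. Qed.
Let dst x i : derive1 (fun u => g u (sp i) tm) x = 0.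
Proof. by under eq_fun do rewrite gst; rewrite derive1_cst. Qed.
Let dss x i j : derive1 (fun u => g u (sp i) (sp j)) x = 2 * velocity x i j.
Proof. by under eq_fun do rewrite gss; rewrite mxE mulrA divff ?mul1r. Qed.
Let dE := (dtt, dts, dst, dss).

Let sum4 (F : 'I_(1 + 3) -> R) : \sum_a F a = F tm + \sum_i F (sp i).
Proof. by rewrite big_split_ord /= big_ord1. Qed.

Let kttt x : koszul w c g tm tm tm x = 0.
Proof. by rewrite /koszul sum4 big1 => [|k _]; rewrite !(dE, cE, ws, wt, gts, gst); ring. Qed.
Let ktts x j : koszul w c g tm tm (sp j) x = 0.
Proof. by rewrite /koszul sum4 big1 => [|k _]; rewrite !(dE, cE, ws, wt, gts, gst); ring. Qed.
Let ktst x i : koszul w c g tm (sp i) tm x = 0.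
Proof. by rewrite /koszul sum4 big1 => [|k _]; rewrite !(dE, cE, ws, wt, gts, gst); ring. Qed.
Let ktss x i j : koszul w c g tm (sp i) (sp j) x = velocity x i j.
Proof. by rewrite /koszul sum4 big1 => [|k _]; rewrite !(dE, cE, ws, wt, gts, gst); field. Qed.
Let kstt x i : koszul w c g (sp i) tm tm x = 0.
Proof. by rewrite /koszul sum4 big1 => [|k _]; rewrite !(dE, cE, ws, wt, gts, gst); ring. Qed.
Let ksts x i j : koszul w c g (sp i) tm (sp j) x = velocity x i j.
Proof. by rewrite /koszul sum4 big1 => [|k _]; rewrite !(dE, cE, ws, wt, gts, gst); field. Qed.
Let ksst x i j : koszul w c g (sp i) (sp j) tm x = - velocity x i j.
Proof. by rewrite /koszul sum4 big1 => [|k _]; rewrite !(dE, cE, ws, wt, gts, gst); field. Qed.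
Let ksss x i j k : koszul w c g (sp i) (sp j) (sp k) x =
  koszul (fun=> 0 : R) (@heis R) (fun=> h_ x) i j k x.
Proof.
rewrite /koszul sum4 !cE !ws !mul0r !subr0 !add0r.
by congr (_ * _); apply: eq_bigr => l _; rewrite !cE !gss.
Qed.

Section Pointwise.
Variable x : R.
Hypothesis hu : h_ x \in unitmx.

Let inv_block : invmx (g x) = block_mx (- 1%:M) 0 0 (invmx (h_ x)).
Proof.
have e : - 1%:M = (-1)%:M :> 'M[R]_1 by rewrite rmorphN.
rewrite /spacetime_metric e invmx_block_diag ?invmx_scalar ?invrN1 //.
by rewrite block_diag_mx_unit hu andbT unitmxE det_scalar1 unitrN1.
Qed.

Let ntt : invmx (g x) tm tm = -1.
Proof. by rewrite inv_block block_mxEul !mxE mulr1n. Qed.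
Let nts i : invmx (g x) tm (sp i) = 0.
Proof. by rewrite inv_block block_mxEur mxE. Qed.
Let nst i : invmx (g x) (sp i) tm = 0.
Proof. by rewrite inv_block block_mxEdl mxE. Qed.
Let nss i j : invmx (g x) (sp i) (sp j) = invmx (h_ x) i j.
Proof. by rewrite inv_block block_mxEdr. Qed.

Lemma conn_tt e : conn tm tm e x = 0.
Proof.
by rewrite /connection sum4 kttt mul0r add0r big1 // => i _; rewrite ktts mul0r.
Qed.
Lemma conn_tst i : conn tm (sp i) tm x = 0.
Proof.
by rewrite /connection sum4 ktst mul0r add0r big1 // => j _; rewrite nst mulr0.
Qed.
Lemma conn_tss i k : conn tm (sp i) (sp k) x = M x i k.
Proof.
rewrite /connection sum4 ktst mul0r add0r [RHS]mxE.
by apply: eq_bigr => j _; rewrite nss ktss.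
Qed.
Lemma conn_stt i : conn (sp i) tm tm x = 0.
Proof.
by rewrite /connection sum4 kstt mul0r add0r big1 // => j _; rewrite nst mulr0.
Qed.
Lemma conn_sts i k : conn (sp i) tm (sp k) x = M x i k.
Proof.
rewrite /connection sum4 kstt mul0r add0r [RHS]mxE.
by apply: eq_bigr => j _; rewrite nss ksts.
Qed.
Lemma conn_sst i j : conn (sp i) (sp j) tm x = velocity x i j.
Proof.
rewrite /connection sum4 ksst ntt mulrN1 opprK big1 ?addr0 // => k _.
by rewrite nst mulr0.
Qed.
Lemma conn_sss i j k : conn (sp i) (sp j) (sp k) x = hconn (h_ x) i j k x.
Proof.
rewrite /connection sum4 nts mulr0 add0r; apply: eq_bigr => l _.
by rewrite ksss nss.
Qed.
Definition connE := (conn_tt, conn_tst, conn_tss, conn_stt, conn_sts, conn_sst, conn_sss).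
End Pointwise.

Variable t : R.
Hypothesis good : \forall x \near t, (h_ x)^T = h_ x /\ h_ x \in unitmx.
Hypothesis h22 : \forall x \near t, h_ x i2 i2 != 0.

Let goodt : (h_ t)^T = h_ t /\ h_ t \in unitmx := nbhs_singleton good.
Let hs := goodt.1.
Let hu := goodt.2.

Let derive1_near (f1 f2 : R -> R) :
  (\forall x \near t, f1 x = f2 x) -> derive1 f1 t = derive1 f2 t.
Proof. by move=> e; rewrite !derive1E; apply: near_eq_derive. Qed.

Lemma velocity_sym : (velocity t)^T = velocity t.
Proof.
apply/matrixP => i j; rewrite !mxE; congr (_ * _); apply: derive1_near.
by near=> x; rewrite sym_entry //; have [] : (h_ x)^T = h_ x /\ h_ x \in unitmx by near: x.
Unshelve. all: by end_near. Qed.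

Let riemann_s i b d e : riemann w c g (sp i) (sp b) d e t =
  \sum_k (conn (sp b) d k t * conn (sp i) k e t - conn (sp i) d k t * conn (sp b) k e t
         - c (sp i) (sp b) k * conn k d e t).
Proof. by rewrite /riemann !ws !mul0r subrr add0r. Qed.

Let ccE := connE hu.

(** The Raychaudhuri equation; [M t] is the transposed Weingarten map. *)
Lemma ricci_tt : ricci w c g tm tm t =
  - \sum_i derive1 (fun x => M x i i) t - \tr (M t *m M t).
Proof.
rewrite /ricci sum4 {1}/riemann subrr add0r big1 ?add0r => [|k _]; last first.
  by rewrite ctl mul0r subrr subr0.
rewrite -sumrN -sumrB; apply: eq_bigr => i _.
rewrite /riemann ws wt mul0r mul1r sub0r; congr (- _ + _).
  apply: derive1_near; near=> x; rewrite conn_sts //.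
  by have [] : (h_ x)^T = h_ x /\ h_ x \in unitmx by near: x.
rewrite sum4 !ccE !cE !(mul0r, mulr0) !subr0 add0r mxE -sumrN.
by apply: eq_bigr => k _; rewrite !ccE !cE !(mul0r, mulr0) sub0r subr0.
Unshelve. all: by end_near. Qed.

Let h2 : h_ t i2 i2 != 0 := nbhs_singleton h22.

(** The momentum constraint. Of the divergence of [K] only the bracket term survives: one term is a
    divergence of invariant fields, another pairs the self-adjoint [M t] with a skew map. *)
Lemma ricci_st i : ricci w c g (sp i) tm t = \sum_k heis R i k i2 * M t i2 k.
Proof.
rewrite /ricci sum4.
have -> : riemann w c g tm (sp i) tm tm t = 0.
  rewrite /riemann ws wt mul0r mul1r subr0 (@derive1_near _ (fun=> 0)).
    rewrite derive1_cst add0r sum4 !ccE !cE !(mul0r, mulr0) !subr0 add0r big1 // => k _.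
    by rewrite !ccE !cE !(mul0r, mulr0) !subr0.
  near=> x; rewrite conn_stt //.
  by have [] : (h_ x)^T = h_ x /\ h_ x \in unitmx by near: x.
rewrite add0r.
transitivity (\sum_a (\sum_k M t i k * hconn (h_ t) a k a t
    - \sum_k M t a k * hconn (h_ t) i k a t - heis R a i i2 * M t i2 a)).
  apply: eq_bigr => a _; rewrite riemann_s sum4 !ccE !cE !(mul0r, mulr0) !subr0 add0r.
  rewrite !sumrB; under eq_bigr do rewrite !ccE; congr (_ - _ - _).
    by apply: eq_bigr => k _; rewrite !ccE.
  rewrite sum3 !cE !ccE (heisE R _ _ i0) (heisE R _ _ i1) /=; ring.
rewrite !sumrB exchange_big /= big1 => [|k _]; last first.
  by rewrite -mulr_sumr hconn_trace ?mulr0.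
rewrite (trM_heis hs hu h2 velocity_sym) subrr sub0r -sumrN; apply: eq_bigr => k _.
by rewrite -mulNr; congr (_ * _); rewrite /heis; elim/ord3P: i; elim/ord3P: k; rewrite /=; ring.
Unshelve. all: by end_near. Qed.

(** The evolution equation: the last line is the Ricci tensor of the slice, the other terms come
    from its second fundamental form. *)
Lemma ricci_ss i j : ricci w c g (sp i) (sp j) t =
  derive1 (fun x => velocity x i j) t - 2 * (M t *m velocity t) i j
  + \tr (M t) * velocity t i j
  + h_ t i2 i2 / \det (h_ t) * (h_ t i2 i * h_ t i2 j - 2^-1 * h_ t i2 i2 * h_ t i j).
Proof.
rewrite /ricci sum4.
have -> : riemann w c g tm (sp i) (sp j) tm t =
    derive1 (fun x => velocity x i j) t - (M t *m velocity t) i j.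
  rewrite /riemann ws wt mul0r mul1r subr0; congr (_ + _).
    apply: derive1_near; near=> x; rewrite conn_sst //.
    by have [] : (h_ x)^T = h_ x /\ h_ x \in unitmx by near: x.
  rewrite sum4 !ccE !cE !(mul0r, mulr0) !subr0 add0r.
  have -> : M t *m velocity t = (M t *m velocity t)^T.
    by rewrite !trmx_mul trmx_inv hs velocity_sym mulmxA.
  rewrite [in RHS]mxE [in RHS]mxE -sumrN; apply: eq_bigr => k _.
  by rewrite !ccE !cE !(mul0r, mulr0) subr0 sub0r (sym_entry velocity_sym i).
rewrite -(ricci_heis hs hu h2 i j t).
transitivity (derive1 (fun x => velocity x i j) t - (M t *m velocity t) i j +
  \sum_a ((velocity t i j * M t a a - M t i a * velocity t a j) +
   \sum_k (hconn (h_ t) i j k t * hconn (h_ t) a k a t - hconn (h_ t) a j k t * hconn (h_ t) i k a t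
     - heis R a i k * hconn (h_ t) k j a t))).
  congr (_ + _); apply: eq_bigr => a _; rewrite riemann_s sum4 !ccE !cE mul0r subr0.
  rewrite [velocity t a j * _]mulrC; congr (_ + _).
  by apply: eq_bigr => k _; rewrite !ccE !cE.
rewrite big_split /= sumrB -mulr_sumr -/(\tr (M t)) [(M t *m velocity t) i j]mxE.
by ring.
Unshelve. all: by end_near. Qed.

Hypothesis hd : forall i j, derivable (fun x => h_ x i j) t 1.

(** Ricci flatness is asserted for both orders of the arguments. In this order time derivatives of
    the connection appear; they add up to the derivative of [hconn_trace], which vanishes
    identically, and [hd] is there to differentiate that sum term by term. *)
Lemma ricci_ts i : ricci w c g tm (sp i) t = \sum_k heis R i k i2 * M t i2 k.
Proof.
rewrite /ricci sum4.
have -> : riemann w c g tm tm (sp i) tm t = 0.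
  by rewrite /riemann subrr add0r big1 // => k _; rewrite cE mul0r subrr subr0.
rewrite add0r.
transitivity (\sum_a (- derive1 (conn (sp a) (sp i) (sp a)) t
    + (\sum_k M t i k * hconn (h_ t) a k a t
    - \sum_k hconn (h_ t) a i k t * M t k a))).
  apply: eq_bigr => a _; rewrite /riemann ws wt mul0r mul1r sub0r.
  rewrite sum4 !ccE !cE !(mul0r, mulr0) !subr0 add0r -sumrB; congr (_ + _).
  by apply: eq_bigr => k _; rewrite !ccE !cE mul0r subr0.
have tr0 : \sum_a \sum_k M t i k * hconn (h_ t) a k a t = 0.
  rewrite exchange_big /= big1 // => k _.
  by rewrite -mulr_sumr hconn_trace ?mulr0.
rewrite big_split /= sumrB (trM_heis' hs hu h2 velocity_sym) tr0.
rewrite sub0r opprK sumrN -[RHS]add0r; congr (_ + _).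
have hH := is_mderive_inv (is_mderive_velocity hd) good.
have dc a : derivable (conn (sp a) (sp i) (sp a)) t 1.
  suff [d] : exists d, is_derive t 1 (conn (sp a) (sp i) (sp a)) d by case.
  eexists; apply: (@is_derive_near _ (fun x => hconn (h_ x) a i a x)).
    near=> x; rewrite conn_sss //.
    by have [] : (h_ x)^T = h_ x /\ h_ x \in unitmx by near: x.
  under eq_fun do rewrite hconnE.
  pose F x d := 2^-1 * (heis R a i i2 * h_ x i2 d - heis R a d i2 * h_ x i2 i - heis R i d i2 * h_ x i2 a).
  have X d : is_derive t 1 (F^~ d) (derive1 (F^~ d) t).
    apply: derivable_is_derive.
    by apply: derivableM => //; apply: derivableB; [apply: derivableB|]; apply: derivableM.
  exact: (is_derive_sum1 (fun d => is_deriveM1 (X d) (hH d a))).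
have ds := is_derive_sum1 (fun a => derivable_is_derive (dc a)).
apply/eqP; rewrite oppr_eq0 -(is_derive1E ds); apply/eqP.
rewrite -[RHS](derive1_cst (0 : R) t); apply: derive1_near; near=> x.
have [xs xu] : (h_ x)^T = h_ x /\ h_ x \in unitmx by near: x.
under eq_bigr do rewrite conn_sss //.
by apply: hconn_trace => //; near: x.
Unshelve. all: by end_near. Qed.

End SpacetimeRicci.

(** * Integration of the vacuum equations *)

Section InnerProducts.
Variables (R : realType).
Implicit Types (h A : 'M[R]_3) (x y v : 'cV[R]_3).

Definition e2 : 'cV[R]_3 := delta_mx i2 0.

Lemma formE h x y : form h x y = \sum_i \sum_j x i 0 * h i j * y j 0.
Proof.
rewrite /form mxE exchange_big /=; apply: eq_bigr => j _.
rewrite mxE mulr_suml; apply: eq_bigr => i _.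
by rewrite mxE.
Qed.

Lemma form_e2 h v : form h v e2 = \sum_i v i 0 * h i i2.
Proof.
rewrite formE; apply: eq_bigr => i _.
by rewrite !sum3 !mxE /= !mulr0 !add0r mulr1.
Qed.

Lemma form_sym h x y : h^T = h -> form h x y = form h y x.
Proof.
move=> hs; rewrite !formE exchange_big; apply: eq_bigr => i _; apply: eq_bigr => j _.
by rewrite (sym_entry hs j i); ring.
Qed.

Lemma central_e2 : central e2.
Proof.
move=> y; apply/matrixP => k j; rewrite !mxE big1 // => i _; rewrite big1 // => l _.
by rewrite !mxE /heis; elim/ord3P: i; rewrite /= ?mulr0 ?mul0r // subrr !mul0r.
Qed.

Lemma centralP z : central z -> z = z i2 0 *: e2.
Proof.
move=> zc; have := zc (delta_mx i1 0); have := zc (delta_mx i0 0).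
move=> /(congr1 (fun B : 'cV[R]_3 => B i2 0)) + /(congr1 (fun B : 'cV[R]_3 => B i2 0)).
rewrite !mxE !sum3 !mxE /heis /= => a b.
apply/matrixP; elim/ord3P => j; rewrite ord1 !mxE /= ?mulr1 ?mulr0 //; lra.
Qed.

Lemma horizontalP h v : horizontal h v <-> form h v e2 = 0.
Proof.
split=> [hv|v0 z zc]; first exact: hv central_e2.
by rewrite (centralP zc) /form -scalemxAr mxE -/(form h v e2) v0 mulr0.
Qed.

Section PositiveDefinite.
Variable h : 'M[R]_3.
Hypothesis hp : inner_product h.
Let hs := hp.1.

Let pos (v : 'I_3 -> R) : (exists i, v i != 0) ->
  0 < \sum_i \sum_j v i * h i j * v j.
Proof.
move=> [i vi]; have := hp.2 (\col_i v i); rewrite formE.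
have -> : \sum_i \sum_j (\col_i v i : 'cV_3) i 0 * h i j * (\col_i v i : 'cV_3) j 0 =
  \sum_i \sum_j v i * h i j * v j.
  by apply: eq_bigr => k _; apply: eq_bigr => l _; rewrite !mxE.
apply; apply: contra_neq vi => /matrixP /(_ i 0); by rewrite !mxE.
Qed.

Ltac sym3 := rewrite ?(sym_entry hs i1 i0) ?(sym_entry hs i2 i0) ?(sym_entry hs i2 i1).

Lemma inner_h22_gt0 : 0 < h i2 i2.
Proof.
have := @pos (fun i => (i == i2)%:R); rewrite !sum3 /= !(mulr0,mul0r,mulr1,mul1r,add0r).
by apply; exists i2; rewrite /= oner_eq0.
Qed.

Let minor_gt0 : 0 < h i1 i1 * h i2 i2 - h i1 i2 * h i1 i2.
Proof.
have g0 := inner_h22_gt0.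
(* The test vector [h22 e_1 - h12 e_2] is orthogonal to the centre, and its square length is [h22]
   times the minor. *)
have := @pos (fun i => (i == i1)%:R * h i2 i2 - (i == i2)%:R * h i1 i2).
rewrite !sum3 /=; sym3 => H.
rewrite -(pmulr_rgt0 _ g0); apply: lt_le_trans (H _) _.
  by exists i1 => /=; rewrite mul1r mul0r subr0 gt_eqF.
by rewrite le_eqVlt; apply/orP; left; apply/eqP; ring.
Qed.

Lemma inner_det_gt0 : 0 < \det h.
Proof.
have m0 := minor_gt0.
(* [h] maps the first row of the adjugate to [det h * e_0], so its square length is the determinant
   times the minor. *)
have := @pos (fun i => adj3_entry h i 0); rewrite !sum3 /adj3_entry /=.
rewrite det_mx33; sym3 => H.
rewrite -(pmulr_rgt0 _ m0); apply: lt_le_trans (H _) _.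
  by exists i0 => /=; rewrite gt_eqF.
by rewrite le_eqVlt; apply/orP; left; apply/eqP; ring.
Qed.

Lemma inner_unit : h \in unitmx.
Proof. by rewrite unitmxE unitfE gt_eqF ?inner_det_gt0. Qed.

Lemma nHE : nH h = h i2 i2 / Num.sqrt (\det h).
Proof.
have g0 := inner_h22_gt0; have d0 := inner_det_gt0.
rewrite /nH (scalE hs inner_unit) ?gt_eqF //.
have -> : -2 * (- (h i2 i2 ^+ 2 / \det h) / 2) = h i2 i2 ^+ 2 / \det h by field; rewrite gt_eqF.
by rewrite sqrtrM ?sqr_ge0 // sqrtr_sqr gtr0_norm // sqrtrV // ltW.
Qed.

Lemma nH_gt0 : 0 < nH h.
Proof. by rewrite nHE divr_gt0 ?inner_h22_gt0 ?sqrtr_gt0 ?inner_det_gt0. Qed.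
End PositiveDefinite.

Definition basis3 x y z : 'M[R]_3 :=
  \matrix_(i, j) (nth 0 [:: x; y; z] j) i 0.

Lemma col_basis3 x y z j : col j (basis3 x y z) = nth 0 [:: x; y; z] j.
Proof. by apply/matrixP => i k; rewrite !mxE ord1. Qed.

Lemma gram_basis3 h x y z i j : ((basis3 x y z)^T *m h *m basis3 x y z) i j =
  form h (nth 0 [:: x; y; z] i) (nth 0 [:: x; y; z] j).
Proof.
rewrite -!col_basis3 /form !mxE; apply: eq_bigr => k _; rewrite !mxE.
by congr (_ * _); apply: eq_bigr => l _; rewrite !mxE.
Qed.
End InnerProducts.

(** * Adapted frames and the eigenvalues of the trace-free part *)

Section AdaptedBasis.
Variables (R : realType).
Implicit Types (h A : 'M[R]_3) (x y v : 'cV[R]_3).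

Definition diag3 (a b c : R) : 'M[R]_3 := diag_mx (\row_j nth 0 [:: a; b; c] j).

Lemma diag3M a b c a' b' c' :
  diag3 a b c *m diag3 a' b' c' = diag3 (a * a') (b * b') (c * c').
Proof.
rewrite /diag3 mulmx_diag; congr diag_mx; apply/rowP; elim/ord3P; by rewrite !mxE.
Qed.

Lemma diag3_tr a b c : \tr (diag3 a b c) = a + b + c.
Proof. by rewrite mxtrace_diag sum3 !mxE. Qed.

Lemma diag3_1 : diag3 1 1 1 = 1%:M.
Proof.
apply/matrixP; elim/ord3P; elim/ord3P; by rewrite /diag3 !mxE.
Qed.

Lemma det_diag3 a b c : \det (diag3 a b c) = a * b * c.
Proof. by rewrite /diag3 det_diag !big_ord_recl big_ord0 !mxE /= mulr1 mulrA. Qed.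

Lemma diag3T a b c : (diag3 a b c)^T = diag3 a b c.
Proof. exact: tr_diag_mx. Qed.

Lemma mul_basis3 A x y z : A *m basis3 x y z = basis3 (A *m x) (A *m y) (A *m z).
Proof.
by apply/matrixP => i; elim/ord3P; rewrite [LHS]mxE [RHS]mxE /= mxE; apply: eq_bigr => k _; congr (_ * _); rewrite mxE.
Qed.

Lemma basis3_scale x y z a b c :
  basis3 (a *: x) (b *: y) (c *: z) = basis3 x y z *m diag3 a b c.
Proof.
by apply/matrixP => i; elim/ord3P; rewrite /diag3 !mxE /= sum3 !mxE /= ?(mulr0,addr0,add0r); rewrite mulrC.
Qed.

Section Adapted.
Variables (h : 'M[R]_3) (Xm Xp : 'cV[R]_3).
Hypothesis hp : inner_product h.
Hypothesis um : unit_horizontal h Xm.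
Hypothesis up : unit_horizontal h Xp.
Hypothesis mp : form h Xm Xp = 0.
Let hs := hp.1.
Let g := h i2 i2.

Definition frame := basis3 Xm Xp (@e2 R).
Definition coframe := invmx frame.

Lemma form_e2_e2 : form h (@e2 R) (@e2 R) = g.
Proof. by rewrite form_e2 sum3 !mxE /= !mul0r !add0r mul1r. Qed.

Lemma gram_frame : frame^T *m h *m frame = diag3 1 1 g.
Proof.
have [/horizontalP hm m1] := um; have [/horizontalP hpl p1] := up.
apply/matrixP; elim/ord3P; elim/ord3P; rewrite gram_basis3 /diag3 !mxE /= ?mulr1n ?mulr0n //.
- by rewrite form_sym.
- by rewrite form_sym.
- by rewrite form_sym.
exact: form_e2_e2.
Qed.

Let g0 : g != 0. Proof. by rewrite gt_eqF // inner_h22_gt0. Qed.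

Lemma frame_unit : frame \in unitmx.
Proof.
have : frame^T *m h *m frame \in unitmx.
  by rewrite gram_frame unitmxE unitfE det_diag3 !mul1r.
by rewrite unitmx_mul => /andP[].
Qed.

Lemma coframeM : coframe *m frame = 1%:M. Proof. exact: mulVmx frame_unit. Qed.
Lemma frameM : frame *m coframe = 1%:M. Proof. exact: mulmxV frame_unit. Qed.

Lemma coframeTM : frame^T *m coframe^T = 1%:M.
Proof. by rewrite -trmx_mul coframeM trmx1. Qed.
Lemma frameTM : coframe^T *m frame^T = 1%:M.
Proof. by rewrite -trmx_mul frameM trmx1. Qed.

Lemma metric_coframe : h = coframe^T *m diag3 1 1 g *m coframe.
Proof.
rewrite -gram_frame !mulmxA frameTM mul1mx -mulmxA frameM mulmx1 //.
Qed.

Section Eigen.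
Variables (A : 'M[R]_3) (a b : R).
Hypothesis Ae2 : A *m (@e2 R) = 0.
Hypothesis Am : A *m Xm = a *: Xm.
Hypothesis Ap : A *m Xp = b *: Xp.

Lemma eigen_frame : A = frame *m diag3 a b 0 *m coframe.
Proof.
rewrite -basis3_scale -Am -Ap scale0r -Ae2 -mul_basis3 -mulmxA frameM mulmx1 //.
Qed.

Lemma eigen_trace : \tr A = a + b.
Proof.
by rewrite eigen_frame mxtrace_mulC mulmxA coframeM mul1mx diag3_tr addr0.
Qed.

Lemma eigen_hs : hs_norm h A = Num.sqrt (a ^+ 2 + b ^+ 2).
Proof.
rewrite /hs_norm; congr (Num.sqrt _).
have iE : invmx h = frame *m diag3 1 1 g^-1 *m frame^T.
  apply: (can_inj (mulKmx (inner_unit hp))); rewrite mulmxV ?inner_unit //.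
  rewrite metric_coframe !mulmxA -[_ *m coframe *m frame]mulmxA coframeM mulmx1.
  by rewrite -[_ *m diag3 1 1 g *m _]mulmxA diag3M !mulr1 mulfV // diag3_1 mulmx1 frameTM.
rewrite iE eigen_frame {1}metric_coframe !trmx_mul diag3T !mulmxA.
rewrite -[_ *m frame^T *m coframe^T]mulmxA coframeTM mulmx1.
rewrite -[_ *m frame^T *m coframe^T]mulmxA coframeTM mulmx1.
rewrite -[_ *m coframe *m frame]mulmxA coframeM mulmx1.
rewrite -!mulmxA mxtrace_mulC -!mulmxA coframeM mulmx1 !diag3M diag3_tr.
by rewrite !(mul1r, mul0r, mulr0) addr0 !expr2.
Qed.
End Eigen.
End Adapted.

(** Reduces [A] to one number [mu]: vanishing trace makes the eigenvalues opposite, and for [A != 0]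
    self-adjointness with distinct eigenvalues makes the eigenvectors orthogonal. For [A = 0] the
    same conclusions hold with [mu = 0], so the case disappears from the rest of the proof. *)
Lemma principal_basis h A Xm Xp : inner_product h -> tracefree_selfadjoint h A ->
  principal_pair h A Xm Xp ->
  exists2 mu, 0 <= mu & [/\ A *m Xm = - mu *: Xm, A *m Xp = mu *: Xp,
    form h Xm Xp = 0 & hs_norm h A = Num.sqrt 2 * mu].
Proof.
move=> hp [Ac Ah At As] [um upl An0 A0].
have Ae2 : A *m (@e2 R) = 0 by exact: Ac (@central_e2 R).
have [A_eq|A_neq] := eqVneq A 0.
  exists 0 => //; have mp := A0 A_eq.
  have z (X : 'cV[R]_3) c : c = 0 -> A *m X = c *: X by move=> ->; rewrite A_eq mul0mx scale0r.
  split=> //; [exact/z/oppr0|exact: z|].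
  rewrite (eigen_hs hp um upl mp Ae2 (z _ 0 erefl) (z _ 0 erefl)).
  by rewrite expr0n addr0 sqrtr0 mulr0.
have [[a a0 Am] [b b0 Ap]] := An0 A_neq.
have mp : form h Xm Xp = 0.
  have := As _ _ um.1 upl.1; rewrite Am Ap /form -!scalemxAr [(_ *: Xm)^T]linearZ /=.
  rewrite -!scalemxAl !mxE -/(form h Xm Xp) => /eqP.
  rewrite -subr_eq0 -mulrBl mulf_eq0 subr_eq0 => /orP[/eqP ab|/eqP //].
  by move: a0; rewrite ab ltNge ltW.
exists b; first exact: ltW.
have := eigen_trace hp um upl mp Ae2 Am Ap; rewrite At => /esym/eqP.
rewrite addr_eq0 => /eqP ab; split=> //; first by rewrite -ab.
rewrite (eigen_hs hp um upl mp Ae2 Am Ap) ab.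
have -> : (- b) ^+ 2 + b ^+ 2 = 2 * b ^+ 2 by ring.
by rewrite sqrtrM // sqrtr_sqr gtr0_norm.
Qed.
End AdaptedBasis.

Section OpenIntervals.
Variables (R : realType) (a b : \bar R).

Definition within_dom (t : R) := (a < t%:E)%E /\ (t%:E < b)%E.

Lemma within_dom_near t : within_dom t -> \forall x \near t, within_dom x.
Proof.
move=> [at_ tb]; near=> x; split.
- near: x; case: a at_ => [r| |] //=; last by move=> _; near=> x; rewrite ltNyr.
  by rewrite lte_fin => rt; near=> x; rewrite lte_fin; near: x; exact: lt_nbhsr.
- near: x; case: b tb => [r| |] //=; last by move=> _; near=> x; rewrite ltry.
  by rewrite lte_fin => rt; near=> x; rewrite lte_fin; near: x; exact: lt_nbhsl.
Unshelve. all: by end_near. Qed.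

Lemma within_dom_itv x y z : within_dom x -> within_dom y -> x <= z <= y -> within_dom z.
Proof.
move=> [ax _] [_ yb] /andP[xz zy]; split.
  by apply: lt_le_trans ax _; rewrite lee_fin.
by apply: le_lt_trans yb; rewrite lee_fin.
Qed.

Lemma within_dom_cst (f : R -> R) : (forall t, within_dom t -> is_derive t 1 f 0) ->
  forall x y, within_dom x -> within_dom y -> f x = f y.
Proof.
move=> fd x y; wlog xy : x y / x <= y => [H|] dx dy.
  by case/orP: (le_total x y) => xy; [|symmetry]; apply: H.
have := @MVT_segment R f (fun=> 0) x y xy.
move=> [z zxy||c _].
- apply: fd; apply: within_dom_itv dx dy _; move: zxy; rewrite in_itv /= => /andP[? ?].
  by rewrite !ltW.
- apply: derivable_within_continuous => z; rewrite in_itv /= => zxy.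
  by have [] := fd z (within_dom_itv dx dy zxy).
by rewrite mul0r => /eqP; rewrite subr_eq0 => /eqP.
Qed.

Lemma within_dom_mcst m n (F : R -> 'M[R]_(m, n)) :
  (forall t, within_dom t -> is_mderive F t 0) ->
  forall x y, within_dom x -> within_dom y -> F x = F y.
Proof.
move=> Fd x y dx dy; apply/matrixP => i j.
apply: (@within_dom_cst (fun t => F t i j)) => // t dt.
by have := Fd t dt i j; rewrite mxE.
Qed.
End OpenIntervals.

(** * Conserved quantities of a vacuum development *)

Section VacuumEquations.
Variables (R : realType) (a b : \bar R) (h_ : R -> 'M[R]_3).
Hypothesis dev : vacuum_development a b h_.
Local Notation D := (within_dom a b).
Local Notation K := (velocity h_).

Definition weingarten t := invmx (h_ t) *m velocity h_ t.
Definition vol t := Num.sqrt (\det (h_ t)).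
Local Notation L := weingarten.
Local Notation V := vol.
Local Notation g t := (h_ t i2 i2).

(** The [h_ x]-orthogonal projection, as the rank-one matrix of
    [v -> h(e_2, v) / h(e_2, e_2) e_2]. *)
Definition center_proj x := (h_ x i2 i2)^-1 *: ((@e2 R) *m (h_ x *m (@e2 R))^T).
Local Notation P := center_proj.

Section AtTime.
Variable t : R.
Hypothesis Dt : D t.

Lemma dev_inner : inner_product (h_ t).
Proof. by have [] := dev Dt.1 Dt.2. Qed.

Let hs := dev_inner.1.
Let hu := inner_unit dev_inner.

Lemma dev_good : \forall x \near t, (h_ x)^T = h_ x /\ h_ x \in unitmx.
Proof.
near=> x; have dx : D x by near: x; exact: within_dom_near.
by have [ip _ _ _] := dev dx.1 dx.2; split; [exact: ip.1|exact: inner_unit].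
Unshelve. all: by end_near. Qed.

Lemma dev_h22 : \forall x \near t, h_ x i2 i2 != 0.
Proof.
near=> x; have dx : D x by near: x; exact: within_dom_near.
by have [ip _ _ _] := dev dx.1 dx.2; rewrite gt_eqF // inner_h22_gt0.
Unshelve. all: by end_near. Qed.

Lemma dev_derivative : is_mderive h_ t (2 *: K t).
Proof. by have [_ d _ _] := dev Dt.1 Dt.2; exact: is_mderive_velocity. Qed.

Let Ks : (K t)^T = K t := velocity_sym dev_good.

Let Mt : K t *m invmx (h_ t) = (L t)^T.
Proof. by rewrite /weingarten trmx_mul Ks trmx_inv hs. Qed.

Lemma shape_metric : h_ t *m L t = K t.
Proof. by rewrite /weingarten mulKVmx. Qed.

(** The mixed Ricci components for [e_0] and [e_1] are, up to sign, the two horizontal entries of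
    the last column of [L t]. *)
Lemma shape_center : L t *m (@e2 R) = L t i2 i2 *: (@e2 R).
Proof.
have [_ _ _ rf] := dev Dt.1 Dt.2.
have := rf (sp i1) tm; rewrite (ricci_st dev_good dev_h22) Mt sum3.
have := rf (sp i0) tm; rewrite (ricci_st dev_good dev_h22) Mt sum3.
move: (L t) => Lt; rewrite /heis /= !mxE => e1 e0.
apply/matrixP; elim/ord3P => j; rewrite ord1 !mxE sum3 !mxE /=; lra.
Qed.

Lemma center_derivative : is_mderive (fun x => h_ x *m (@e2 R)) t
  ((2 * L t i2 i2) *: (h_ t *m (@e2 R))).
Proof.
have := is_mderiveM dev_derivative (is_mderive_cst (@e2 R) t).
by rewrite mulmx0 addr0 -shape_metric -scalemxAl -mulmxA shape_center -scalemxAr scalerA.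
Qed.

Let e2E : h_ t *m (@e2 R) = col i2 (h_ t).
Proof.
by apply/matrixP => i j; rewrite !mxE sum3 !mxE /= !ord1 !(mulr0,mulr1,add0r).
Qed.

Lemma h22_derivative : is_derive t 1 (fun x => g x) (2 * L t i2 i2 * g t).
Proof.
have := center_derivative i2 0; rewrite e2E !mxE.
rewrite (_ : (fun x => (h_ x *m (@e2 R)) i2 0) = (fun x => g x)) //.
by apply/funext => x; rewrite mxE sum3 !mxE /= !(mulr0,mulr1,add0r).
Qed.

Lemma accel_derivative : is_mderive K t
   (2 *: (K t *m L t) - \tr (L t) *: K t
    - (g t / \det (h_ t)) *: (col i2 (h_ t) *m (col i2 (h_ t))^T - (2^-1 * g t) *: h_ t)).
Proof.
have [_ _ dd rf] := dev Dt.1 Dt.2 => i j.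
have dK : derivable (fun x => K x i j) t 1.
  rewrite (_ : (fun x => K x i j) = (fun x => 2^-1 * derive1 (fun u => h_ u i j) x)); last first.
    by apply/funext => x; rewrite mxE.
  by apply: derivableM.
apply: is_derive_val1; first exact: derivable_is_derive dK.
have := rf (sp i) (sp j); rewrite (ricci_ss dev_good dev_h22) Mt mxtrace_tr.
have -> : (L t)^T *m K t = (K t *m L t)^T by rewrite [RHS]trmx_mul Ks.
have -> : (K t *m L t)^T = K t *m L t by rewrite /weingarten !trmx_mul Ks trmx_inv hs mulmxA.
move: (K t *m L t) (K t) (derive1 _ t) (\tr (L t)) => KL Kt d tL.
rewrite !mxE big_ord1 !mxE (sym_entry hs i i2) (sym_entry hs j i2) => e.
by apply/eqP; rewrite -subr_eq0 -[X in _ == X]e; apply/eqP; ring.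
Qed.

Lemma det_gt0 : 0 < \det (h_ t). Proof. exact: inner_det_gt0 dev_inner. Qed.
Lemma vol_gt0 : 0 < V t. Proof. by rewrite sqrtr_gt0 det_gt0. Qed.
Lemma h22_gt0 : 0 < g t. Proof. exact: inner_h22_gt0 dev_inner. Qed.

Lemma vol_derivative : is_derive t 1 V (V t * \tr (L t)).
Proof.
have dd := is_derive_det3 dev_derivative hu hs; rewrite linearZ /= Ks in dd.
apply: is_derive_val1; first exact: is_derive_sqrt1 det_gt0 (dd erefl).
rewrite -/(V t) -scalemxAr -/(L t) linearZ /=.
have -> : \det (h_ t) = V t ^+ 2 by rewrite sqr_sqrtr // ltW // det_gt0.
by field; rewrite gt_eqF ?vol_gt0.
Qed.

(** The terms [2 L^2] produced by differentiating [h^-1] and by the evolution equation cancel. What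
    remains is a damping term and minus the Ricci endomorphism of the slice. *)
Lemma shape_derivative : is_mderive L t
  (- \tr (L t) *: L t + (g t ^+ 2 / \det (h_ t)) *: (2^-1 *: 1%:M - P t)).
Proof.
apply: is_mderive_val (is_mderiveM (is_mderive_inv dev_derivative dev_good) accel_derivative) _.
have HK : invmx (h_ t) *m K t = L t by [].
have HKL : invmx (h_ t) *m (K t *m L t) = L t *m L t by rewrite mulmxA.
have Hc : invmx (h_ t) *m (col i2 (h_ t) *m (col i2 (h_ t))^T) = (@e2 R) *m (h_ t *m (@e2 R))^T.
  by rewrite -e2E mulmxA mulKmx.
rewrite mulNmx -scalemxAr -!scalemxAl HK -[L t *m _ *m K t]mulmxA HK !mulmxBr -!scalemxAr mulmxBr.
rewrite -scalemxAr HK HKL Hc mulVmx // /center_proj.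
move: (L t *m L t) ((@e2 R) *m (h_ t *m (@e2 R))^T) (\tr (L t)) (L t) => LL E tL Lt.
apply/matrixP => i j; rewrite !mxE; move: ((i == j)%:R : R) => x.
by field; rewrite !gt_eqF ?h22_gt0 ?det_gt0.
Qed.

(** Since [V' = V tr L], the volume is an integrating factor for the damping term. *)
Lemma volshape_derivative : is_mderive (fun x => V x *: L x) t
  ((g t ^+ 2 / V t) *: (2^-1 *: 1%:M - P t)).
Proof.
apply: is_mderive_val (is_mderiveZ vol_derivative shape_derivative) _.
have -> : \det (h_ t) = V t ^+ 2 by rewrite sqr_sqrtr // ltW // det_gt0.
move: (\tr (L t)) (L t) (P t) => tL Lt Pp.
apply/matrixP => i j; rewrite !mxE; move: ((i == j)%:R : R) => x.
by field; rewrite !gt_eqF ?vol_gt0.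
Qed.

(** The covector [h e_2] only gets rescaled, at the same rate as [h22], so the quotient defining [P]
    is constant. *)
Lemma center_proj_derivative : is_mderive P t 0.
Proof.
have cT : is_mderive (fun x => (h_ x *m (@e2 R))^T) t ((2 * L t i2 i2) *: (h_ t *m (@e2 R))^T).
  move=> i j; under eq_fun do rewrite mxE.
  apply: is_derive_val1 (center_derivative j i) _.
  by rewrite [LHS]mxE [RHS]mxE; congr (_ * _); rewrite [RHS]mxE.
have gn0 : g t != 0 by rewrite gt_eqF ?h22_gt0.
have := is_mderiveZ (is_deriveV1 gn0 h22_derivative) (is_mderiveM (is_mderive_cst (@e2 R) t) cT).
move=> /is_mderive_val; apply; rewrite mul0mx add0r -scalemxAr scalerA -scalerDl.
rewrite (_ : _ + _ = 0) ?scale0r //.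
by field.
Qed.

Definition center_momentum x := V x * L x i2 i2.

Lemma beta_derivative : is_derive t 1 center_momentum (- g t ^+ 2 / (2 * V t)).
Proof.
have := volshape_derivative i2 i2.
rewrite (_ : (fun x => _) = center_momentum); last by apply/funext => x; rewrite mxE.
move=> /is_derive_val1; apply.
have : P t i2 i2 = 1.
  by rewrite /center_proj e2E !mxE big_ord1 !mxE /= mul1r mulVf // gt_eqF ?h22_gt0.
move: (P t) => Pp P22; rewrite !mxE P22 /=.
by field; rewrite gt_eqF ?vol_gt0.
Qed.

(** The derivative of [V L] is a multiple of [1 - 2 P], whose direction is constant; its central
    entry identifies the coefficient as [- be'], which the second summand compensates. *)
Lemma volume_shape_invariant :
  is_mderive (fun x => V x *: L x + center_momentum x *: (1%:M - 2 *: P x)) t 0.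
Proof.
have c1 : is_mderive (fun x => 1%:M + (-2) *: P x) t ((-2) *: 0).
  apply: is_mderive_val.
    apply: is_mderiveD (is_mderive_cst _ _) _.
    exact: is_mderiveZ (is_derive_cst1 (-2) t) center_proj_derivative.
  by rewrite scale0r !add0r.
have := is_mderiveD volshape_derivative (is_mderiveZ beta_derivative c1).
rewrite (_ : (fun x => _) = fun x => V x *: L x + center_momentum x *: (1%:M - 2 *: P x)); last first.
  by apply/funext => x; rewrite scaleNr.
move=> /is_mderive_val; apply.
move: (P t) => Pp; apply/matrixP => i j; rewrite !mxE; move: ((i == j)%:R : R) => x.
by field; rewrite !gt_eqF ?vol_gt0.
Qed.
End AtTime.
End VacuumEquations.

Section Integration.
Variables (R : realType) (a b : \bar R) (h_ : R -> 'M[R]_3) (t0 : R).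
Hypothesis dev : vacuum_development a b h_.
Hypothesis D0 : within_dom a b t0.
Local Notation D := (within_dom a b).
Local Notation L := (weingarten h_).
Local Notation V := (vol h_).
Local Notation P := (center_proj h_).
Local Notation beta := (center_momentum h_).
Local Notation h := (h_ t0).

Lemma volume_shapeE t : D t ->
  V t *: L t = V t0 *: L t0 + (beta t0 - beta t) *: (1%:M - 2 *: P t0).
Proof.
move=> Dt.
have := within_dom_mcst (fun t => @volume_shape_invariant _ _ _ _ dev t) Dt D0.
have -> : P t = P t0 by apply: (@within_dom_mcst _ _ _ _ _ P _ _ _ Dt D0) => x; exact: center_proj_derivative.
by move=> e; rewrite scalerBl addrA -e addrK.
Qed.

Lemma trace_center_proj : \tr (P t0) = 1.
Proof.
rewrite /center_proj linearZ /= mxtrace_mulC.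
rewrite (_ : \tr _ = h i2 i2); first by rewrite mulVf // gt_eqF // (h22_gt0 dev D0).
rewrite /mxtrace big_ord1 !mxE sum3 !mxE !sum3 !mxE /=; ring.
Qed.

(** [1 - 2 P] has trace 1, so [V' + be] is conserved; it becomes the constant [q] of the scalar
    system. *)
Lemma volume_expansion t : D t ->
  V t * \tr (L t) = V t0 * \tr (L t0) + beta t0 - beta t.
Proof.
move=> Dt; have := congr1 mxtrace (volume_shapeE Dt).
rewrite mxtraceD !mxtraceZ mxtraceD [\tr (- _)]raddfN /= mxtraceZ mxtrace1 trace_center_proj => ->.
ring.
Qed.

Section Eigenvector.
Variables (X : 'cV[R]_3) (l : R).
Hypothesis hX : unit_horizontal h X.
Hypothesis LX : L t0 *m X = l *: X.
Local Notation f t := (form (h_ t) X X).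

(** [P t0] kills the horizontal vector [X], so the invariant acts on [X] by a scalar at all
    times. *)
Lemma shape_eigen t : D t ->
  V t *: (L t *m X) = (V t0 * l + beta t0 - beta t) *: X.
Proof.
move=> Dt; rewrite scalemxAl volume_shapeE // mulmxDl -!scalemxAl LX mulmxBl mul1mx.
have -> : 2 *: P t0 *m X = 0.
  rewrite /center_proj -!scalemxAl -mulmxA.
  have [/horizontalP hX0 _] := hX.
  rewrite (_ : (h *m (@e2 R))^T *m X = 0) ?mulmx0 ?scaler0 //.
  rewrite trmx_mul (dev_inner dev D0).1; apply/matrixP => i j; rewrite !ord1 [RHS]mxE.
  by rewrite -[LHS]/(form h (@e2 R) X) form_sym ?(dev_inner dev D0).1.
by rewrite subr0 scalerA -scalerDl addrA.
Qed.

Local Notation c := (2 * (V t0 * l + beta t0)).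

Lemma eigen_mderivative t : D t ->
  is_mderive (fun x => h_ x *m X) t (((c - 2 * beta t) / V t) *: (h_ t *m X)).
Proof.
move=> Dt; apply: is_mderive_val (is_mderiveM (dev_derivative dev Dt) (is_mderive_cst X t)) _.
rewrite mulmx0 addr0 -(shape_metric dev Dt) -scalemxAl -mulmxA.
have V0 : V t != 0 by rewrite gt_eqF ?(vol_gt0 dev Dt).
have -> : L t *m X = ((V t0 * l + beta t0 - beta t) / V t) *: X.
  by rewrite mulrC -scalerA -shape_eigen // scalerA mulVf // scale1r.
by rewrite -scalemxAr scalerA; congr (_ *: _); field.
Qed.

Lemma eigen_derivative t : D t ->
  is_derive t 1 (fun x => f x) ((c - 2 * beta t) / V t * f t).
Proof.
move=> Dt; have := is_mderiveM (is_mderive_cst X^T t) (eigen_mderivative Dt).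
rewrite mul0mx add0r -scalemxAr mulmxA => /(_ 0 0).
rewrite [X in is_derive _ _ _ X]mxE -/(f t).
by rewrite (_ : (fun x => (X^T *m (h_ x *m X)) 0 0) = (fun x => f x)) //; apply/funext => x; rewrite mulmxA.
Qed.

Lemma eigen_gt0 t : D t -> 0 < f t.
Proof.
move=> Dt; apply: (dev_inner dev Dt).2; apply/eqP => X0.
by have [_] := hX; rewrite X0 /form mulmx0 mxE => /eqP; rewrite eq_sym oner_eq0.
Qed.

(** The covector [h_ t X] and the number [f t] satisfy the same linear equation, so their quotient
    is constant. Hence [X] stays orthogonal to whatever it was orthogonal to at [t0]. *)
Lemma eigen_metric t : D t -> h_ t *m X = f t *: (h *m X).
Proof.
move=> Dt.
have cst x : D x -> is_mderive (fun x => (f x)^-1 *: (h_ x *m X)) x 0.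
  move=> Dx; have f0 : f x != 0 by rewrite gt_eqF ?eigen_gt0.
  apply: is_mderive_val (is_mderiveZ (is_deriveV1 f0 (eigen_derivative Dx)) (eigen_mderivative Dx)) _.
  rewrite scalerA -scalerDl (_ : _ + _ = 0) ?scale0r //.
  by field; rewrite f0 gt_eqF ?(vol_gt0 dev Dx).
have := within_dom_mcst cst Dt D0; have [_ ->] := hX; rewrite invr1 scale1r => <-.
by rewrite scalerA mulfV ?scale1r // gt_eqF ?eigen_gt0.
Qed.
End Eigenvector.

Lemma center_metric t : D t -> h_ t *m (@e2 R) = (h_ t i2 i2 / h i2 i2) *: (h *m (@e2 R)).
Proof.
move=> Dt.
have cst x : D x -> is_mderive (fun x => (h_ x i2 i2)^-1 *: (h_ x *m (@e2 R))) x 0.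
  move=> Dx; have f0 : h_ x i2 i2 != 0 by rewrite gt_eqF ?(h22_gt0 dev Dx).
  apply: is_mderive_val (is_mderiveZ (is_deriveV1 f0 (h22_derivative dev Dx)) (center_derivative dev Dx)) _.
  rewrite scalerA -scalerDl (_ : _ + _ = 0) ?scale0r //.
  by field.
have := within_dom_mcst cst Dt D0 => e.
by rewrite -scalerA -e scalerA mulfV ?scale1r // gt_eqF ?(h22_gt0 dev Dt).
Qed.

Section DiagonalForm.
Variables (Xm Xp : 'cV[R]_3) (lm lp : R).
Hypothesis um : unit_horizontal h Xm.
Hypothesis up : unit_horizontal h Xp.
Hypothesis mp : form h Xm Xp = 0.
Hypothesis Lm : L t0 *m Xm = lm *: Xm.
Hypothesis Lp : L t0 *m Xp = lp *: Xp.
Local Notation Q := (coframe Xm Xp).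
Local Notation B := (frame Xm Xp).
Let hp := dev_inner dev D0.

Lemma diagonal_metric t : D t -> h_ t =
  Q^T *m diag3 (form (h_ t) Xm Xm) (form (h_ t) Xp Xp) (h_ t i2 i2) *m Q.
Proof.
move=> Dt; set d := diag3 _ _ _.
have g0 : h i2 i2 != 0 by rewrite gt_eqF ?(h22_gt0 dev D0).
have e : h_ t *m B = Q^T *m d.
  rewrite mul_basis3 (eigen_metric um Lm Dt) (eigen_metric up Lp Dt) (center_metric Dt).
  have hB : h *m B = Q^T *m diag3 1 1 (h i2 i2).
    by rewrite {1}(metric_coframe hp um up mp) -[LHS]mulmxA (coframeM hp um up mp) mulmx1.
  rewrite basis3_scale -mul_basis3 -/B hB -mulmxA diag3M !mul1r.
  by rewrite mulrCA mulfV // mulr1.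
by rewrite -e -mulmxA (frameM hp um up mp) mulmx1.
Qed.

Lemma weingarten_trace : \tr (L t0) = lm + lp + L t0 i2 i2.
Proof.
have e : L t0 = B *m diag3 lm lp (L t0 i2 i2) *m Q.
  rewrite -basis3_scale -Lm -Lp -(shape_center dev D0) -mul_basis3 -mulmxA.
  by rewrite (frameM hp um up mp) mulmx1.
by rewrite {1}e mxtrace_mulC mulmxA (coframeM hp um up mp) mul1mx diag3_tr.
Qed.
End DiagonalForm.
End Integration.

(** * The scalar system and its explicit solution *)

Section TaubSystem.
Variable R : realType.

(* [V], [g], [fm], [fp] stand for [sqrt (det h)], [h(z, z)], [h(X_-, X_-)],
   [h(X_+, X_+)] in proper time, [be] for [V] times the central eigenvalue of
   [h^-1 K]; [c / 2] is the conserved trace-free momentum. *)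
Record taub_system (q c : R) (V g be fm fp : R -> R) (t : R) := TaubSystem {
  taub_V_gt0 : 0 < V t;
  taub_g_gt0 : 0 < g t;
  taub_fm_gt0 : 0 < fm t;
  taub_fp_gt0 : 0 < fp t;
  taub_V : is_derive t 1 V (q - be t);
  taub_g : is_derive t 1 g (2 * be t / V t * g t);
  taub_be : is_derive t 1 be (- g t ^+ 2 / (2 * V t));
  taub_fm : is_derive t 1 fm ((q - c - 2 * be t) / V t * fm t);
  taub_fp : is_derive t 1 fp ((q + c - 2 * be t) / V t * fp t) }.

Section Profiles.
Variables (V0 E u y0 : R).
(* The solution of [taub_system] as a function of [y = (E - 2 be) / g]. *)
Definition prof_g (y : R) := 2 * E * y / (1 + y ^+ 2).
Definition prof_be (y : R) := E * (1 - y ^+ 2) / (2 * (1 + y ^+ 2)).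
(** Powers of [y / y0] are written through [ln], which turns identities between profiles into linear
    identities between logarithms. *)
Definition prof_f (k y : R) :=
  expR ((k - 1) * (ln y - ln y0)) * (1 + y ^+ 2) / (1 + y0 ^+ 2).
Definition prof_V (y : R) :=
  V0 * expR ((u - 2^-1) * (ln y - ln y0)) * Num.sqrt ((1 + y ^+ 2) / (1 + y0 ^+ 2)).

Lemma sqrt_expR (x : R) : 0 < x -> Num.sqrt x = expR (2^-1 * ln x).
Proof. by move=> x0; rewrite -powR12_sqrt ?ltW // /powR gt_eqF. Qed.

Lemma sq1_gt0 (y : R) : 0 < 1 + y ^+ 2.
Proof. by rewrite ltr_pwDl ?sqr_ge0. Qed.
Lemma sq1_neq0 (y : R) : 1 + y ^+ 2 != 0.
Proof. by rewrite gt_eqF ?sq1_gt0. Qed.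

Section FromTaub.
Variables (a b : \bar R) (t0 q c : R) (V g be fm fp : R -> R).
Local Notation D := (within_dom a b).
Hypothesis sys : forall t, D t -> taub_system q c V g be fm fp t.
Hypothesis D0 : D t0.
Hypothesis VV0 : V t0 = V0.
Hypothesis E0 : 0 < E.
Hypothesis E2 : E ^+ 2 = 4 * be t0 ^+ 2 + g t0 ^+ 2.
Hypothesis qu : q = E * u.

(** The tangent of half the angle on the circle [(2 be)^2 + g^2 = E^2]. It parametrizes the circle
    rationally, and [ln y] has the simple rate [E / V]. *)
Definition taub_y t := (E - 2 * be t) / g t.
Local Notation y := taub_y.
Hypothesis yy0 : y t0 = y0.

Lemma taub_energy t : D t -> 4 * be t ^+ 2 + g t ^+ 2 = E ^+ 2.
Proof.
move=> Dt; rewrite E2.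
apply: (@within_dom_cst _ a b (fun t => 4 * be t ^+ 2 + g t ^+ 2)) => // x Dx.
have s := sys Dx; have Vx := taub_V_gt0 s.
have := is_deriveD1 (is_deriveM1 (is_derive_cst1 4 x) (is_deriveM1 (taub_be s) (taub_be s)))
  (is_deriveM1 (taub_g s) (taub_g s)).
by move=> /is_derive_val1; apply; field; rewrite gt_eqF.
Qed.

Lemma taub_y_gt0 t : D t -> 0 < y t.
Proof.
move=> Dt; have s := sys Dt; have en := taub_energy Dt.
have g0 := taub_g_gt0 s; rewrite divr_gt0 // subr_gt0 ltNge; apply/negP => le.
have : E * E <= 2 * be t * (2 * be t) by apply: ler_pM => //; exact: ltW.
have : 0 < g t * g t by exact: mulr_gt0.
by nra.
Qed.

Lemma taub_gE t : D t -> g t = prof_g (y t).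
Proof.
move=> Dt; have s := sys Dt; have en := taub_energy Dt; have g0 := taub_g_gt0 s.
have gn := lt0r_neq0 g0; have yg : y t * g t = E - 2 * be t by rewrite /taub_y mulfVK.
have y1 := sq1_neq0 (y t).
apply: (mulIf y1); rewrite /prof_g mulfVK //; apply: (mulIf gn).
have -> : g t * (1 + y t ^+ 2) * g t = g t ^+ 2 + (y t * g t) ^+ 2 by ring.
have -> : 2 * E * y t * g t = 2 * E * (y t * g t) by ring.
rewrite yg; lra.
Qed.

Lemma taub_y_derivative t : D t -> is_derive t 1 y (E * y t / V t).
Proof.
move=> Dt; have s := sys Dt; have g0 := taub_g_gt0 s; have V1 := taub_V_gt0 s.
have gn := lt0r_neq0 g0; have yg : y t * g t = E - 2 * be t by rewrite /taub_y mulfVK.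
have en := taub_energy Dt.
have := is_deriveM1 (is_deriveB1 (is_derive_cst1 E t) (is_deriveM1 (is_derive_cst1 2 t) (taub_be s)))
   (is_deriveV1 gn (taub_g s)).
move=> /is_derive_val1; apply.
have Vn := lt0r_neq0 V1.
transitivity ((g t ^+ 2 - 2 * be t * (E - 2 * be t)) / (V t * g t)).
  by field; rewrite gn.
have -> : g t ^+ 2 = (E - 2 * be t) * (E + 2 * be t) by lra.
by rewrite /taub_y; field; rewrite gn Vn.
Qed.

Let y0_gt0 : 0 < y0. Proof. by rewrite -yy0 taub_y_gt0. Qed.

Let lnD_prof_g (z : R) : 0 < z -> ln (prof_g z) = ln (2 * E) + ln z - ln (1 + z ^+ 2).
Proof.
move=> z0; rewrite /prof_g ln_div ?posrE ?sq1_gt0 ?mulr_gt0 //.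
by rewrite lnM ?posrE ?mulr_gt0.
Qed.

(** In [ln f + ln g] the terms with [be] cancel, leaving the rate [E k / V], which is that of
    [k ln y]. The volume is treated in the same way below, with [2 ln V] for [ln f]. *)
Lemma taub_fE (f : R -> R) (k : R) : f t0 = 1 -> (forall t, D t -> 0 < f t) ->
  (forall t, D t -> is_derive t 1 f ((E * k - 2 * be t) / V t * f t)) ->
  forall t, D t -> f t = prof_f k (y t).
Proof.
move=> f0 fpos fd t Dt.
have F : ln (f t) + ln (g t) - k * ln (y t) = ln (f t0) + ln (g t0) - k * ln (y t0).
  apply: (@within_dom_cst _ a b (fun t => ln (f t) + ln (g t) - k * ln (y t))) => // x Dx.
  have s := sys Dx; have g0 := taub_g_gt0 s; have y1 := taub_y_gt0 Dx.
  have := is_deriveB1 (is_deriveD1 (is_derive_ln1 (fpos _ Dx) (fd _ Dx)) (is_derive_ln1 g0 (taub_g s)))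
    (is_deriveM1 (is_derive_cst1 k x) (is_derive_ln1 y1 (taub_y_derivative Dx))).
  move=> /is_derive_val1; apply.
  have fx := fpos _ Dx; have Vx := taub_V_gt0 s.
  by field; rewrite !gt_eqF.
move: F; rewrite f0 ln1 !taub_gE // yy0 !lnD_prof_g ?taub_y_gt0 // => F.
rewrite -[LHS]lnK ?posrE ?fpos // /prof_f -[1 + y t ^+ 2]lnK ?posrE ?sq1_gt0 //.
rewrite -[X in _ / X]lnK ?posrE ?sq1_gt0 // -expRN -!expRD; congr expR.
by lra.
Qed.

Lemma taub_VE t : D t -> V t = prof_V (y t).
Proof.
move=> Dt; have V1 t' : D t' -> 0 < V t' by move=> /sys/taub_V_gt0.
have F : 2 * ln (V t) + ln (g t) - 2 * u * ln (y t) = 2 * ln (V t0) + ln (g t0) - 2 * u * ln (y t0).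
  apply: (@within_dom_cst _ a b (fun t => 2 * ln (V t) + ln (g t) - 2 * u * ln (y t))) => // x Dx.
  have s := sys Dx; have g0 := taub_g_gt0 s; have y1 := taub_y_gt0 Dx.
  have := is_deriveB1 (is_deriveD1 (is_deriveM1 (is_derive_cst1 2 x) (is_derive_ln1 (V1 _ Dx) (taub_V s)))
      (is_derive_ln1 g0 (taub_g s)))
    (is_deriveM1 (is_derive_cst1 (2 * u) x) (is_derive_ln1 y1 (taub_y_derivative Dx))).
  move=> /is_derive_val1; apply.
  by rewrite qu; field; rewrite !gt_eqF ?(taub_V_gt0 s).
move: F; rewrite !taub_gE // yy0 !lnD_prof_g ?taub_y_gt0 // VV0 => F.
have V00 : 0 < V0 by rewrite -VV0 V1.
rewrite -[LHS]lnK ?posrE ?V1 // /prof_V -[X in X * expR _]lnK ?posrE //.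
rewrite sqrt_expR ?divr_gt0 ?sq1_gt0 // ln_div ?posrE ?sq1_gt0 // -!expRD; congr expR.
by lra.
Qed.
End FromTaub.
End Profiles.
End TaubSystem.

Section ProfilesSolve.
Variables (R : realType) (V0 E u y0 q c : R) (y : R -> R) (t : R).
Hypothesis V00 : 0 < V0.
Hypothesis E0 : 0 < E.
Hypothesis qu : q = E * u.
Local Notation pV := (prof_V V0 u y0).
Local Notation pg := (prof_g E).
Local Notation pb := (prof_be E).
Local Notation pf k := (prof_f y0 k).

Lemma prof_VE z : pV z = V0 * expR ((u - 2^-1) * (ln z - ln y0)
    + 2^-1 * (ln (1 + z ^+ 2) - ln (1 + y0 ^+ 2))).
Proof.
by rewrite /prof_V sqrt_expR ?divr_gt0 ?sq1_gt0 // ln_div ?posrE ?sq1_gt0 // expRD mulrA.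
Qed.

Lemma prof_V_gt0 z : 0 < pV z.
Proof. by rewrite prof_VE mulr_gt0 ?expR_gt0. Qed.

Hypothesis yt : 0 < y t.
Hypothesis dy : is_derive t 1 y (E * y t / pV (y t)).

Lemma is_derive_expR1 (f : R -> R) (x d : R) : is_derive x 1 f d ->
  is_derive x 1 (fun z => expR (f z)) (d * expR (f x)).
Proof. by move=> fd; apply: is_derive_comp1 => //; exact: is_derive_expR. Qed.

Let dsq : is_derive t 1 (fun x => 1 + y x ^+ 2) (2 * y t * (E * y t / pV (y t))).
Proof.
have := is_deriveD1 (is_derive_cst1 1 t) (is_deriveM1 dy dy).
move=> /is_derive_val1; apply.
by field; rewrite gt_eqF ?prof_V_gt0.
Qed.

Let dln : is_derive t 1 (fun x => ln (y x) - ln y0) (E / pV (y t)).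
Proof.
apply: is_derive_val1.
  exact: is_deriveB1 (is_derive_ln1 yt dy) (is_derive_cst1 (ln y0) t).
by field; rewrite !gt_eqF ?prof_V_gt0.
Qed.

Let Vn : pV (y t) != 0. Proof. by rewrite gt_eqF ?prof_V_gt0. Qed.
Let sn := @sq1_neq0 R.

Let dlnsq := @is_derive_ln1 R (fun x => 1 + y x ^+ 2) t _ (sq1_gt0 (y t)) dsq.
Let dVsq := @is_deriveV1 R (fun x => 1 + y x ^+ 2) t _ (sn (y t)) dsq.

Let dV : is_derive t 1 (fun x => pV (y x)) (q - pb (y t)).
Proof.
rewrite (_ : (fun x => _) = fun x => V0 * expR ((u - 2^-1) * (ln (y x) - ln y0)
    + 2^-1 * (ln (1 + y x ^+ 2) - ln (1 + y0 ^+ 2)))); last first.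
  by apply/funext => x; rewrite prof_VE.
have d1 := is_deriveM1 (is_derive_cst1 (u - 2^-1) t) dln.
have d2 := is_deriveM1 (is_derive_cst1 2^-1 t) (is_deriveB1 dlnsq (is_derive_cst1 (ln (1 + y0 ^+ 2)) t)).
have := is_deriveM1 (is_derive_cst1 V0 t) (is_derive_expR1 (is_deriveD1 d1 d2)).
move=> /is_derive_val1; apply.
rewrite mul0r add0r mulrCA -prof_VE /prof_be qu; move: Vn; move: (pV (y t)) => W Wn.
by field; rewrite Wn sn.
Qed.

Let df k : is_derive t 1 (fun x => pf k (y x)) ((E * k - 2 * pb (y t)) / pV (y t) * pf k (y t)).
Proof.
have := is_deriveM1 (is_deriveM1 (is_derive_expR1 (is_deriveM1 (is_derive_cst1 (k - 1) t) dln)) dsq)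
  (is_derive_cst1 (1 + y0 ^+ 2)^-1 t).
move=> /is_derive_val1; apply.
rewrite /prof_be /prof_f; move: Vn; move: (pV (y t)) (expR _) => W ex Wn.
by field; rewrite Wn !sn.
Qed.

(** The converse of the integration. It is needed because the continuation of a development below
    time 0 is built from the profiles and must be recognized as a solution. *)
Lemma prof_taub : taub_system q c (fun x => pV (y x)) (fun x => pg (y x))
  (fun x => pb (y x)) (fun x => pf ((q - c) / E) (y x)) (fun x => pf ((q + c) / E) (y x)) t.
Proof.
have En : E != 0 by rewrite gt_eqF.
have dg : is_derive t 1 (fun x => pg (y x)) (2 * pb (y t) / pV (y t) * pg (y t)).
  have := is_deriveM1 (is_deriveM1 (is_derive_cst1 (2 * E) t) dy) dVsq.
  move=> /is_derive_val1; apply.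
  by rewrite /prof_be /prof_g; move: Vn; move: (pV (y t)) => W Wn; field; rewrite Wn sn.
have db : is_derive t 1 (fun x => pb (y x)) (- pg (y t) ^+ 2 / (2 * pV (y t))).
  rewrite (_ : (fun x => _) = fun x => E * (1 + y x ^+ 2)^-1 - E / 2); last first.
    by apply/funext => x; rewrite /prof_be; field; rewrite sn.
  have := is_deriveB1 (is_deriveM1 (is_derive_cst1 E t) dVsq) (is_derive_cst1 (E / 2) t).
  move=> /is_derive_val1; apply.
  by rewrite /prof_g; move: Vn; move: (pV (y t)) => W Wn; field; rewrite Wn sn.
have fpos k : 0 < pf k (y t).
  by rewrite /prof_f divr_gt0 ?mulr_gt0 ?expR_gt0 ?sq1_gt0.
have gpos : 0 < pg (y t) by rewrite /prof_g divr_gt0 ?mulr_gt0 ?sq1_gt0.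
have dm : is_derive t 1 (fun x => pf ((q - c) / E) (y x))
    ((q - c - 2 * pb (y t)) / pV (y t) * pf ((q - c) / E) (y t)).
  by have := df ((q - c) / E); rewrite [E * _]mulrC mulfVK.
have dp : is_derive t 1 (fun x => pf ((q + c) / E) (y x))
    ((q + c - 2 * pb (y t)) / pV (y t) * pf ((q + c) / E) (y t)).
  by have := df ((q + c) / E); rewrite [E * _]mulrC mulfVK.
exact: (@TaubSystem R q c (fun x => pV (y x)) (fun x => pg (y x)) (fun x => pb (y x))
  (fun x => pf ((q - c) / E) (y x)) (fun x => pf ((q + c) / E) (y x)) t
  (prof_V_gt0 (y t)) gpos (fpos _) (fpos _) dV dg db dm dp).
Qed.
End ProfilesSolve.

(** * Ricci flatness of the explicit diagonal metrics *)

Section DiagonalDevelopment.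
Variables (R : realType) (a b : \bar R) (q c : R) (V g be fm fp : R -> R).
Variables (Q B : 'M[R]_3).
Local Notation D := (within_dom a b).
Hypothesis sys : forall t, D t -> taub_system q c V g be fm fp t.
Hypothesis QB : Q *m B = 1%:M.
Hypothesis Be2 : B *m (@e2 R) = (@e2 R).

Definition diag_metric x := Q^T *m diag3 (fm x) (fp x) (g x) *m Q.
Local Notation h := diag_metric.
Hypothesis Vdet : forall t, D t -> V t ^+ 2 = \det (h t).
Hypothesis energy : forall t, D t -> q ^+ 2 = 4 * be t ^+ 2 + g t ^+ 2 + c ^+ 2.

Let BQ : B *m Q = 1%:M. Proof. exact: mulmx1C. Qed.
Let BQT : B^T *m Q^T = 1%:M. Proof. by rewrite -trmx_mul QB trmx1. Qed.
Let QBT : Q^T *m B^T = 1%:M. Proof. by rewrite -trmx_mul BQ trmx1. Qed.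
Let Qe2 : Q *m (@e2 R) = (@e2 R).
Proof. by rewrite -{1}Be2 mulmxA QB mul1mx. Qed.

Let conjE x y z i j : (Q^T *m diag3 x y z *m Q) i j =
  x * Q i0 i * Q i0 j + y * Q i1 i * Q i1 j + z * Q i2 i * Q i2 j.
Proof.
rewrite mxE !sum3 !mxE !sum3 /diag3 !mxE /=; ring.
Qed.

Let Qi2 k : Q k i2 = (k == i2)%:R.
Proof.
have := congr1 (fun M : 'cV[R]_3 => M k 0) Qe2.
by rewrite !mxE sum3 !mxE /= !(mulr0, add0r, mulr1) andbT.
Qed.

Lemma diag_metric_inner t : D t -> inner_product (h t).
Proof.
move=> Dt; have s := sys Dt; split.
  by rewrite /diag_metric !trmx_mul trmxK diag3T mulmxA.
move=> x x0; pose z := Q *m x.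
have -> : form (h t) x x = fm t * z i0 0 ^+ 2 + fp t * z i1 0 ^+ 2 + g t * z i2 0 ^+ 2.
  have -> : form (h t) x x = (z^T *m diag3 (fm t) (fp t) (g t) *m z) 0 0.
    by rewrite /form /z /diag_metric trmx_mul !mulmxA.
  by move: z => w; rewrite mxE !sum3 !mxE !sum3 /diag3 !mxE /=; ring.
have zn : z != 0.
  by apply: contra_neq x0 => z0; rewrite -[x]mul1mx -BQ -mulmxA -/z z0 mulmx0.
have [m p gg] : [/\ 0 < fm t, 0 < fp t & 0 < g t].
  by split; [exact: taub_fm_gt0 s|exact: taub_fp_gt0 s|exact: taub_g_gt0 s].
have t0 i : 0 <= z i 0 ^+ 2 by exact: sqr_ge0.
have nn : [|| z i0 0 != 0, z i1 0 != 0 | z i2 0 != 0].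
  apply: contraNT zn; rewrite !negb_or !negbK => /and3P[/eqP z0 /eqP z1 /eqP z2].
  by apply/eqP/matrixP; elim/ord3P => j; rewrite ord1 [RHS]mxE.
have pp (k : R) i : 0 < k -> z i 0 != 0 -> 0 < k * z i 0 ^+ 2.
  by move=> k0 zi; rewrite mulr_gt0 // exprn_even_gt0.
have pe (k : R) i : 0 < k -> 0 <= k * z i 0 ^+ 2.
  by move=> k0; rewrite mulr_ge0 // ltW.
case/or3P: nn => zi.
- by have := pp _ _ m zi; have := pe _ i1 p; have := pe _ i2 gg; lra.
- by have := pp _ _ p zi; have := pe _ i0 m; have := pe _ i2 gg; lra.
- by have := pp _ _ gg zi; have := pe _ i1 p; have := pe _ i0 m; lra.
Qed.

Let inv_h t : D t -> invmx (h t) = B *m diag3 (fm t)^-1 (fp t)^-1 (g t)^-1 *m B^T.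
Proof.
move=> Dt; have s := sys Dt; have hu := inner_unit (diag_metric_inner Dt).
apply: (can_inj (mulKmx hu)); rewrite mulmxV //.
rewrite /diag_metric !mulmxA -[_ *m Q *m B]mulmxA QB mulmx1 -[_ *m diag3 _ _ _ *m diag3 _ _ _]mulmxA.
rewrite diag3M !mulfV ?diag3_1 ?mulmx1 ?QBT //.
- by rewrite gt_eqF ?(taub_g_gt0 s).
- by rewrite gt_eqF ?(taub_fp_gt0 s).
- by rewrite gt_eqF ?(taub_fm_gt0 s).
Qed.

Lemma is_mderive_conj (x y z : R -> R) (t x' y' z' : R) (M N : 'M[R]_3) :
  is_derive t 1 x x' -> is_derive t 1 y y' -> is_derive t 1 z z' ->
  is_mderive (fun s => M *m diag3 (x s) (y s) (z s) *m N) t (M *m diag3 x' y' z' *m N).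
Proof.
move=> dx dy dz.
have dd : is_mderive (fun s => diag3 (x s) (y s) (z s)) t (diag3 x' y' z').
  have E (u v w : R) i j : diag3 u v w i j = nth 0 [:: u; v; w] j *+ (i == j).
    by rewrite /diag3 !mxE; case: eqP => [->|].
  move=> i j; rewrite E; under eq_fun do rewrite E.
  case: (i == j) => /=; last exact: is_derive_cst1.
  by elim/ord3P: j.
have := is_mderiveM (is_mderiveM (is_mderive_cst M t) dd) (is_mderive_cst N t).
by rewrite mul0mx add0r mulmx0 addr0.
Qed.

(** [am], [ap], [al] are the eigenvalues of the Weingarten map; below, [th] is their sum and [n2] is
    the square of [nH]. *)
Let am x := (q - c - 2 * be x) / (2 * V x).
Let ap x := (q + c - 2 * be x) / (2 * V x).
Let al x := be x / V x.

Let dh t : D t -> is_mderive h t (2 *: (Q^T *m diag3 (am t * fm t) (ap t * fp t) (al t * g t) *m Q)).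
Proof.
move=> Dt; have s := sys Dt; have Vn : V t != 0 by rewrite gt_eqF ?(taub_V_gt0 s).
apply: is_mderive_val (is_mderive_conj Q^T Q (taub_fm s) (taub_fp s) (taub_g s)) _.
rewrite scalemxAl scalemxAr; congr (_ *m _ *m _).
apply/matrixP; elim/ord3P; elim/ord3P; rewrite /diag3 !mxE /= ?mulr0n ?mulr1n ?mulr0 //; rewrite /am /ap /al; field; by rewrite Vn.
Qed.

Let vel t : D t -> velocity h t = Q^T *m diag3 (am t * fm t) (ap t * fp t) (al t * g t) *m Q.
Proof.
move=> Dt; apply/matrixP => i j; rewrite [LHS]mxE (is_derive1E (dh Dt i j)) [X in _ * X]mxE.
by rewrite mulrA mulVf ?mul1r.
Qed.

Let th t := (q - be t) / V t.
Let n2 t := g t ^+ 2 / V t ^+ 2.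

Let dam t : D t -> is_derive t 1 am (n2 t / 2 - am t * th t).
Proof.
move=> Dt; have s := sys Dt; have Vn : 2 * V t != 0 by rewrite gt_eqF ?mulr_gt0 ?(taub_V_gt0 s).
have := is_deriveM1 (is_deriveB1 (is_derive_cst1 (q - c) t) (is_deriveM1 (is_derive_cst1 2 t) (taub_be s)))
  (@is_deriveV1 R (fun x => 2 * V x) t _ Vn (is_deriveM1 (is_derive_cst1 2 t) (taub_V s))).
move=> /is_derive_val1; apply.
by rewrite /am /th /n2; field; rewrite gt_eqF ?(taub_V_gt0 s).
Qed.

Let dap t : D t -> is_derive t 1 ap (n2 t / 2 - ap t * th t).
Proof.
move=> Dt; have s := sys Dt; have Vn : 2 * V t != 0 by rewrite gt_eqF ?mulr_gt0 ?(taub_V_gt0 s).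
have := is_deriveM1 (is_deriveB1 (is_derive_cst1 (q + c) t) (is_deriveM1 (is_derive_cst1 2 t) (taub_be s)))
  (@is_deriveV1 R (fun x => 2 * V x) t _ Vn (is_deriveM1 (is_derive_cst1 2 t) (taub_V s))).
move=> /is_derive_val1; apply.
by rewrite /ap /th /n2; field; rewrite gt_eqF ?(taub_V_gt0 s).
Qed.

Let dal t : D t -> is_derive t 1 al (- n2 t / 2 - al t * th t).
Proof.
move=> Dt; have s := sys Dt; have Vn : V t != 0 by rewrite gt_eqF ?(taub_V_gt0 s).
have := is_deriveM1 (taub_be s) (is_deriveV1 Vn (taub_V s)).
move=> /is_derive_val1; apply.
by rewrite /al /th /n2; field.
Qed.

Let dvel t : D t -> is_mderive (velocity h) t (Q^T *m diag3
   (fm t * (n2 t / 2 - am t * th t + 2 * am t ^+ 2))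
   (fp t * (n2 t / 2 - ap t * th t + 2 * ap t ^+ 2))
   (g t * (- n2 t / 2 - al t * th t + 2 * al t ^+ 2)) *m Q).
Proof.
move=> Dt; have s := sys Dt; have Vn : V t != 0 by rewrite gt_eqF ?(taub_V_gt0 s).
apply: (@is_mderive_near _ _ _ (fun x => Q^T *m diag3 (am x * fm x) (ap x * fp x) (al x * g x) *m Q)).
  near=> x; rewrite vel //; near: x; exact: within_dom_near.
apply: is_mderive_val.
  exact: (is_mderive_conj Q^T Q (is_deriveM1 (dam Dt) (taub_fm s)) (is_deriveM1 (dap Dt) (taub_fp s)) (is_deriveM1 (dal Dt) (taub_g s))).
congr (_ *m diag3 _ _ _ *m _).
- by rewrite /am; field.
- by rewrite /ap; field.
- by rewrite /al; field.
Unshelve. all: by end_near. Qed.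

Let Mx t : D t -> velocity h t *m invmx (h t) = Q^T *m diag3 (am t) (ap t) (al t) *m B^T.
Proof.
move=> Dt; have s := sys Dt; rewrite vel // inv_h // !mulmxA -[_ *m Q *m B]mulmxA QB mulmx1.
rewrite -[_ *m diag3 _ _ _ *m diag3 _ _ _]mulmxA diag3M; congr (_ *m diag3 _ _ _ *m _).
- by rewrite mulfK // gt_eqF ?(taub_fm_gt0 s).
- by rewrite mulfK // gt_eqF ?(taub_fp_gt0 s).
- by rewrite mulfK // gt_eqF ?(taub_g_gt0 s).
Qed.

(** The mixed components vanish because the Weingarten map preserves the centre, the spatial ones by
    the scalar system together with [Vdet], and the time component by [energy], which is the
    Hamiltonian constraint. *)
Lemma diag_metric_vacuum : vacuum_development a b h.
Proof.
move=> t at_ tb; have Dt : D t by split.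
have s := sys Dt; have Vp := taub_V_gt0 s.
have hd i j : derivable (fun x => h x i j) t 1 by case: (dh Dt i j).
split=> //; first exact: diag_metric_inner.
  move=> i j; apply: (@near_eq_derivable _ _ _ (fun x => 2 * velocity h x i j)).
    by near=> x; rewrite mxE mulrA divff ?mul1r.
  by apply: derivableM => //; case: (dvel Dt i j).
have good : \forall x \near t, (h x)^T = h x /\ h x \in unitmx.
  near=> x; have Dx : D x by near: x; exact: within_dom_near.
  by split; [exact: (diag_metric_inner Dx).1|exact: inner_unit (diag_metric_inner Dx)].
have h22 : \forall x \near t, h x i2 i2 != 0.
  near=> x; have Dx : D x by near: x; exact: within_dom_near.
  by rewrite gt_eqF // inner_h22_gt0 //; exact: diag_metric_inner.
have mix i : \sum_k heis R i k i2 * (velocity h t *m invmx (h t)) i2 k = 0.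
  have e k : (velocity h t *m invmx (h t)) i2 k = al t * (k == i2)%:R.
    rewrite Mx //.
    have -> : Q^T *m diag3 (am t) (ap t) (al t) *m B^T = (B *m diag3 (am t) (ap t) (al t) *m Q)^T.
      by rewrite !trmx_mul diag3T mulmxA.
    have : (B *m diag3 (am t) (ap t) (al t) *m Q) *m (@e2 R) = al t *: (@e2 R).
      rewrite -mulmxA Qe2 -mulmxA (_ : diag3 _ _ _ *m (@e2 R) = al t *: (@e2 R)) ?scalemxAr -?scalemxAr ?Be2 //.
      by apply/matrixP; elim/ord3P => j; rewrite ord1 /diag3 !mxE sum3 !mxE /=; ring.
    move=> /(congr1 (fun M : 'cV[R]_3 => M k 0)); move: (B *m _ *m Q) => N.
    by rewrite !mxE sum3 !mxE /= !(mulr0, add0r, mulr1) andbT.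
  by rewrite sum3 !e /heis; elim/ord3P: i => /=; ring.
move=> x y; case: (split_ordP x) => [x' ->|x' ->]; case: (split_ordP y) => [y' ->|y' ->].
- rewrite !ord1 (ricci_tt good).
  have dM : is_mderive (fun x => velocity h x *m invmx (h x)) t
    (Q^T *m diag3 (n2 t / 2 - am t * th t) (n2 t / 2 - ap t * th t) (- n2 t / 2 - al t * th t) *m B^T).
    apply: is_mderive_near (is_mderive_conj Q^T B^T (dam Dt) (dap Dt) (dal Dt)).
    by near=> z; rewrite Mx //; near: z; exact: within_dom_near.
  move: dM; set N := (Q^T *m _ *m _) => dM.
  have tN : \tr N = (n2 t / 2 - am t * th t) + (n2 t / 2 - ap t * th t) + (- n2 t / 2 - al t * th t).
    by rewrite /N mxtrace_mulC mulmxA BQT mul1mx diag3_tr.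
  under eq_bigr do rewrite (is_derive1E (dM _ _)).
  rewrite -[\sum_i N i i]/(\tr N) tN.
  rewrite Mx // !mulmxA -[_ *m B^T *m Q^T]mulmxA BQT mulmx1 mxtrace_mulC !mulmxA BQT mul1mx.
  rewrite diag3M diag3_tr.
  (* The Hamiltonian constraint enters here: it trades the curvature of the slice for a quadratic
     expression in the eigenvalues. *)
  have -> : n2 t = (q ^+ 2 - 4 * be t ^+ 2 - c ^+ 2) / V t ^+ 2.
    by rewrite /n2; congr (_ / _); rewrite (energy Dt); ring.
  by rewrite /am /ap /al /th; field; rewrite gt_eqF.
- by rewrite ord1 (ricci_ts good h22 hd).
- by rewrite ord1 (ricci_st good h22).
- rewrite (ricci_ss good h22) (is_derive1E (dvel Dt x' y')) -Vdet // Mx // vel //.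
  have -> : \tr (Q^T *m diag3 (am t) (ap t) (al t) *m B^T) = am t + ap t + al t.
    by rewrite mxtrace_mulC mulmxA BQT mul1mx diag3_tr.
  rewrite !mulmxA -[_ *m B^T *m Q^T]mulmxA BQT mulmx1 -[Q^T *m _ *m diag3 _ _ _]mulmxA diag3M.
  rewrite /diag_metric !conjE !Qi2 /=.
  by rewrite /am /ap /al /th /n2; field; rewrite gt_eqF.
Unshelve. all: by end_near. Qed.
End DiagonalDevelopment.

(** * Proper time *)

Section Clock.
Variable R : realType.

Lemma powR_norm_continuous (p : R) : 0 < p -> continuous (fun x : R => `|x| `^ p).
Proof.
move=> p0 x; have [->|x0] := eqVneq x 0.
  apply/cvgrPdist_lt => e e0; near=> z.
  rewrite normr0 powR0 ?gt_eqF // sub0r normrN ger0_norm ?powR_ge0 //.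
  have ze : `|z| < e `^ p^-1.
    near: z; apply/nbhs_ballP; exists (e `^ p^-1) => /=; first exact: powR_gt0.
    by move=> z; rewrite /ball /= sub0r normrN.
  apply: lt_le_trans (gt0_ltr_powR p0 _ _ ze) _; rewrite ?nnegrE ?powR_ge0 //.
  by rewrite -powRrM mulVf ?gt_eqF // powRr1 // ltW.
apply: (@continuous_comp _ _ _ (@Num.norm R R) (fun z => z `^ p)); first exact: norm_continuous.
apply: differentiable_continuous; apply/derivable1_diffP.
by have [] := @is_derive1_powR R p `|x| _; rewrite ?normr_gt0.
Unshelve. all: by end_near. Qed.

(** Integrating from -1 puts 0, where the clock variable [m] ends at the past boundary, in the
    interior of the domain of differentiability. *)
Lemma continuous_primitive (w : R -> R) : continuous w ->
  exists F : R -> R, F 0 = 0 /\ forall x : R, -1 < x -> is_derive x 1 F (w x).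
Proof.
move=> wc; pose F x := (\int[lebesgue_measure]_(t in `[-1, x]) w t)%R.
exists (fun x => F x - F 0); split=> [|x x1]; first by rewrite subrr.
rewrite -[w x]subr0; apply: is_deriveB1 (is_derive_cst1 _ x).
have int : lebesgue_measure.-integrable `[-1, x + 1] (EFin \o w).
  apply: continuous_compact_integrable; first exact: segment_compact.
  by apply: continuous_subspaceT.
have xx1 : x < x + 1 by rewrite ltrDl.
have [dF dFE] := continuous_FTC1_closed xx1 int x1 (wc x).
by rewrite -dFE; exact: derivable_is_derive.
Qed.

Variables (y0 k : R).
Hypothesis y00 : 0 < y0.
Hypothesis k0 : 0 < k.

(* With [x = (y / y0)^k] this is [sqrt (1 + y^2)]; the absolute value only serves
   to make it continuous on the whole line. *)
Definition clock_rate (x : R) := Num.sqrt (1 + y0 ^+ 2 * `|x| `^ (2 / k)).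

Lemma clock_rate_continuous : continuous clock_rate.
Proof.
move=> x; apply: (@continuous_comp _ _ _ (fun x => 1 + y0 ^+ 2 * `|x| `^ (2 / k)) Num.sqrt); last exact: sqrt_continuous.
apply: cvgD; first exact: cvg_cst.
by apply: cvgM; [exact: cvg_cst|apply: powR_norm_continuous; rewrite divr_gt0].
Qed.

Lemma clock_rate_ge1 x : 1 <= clock_rate x.
Proof.
rewrite -[leLHS]sqrtr1; apply: ler_wsqrtr.
by rewrite lerDl mulr_ge0 ?sqr_ge0 ?powR_ge0.
Qed.

Lemma clock_rate_homo x z : 0 <= x -> x <= z -> clock_rate x <= clock_rate z.
Proof.
move=> x0 xz; have z0 := le_trans x0 xz.
apply: ler_wsqrtr; rewrite lerD2l ler_wpM2l ?sqr_ge0 //.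
by rewrite !ger0_norm // ge0_ler_powR // ?nnegrE // divr_ge0 // ltW.
Qed.

Lemma clock_rateE y : 0 < y ->
  clock_rate (expR (k * (ln y - ln y0))) = Num.sqrt (1 + y ^+ 2).
Proof.
move=> yp; rewrite /clock_rate gtr0_norm ?expR_gt0 //; congr (Num.sqrt (1 + _)).
rewrite /powR gt_eqF ?expR_gt0 // expRK mulrA mulfVK ?gt_eqF //.
rewrite mulrBr !mulr_natl -!lnXn // expRB !lnK ?posrE ?exprn_gt0 //.
by rewrite mulrCA mulfV ?mulr1 // gt_eqF ?exprn_gt0.
Qed.

Variable Phi : R -> R.
Hypothesis Phi0 : Phi 0 = 0.
Hypothesis dPhi : forall x : R, -1 < x -> is_derive x 1 Phi (clock_rate x).

Lemma clock_MVT x z : 0 <= x -> x < z ->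
  exists2 c, x <= c <= z & Phi z - Phi x = clock_rate c * (z - x).
Proof.
move=> x0 xz.
have dP c : x <= c -> is_derive c 1 Phi (clock_rate c).
  by move=> xc; apply: dPhi; apply: lt_le_trans (le_trans x0 xc); rewrite ltrN10.
have [||c] := @MVT R Phi clock_rate x z xz.
- by move=> c; rewrite in_itv /= => /andP[/ltW xc _]; exact: dP.
- apply: derivable_within_continuous => c; rewrite in_itv /= => /andP[xc _].
  by have [] := dP c xc.
by rewrite in_itv /= => /andP[/ltW xc /ltW cz] e; exists c => //; rewrite xc.
Qed.

Lemma clock_lt x z : 0 <= x -> x < z -> Phi x < Phi z.
Proof.
move=> x0 xz; have [c _ e] := clock_MVT x0 xz.
by rewrite -subr_gt0 e mulr_gt0 ?subr_gt0 // (lt_le_trans _ (clock_rate_ge1 c)).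
Qed.

Lemma clock_bounds x : 0 < x -> x <= Phi x <= x * clock_rate x.
Proof.
move=> xp; have [c /andP[c0 cx]] := clock_MVT (lexx 0) xp.
rewrite Phi0 !subr0 => ->; apply/andP; split.
  by rewrite ler_peMl ?clock_rate_ge1 ?ltW.
by rewrite [clock_rate c * x]mulrC ler_pM2l //; exact: clock_rate_homo.
Qed.

Lemma clock_inj x z : 0 <= x -> 0 <= z -> Phi x = Phi z -> x = z.
Proof.
move=> x0 z0 e; case: (ltgtP x z) => // xz.
- by have := clock_lt x0 xz; rewrite e ltxx.
- by have := clock_lt z0 xz; rewrite e ltxx.
Qed.

Lemma clock_onto v : 0 < v -> exists2 x, 0 < x & Phi x = v.
Proof.
move=> vp; have /andP[vP _] := clock_bounds vp.
have [||c] := @IVT R Phi 0 v v (ltW vp).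
- apply: derivable_within_continuous => c; rewrite in_itv /= => /andP[c0 _].
  by have [] := dPhi (lt_le_trans (ltrN10 R) c0).
- by rewrite Phi0 ge_min le_max vP (ltW vp) orbT.
rewrite in_itv /= => /andP[c0 _] Pc; exists c => //.
rewrite lt_neqAle c0 andbT; apply/eqP => c00.
by move: vp; rewrite -Pc -c00 Phi0 ltxx.
Qed.

Lemma clock_inverse : exists Psi : R -> R, forall v, 0 < v ->
  [/\ 0 < Psi v, Phi (Psi v) = v & is_derive v 1 Psi (clock_rate (Psi v))^-1].
Proof.
(* Only positive arguments matter; the value 0 elsewhere is a default. *)
pose Psi v := if pselect (0 < v) is left vp then s2val (cid2 (clock_onto vp)) else 0.
have PsiP v : 0 < v -> 0 < Psi v /\ Phi (Psi v) = v.
  by move=> vp; rewrite /Psi; case: pselect => // vp'; case: cid2.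
exists Psi => v vp; have [Pp Pe] := PsiP v vp; split=> //.
rewrite -{1}Pe; apply: is_derive_inverse.
- near=> x; have xp : 0 < x by near: x; exact: lt_nbhsr.
  have Px : 0 < Phi x by have /andP[xP _] := clock_bounds xp; exact: lt_le_trans xP.
  have [a b] := PsiP _ Px.
  by apply: clock_inj; rewrite ?ltW.
- near=> x; have xp : 0 < x by near: x; exact: lt_nbhsr.
  apply: differentiable_continuous; apply/derivable1_diffP.
  by have [] := dPhi (lt_trans (ltrN10 R) xp).
- by apply: dPhi; exact: lt_trans (ltrN10 R) Pp.
- by rewrite gt_eqF // (lt_le_trans _ (clock_rate_ge1 _)).
Unshelve. all: by end_near. Qed.
End Clock.

(** * From the datum to its explicit solution *)

Section DatumScalars.
Variables (R : realType) (h : 'M[R]_3) (s : R) (A : 'M[R]_3) (mu : R).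
Hypothesis hp : inner_product h.
Hypothesis s0 : 0 < s.
Hypothesis Anorm : hs_norm h A = Num.sqrt 2 * mu.
Local Notation n := (nH h).
Local Notation al := (alpha h s A).
Let n0 : 0 < n := nH_gt0 hp.

(** The constants of the scalar system freed from the initial volume [V0]: [E = V0 rho], [q = E u],
    [c = E r], and [datum_y] is the value of [y] on the slice of the datum. *)
Definition datum_rho := Num.sqrt (4 * al ^+ 2 + n ^+ 2).
Local Notation rho := datum_rho.
Definition datum_u := (s + 2 * al) / rho.
Local Notation u := datum_u.
Definition datum_y := (rho - 2 * al) / n.
Local Notation y0 := datum_y.
Let r := 2 * mu / rho.

Lemma rho_gt0 : 0 < rho.
Proof. rewrite sqrtr_gt0; have : 0 < n ^+ 2 by rewrite exprn_gt0.
by have := sqr_ge0 al; lra. Qed.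
Let rhon : rho != 0. Proof. by rewrite gt_eqF ?rho_gt0. Qed.
Let nn : n != 0. Proof. by rewrite gt_eqF. Qed.

Lemma rho_sq : rho ^+ 2 = 4 * al ^+ 2 + n ^+ 2.
Proof.
by rewrite sqr_sqrtr //; have := sqr_ge0 al; have := sqr_ge0 n; lra.
Qed.

(** The formula for [alpha] is the Hamiltonian constraint solved for the central eigenvalue; here it
    reads [q^2 = E^2 + c^2] after division by [V0^2], and it gives [u = sqrt (1 + r^2)]. *)
Lemma datum_constraint : (s + 2 * al) ^+ 2 = rho ^+ 2 + 4 * mu ^+ 2.
Proof.
have aE : 4 * s * al = n ^+ 2 - s ^+ 2 + 4 * mu ^+ 2.
  have -> : 4 * mu ^+ 2 = 2 * hs_norm h A ^+ 2 by rewrite Anorm exprMn sqr_sqrtr //; ring.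
  by rewrite /alpha; field; rewrite gt_eqF.
by rewrite rho_sq; lra.
Qed.

Lemma datum_expansion_gt0 : 0 < s + 2 * al.
Proof.
have s20 : 0 < 2 * s by rewrite mulr_gt0.
have e : (s + 2 * al) * (2 * s) = n ^+ 2 + s ^+ 2 + 2 * hs_norm h A ^+ 2.
  by rewrite /alpha; field; rewrite gt_eqF.
rewrite -(pmulr_lgt0 _ s20) e; have : 0 < n ^+ 2 by rewrite exprn_gt0.
by have := sqr_ge0 s; have := sqr_ge0 (hs_norm h A); lra.
Qed.

Lemma datum_u_gt0 : 0 < u. Proof. by rewrite divr_gt0 ?datum_expansion_gt0 ?rho_gt0. Qed.

Lemma datum_u_sq : u ^+ 2 = 1 + r ^+ 2.
Proof.
rewrite /datum_u expr_div_n datum_constraint /r; field; exact: rhon.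
Qed.

Lemma datum_u_ge1 : 1 <= u.
Proof.
rewrite -(@ler_pXn2r _ 2) ?nnegrE ?ler01 ?(ltW datum_u_gt0) // expr1n datum_u_sq.
by rewrite lerDl sqr_ge0.
Qed.

Lemma datum_y_gt0 : 0 < y0.
Proof.
rewrite divr_gt0 // subr_gt0; have := rho_sq; have := rho_gt0; move: n0 => n1 r1 r2.
rewrite ltNge; apply/negP => le.
have : rho * rho <= 2 * al * (2 * al) by apply: ler_pM => //; exact: ltW.
have : 0 < n * n by exact: mulr_gt0.
by move: r2; rewrite !expr2; lra.
Qed.

End DatumScalars.

Section Datum.
Variables (R : realType) (h : 'M[R]_3) (s : R) (A : 'M[R]_3) (t0 : R)
  (h_ : R -> 'M[R]_3) (b : \bar R) (K : 'M[R]_3) (Xm Xp : 'cV[R]_3) (mu : R).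
Hypothesis s0 : 0 < s.
Hypothesis maxdev : maximal_vacuum_development 0%E b h_.
Hypothesis t00 : 0 < t0.
Hypothesis t0b : (t0%:E < b)%E.
Hypothesis sff : second_fundamental_form h s A K.
Hypothesis h0 : h_ t0 = h.
Hypothesis dh0 : forall i j, 2^-1 * derive1 (fun t => h_ t i j) t0 = K i j.
Hypothesis um : unit_horizontal h Xm.
Hypothesis up : unit_horizontal h Xp.
Hypothesis mp : form h Xm Xp = 0.
Hypothesis Am : A *m Xm = - mu *: Xm.
Hypothesis Ap : A *m Xp = mu *: Xp.
Hypothesis Anorm : hs_norm h A = Num.sqrt 2 * mu.

Let dev := maxdev.1.
Local Notation D := (within_dom 0%E b).
Local Notation L := (weingarten h_).
Local Notation V := (vol h_).
Local Notation be := (center_momentum h_).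
Local Notation g := (fun t => h_ t i2 i2).
Local Notation fm := (fun t => form (h_ t) Xm Xm).
Local Notation fp := (fun t => form (h_ t) Xp Xp).
Local Notation n := (nH h).
Local Notation al := (alpha h s A).

Let D0 : D t0. Proof. by split; rewrite ?lte_fin. Qed.
Let hp : inner_product h. Proof. by have := dev_inner dev D0; rewrite h0. Qed.
Let n0 : 0 < n := nH_gt0 hp.

Let L0 : exists2 L0, L t0 = L0 & (forall v, horizontal h v -> L0 *m v = (s / 2) *: v + A *m v)
  /\ L0 *m (@e2 R) = al *: (@e2 R).
Proof.
have [L0 [KE Lh Lc]] := sff; exists L0; last by split=> //; exact: Lc (@central_e2 R).
rewrite /weingarten (_ : velocity h_ t0 = K); last by apply/matrixP => i j; rewrite mxE.
by rewrite h0 KE mulKmx // inner_unit.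
Qed.

Let Lm : L t0 *m Xm = (s / 2 - mu) *: Xm.
Proof. by have [L1 -> [Lh _]] := L0; rewrite (Lh _ um.1) Am -scalerDl. Qed.
Let Lp : L t0 *m Xp = (s / 2 + mu) *: Xp.
Proof. by have [L1 -> [Lh _]] := L0; rewrite (Lh _ up.1) Ap -scalerDl. Qed.
Let Le : L t0 i2 i2 = al.
Proof.
have [L1 -> [_]] := L0; move/(congr1 (fun M : 'cV[R]_3 => M i2 0)).
by rewrite !mxE sum3 !mxE /= !(mulr0, add0r, mulr1).
Qed.

Local Notation rho := (datum_rho h s A).
Local Notation u := (datum_u h s A).
Local Notation y0 := (datum_y h s A).
Let r := 2 * mu / rho.
Let rho_gt0 := rho_gt0 s A hp.
Let rho_sq := rho_sq h s A.
Let datum_u_sq := datum_u_sq hp s0 Anorm.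
Let datum_u_ge1 := datum_u_ge1 hp s0 Anorm.
Let datum_y_gt0 := datum_y_gt0 s A hp.
Let rhon : rho != 0. Proof. by rewrite gt_eqF ?rho_gt0. Qed.
Let nn : n != 0. Proof. by rewrite gt_eqF. Qed.

Let V0 := V t0.
Let E := V0 * rho.
Let q := E * u.
Let c := E * r.
Let V00 : 0 < V0 := vol_gt0 dev D0.
Let V0n : V0 != 0. Proof. by rewrite gt_eqF. Qed.
Let E0 : 0 < E. Proof. by rewrite mulr_gt0 ?rho_gt0. Qed.
Let En : E != 0. Proof. by rewrite gt_eqF. Qed.
Let qE : q = V0 * (s + 2 * al). Proof. by rewrite /q /E /datum_u; field. Qed.
Let cE : c = 2 * V0 * mu. Proof. by rewrite /c /E /r; field. Qed.
Let be0 : be t0 = V0 * al. Proof. by rewrite /center_momentum Le. Qed.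
Let g0E : h_ t0 i2 i2 = V0 * n.
Proof. by rewrite (nHE hp) /V0 /vol h0 mulrC mulfVK // gt_eqF // sqrtr_gt0 inner_det_gt0. Qed.

Let um' : unit_horizontal (h_ t0) Xm. Proof. by rewrite h0. Qed.
Let up' : unit_horizontal (h_ t0) Xp. Proof. by rewrite h0. Qed.
Let mp' : form (h_ t0) Xm Xp = 0. Proof. by rewrite h0. Qed.

Lemma datum_system t : D t -> taub_system q c V g be fm fp t.
Proof.
move=> Dt; have Vp := vol_gt0 dev Dt; have Vn : V t != 0 by rewrite gt_eqF.
have trL : V t * \tr (L t) = q - be t.
  rewrite (volume_expansion dev D0 Dt) (weingarten_trace dev D0 um' up' mp' Lm Lp) Le be0 qE.
  by rewrite -/V0; field.
have L22 : L t i2 i2 = be t / V t by rewrite /center_momentum mulrC mulKf.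
have dV : is_derive t 1 V (q - be t) by have := vol_derivative dev Dt; rewrite trL.
have dg : is_derive t 1 g (2 * be t / V t * g t).
  by have := h22_derivative dev Dt; rewrite L22 mulrA.
have dm : is_derive t 1 fm ((q - c - 2 * be t) / V t * fm t).
  apply: is_derive_val1 (eigen_derivative dev D0 um' Lm Dt) _.
  by congr (_ / _ * _); rewrite be0 qE cE -/V0; field.
have dp : is_derive t 1 fp ((q + c - 2 * be t) / V t * fp t).
  apply: is_derive_val1 (eigen_derivative dev D0 up' Lp Dt) _.
  by congr (_ / _ * _); rewrite be0 qE cE -/V0; field.
exact: (@TaubSystem R q c V g be fm fp t Vp (h22_gt0 dev Dt) (eigen_gt0 dev um' Dt)
  (eigen_gt0 dev up' Dt) dV dg (beta_derivative dev Dt) dm dp).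
Qed.

Let E2 : E ^+ 2 = 4 * be t0 ^+ 2 + g t0 ^+ 2.
Proof. by rewrite /E exprMn rho_sq be0 g0E; ring. Qed.

Local Notation y := (taub_y E g be).

Let yt0 : y t0 = y0.
Proof. by rewrite /taub_y be0 g0E /datum_y /E; field; rewrite nn V0n. Qed.

Let yp t : D t -> 0 < y t. Proof. exact: taub_y_gt0 datum_system D0 E0 E2 t. Qed.

Let fm0 : fm t0 = 1. Proof. by rewrite /= h0; exact: um.2. Qed.
Let fp0 : fp t0 = 1. Proof. by rewrite /= h0; exact: up.2. Qed.

Let kmE : (q - c) / E = u - r. Proof. by rewrite /q /c -mulrBr mulrC mulKf. Qed.
Let kpE : (q + c) / E = u + r. Proof. by rewrite /q /c -mulrDr mulrC mulKf. Qed.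

Let fmE t : D t -> fm t = prof_f y0 (u - r) (y t).
Proof.
move=> Dt; apply: (taub_fE datum_system D0 E0 E2 yt0 fm0) => // x Dx.
  exact: taub_fm_gt0 (datum_system Dx).
by apply: is_derive_val1 (taub_fm (datum_system Dx)) _; rewrite /q /c mulrBr.
Qed.

Let fpE t : D t -> fp t = prof_f y0 (u + r) (y t).
Proof.
move=> Dt; apply: (taub_fE datum_system D0 E0 E2 yt0 fp0) => // x Dx.
  exact: taub_fp_gt0 (datum_system Dx).
by apply: is_derive_val1 (taub_fp (datum_system Dx)) _; rewrite /q /c mulrDr.
Qed.

Let gE t : D t -> g t = prof_g E (y t).
Proof. by move=> Dt; exact: (taub_gE datum_system D0 E2 Dt). Qed.

Let VE t : D t -> V t = prof_V V0 u y0 (y t).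
Proof. by move=> Dt; exact: (taub_VE datum_system D0 (erefl V0) E0 E2 (erefl q) yt0 Dt). Qed.

Local Notation k := (u - 2^-1).
Let k0 : 0 < k. Proof. by have := datum_u_ge1; lra. Qed.
Let y00 := datum_y_gt0.
Let m t := expR (k * (ln (y t) - ln y0)).

Variable Phi : R -> R.
Hypothesis Phi0 : Phi 0 = 0.
Hypothesis dPhi : forall x : R, -1 < x -> is_derive x 1 Phi (clock_rate y0 k x).

Let c1 := k * E * Num.sqrt (1 + y0 ^+ 2) / V0.
Let S0 : 0 < Num.sqrt (1 + y0 ^+ 2). Proof. by rewrite sqrtr_gt0 sq1_gt0. Qed.
Let c10 : 0 < c1. Proof. exact: divr_gt0 (mulr_gt0 (mulr_gt0 k0 E0) S0) V00. Qed.

Let prof_VS z : prof_V V0 u y0 z =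
  V0 * expR (k * (ln z - ln y0)) * (Num.sqrt (1 + z ^+ 2) / Num.sqrt (1 + y0 ^+ 2)).
Proof.
by rewrite /prof_V sqrtrM ?sqrtrV // ltW // sq1_gt0.
Qed.

(** Here [m' = k E m / V] and [V = V0 m sqrt (1 + y^2) / sqrt (1 + y0^2)], so the factor
    [sqrt (1 + y^2)] in the rate of [Phi] cancels and [Phi (m t)] has the constant rate [c1]. *)
Lemma clock_advance t : D t -> Phi (m t) = c1 * (t + (Phi 1 / c1 - t0)).
Proof.
move=> Dt.
have e : Phi (m t) - c1 * t = Phi (m t0) - c1 * t0.
  apply: (@within_dom_cst _ 0%E b (fun t => Phi (m t) - c1 * t)) => // x Dx.
  have Vx : 0 < V x := vol_gt0 dev Dx.
  have Vn : V x != 0 by rewrite gt_eqF.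
  have yx := yp Dx.
  have dy := taub_y_derivative datum_system D0 E2 Dx.
  have dm := is_derive_expR1 (is_deriveM1 (is_derive_cst1 k x)
    (is_deriveB1 (is_derive_ln1 yx dy) (is_derive_cst1 (ln y0) x))).
  have mx : -1 < m x by apply: lt_trans (ltrN10 R) (expR_gt0 _).
  have dP := is_derive_comp1 dm (dPhi mx).
  have dt : is_derive x 1 (fun t => c1 * t) c1.
    by apply: is_derive_val1 (is_deriveM1 (is_derive_cst1 c1 x) (is_derive_id x 1)) _; ring.
  have := is_deriveB1 dP dt; move=> /is_derive_val1; apply.
  rewrite /m clock_rateE // -/(m x).
  have := VE Dx; rewrite prof_VS -/(m x) => VxE.
  have mn : m x != 0 by rewrite gt_eqF ?expR_gt0.
  have Sn : Num.sqrt (1 + y0 ^+ 2) != 0 by rewrite gt_eqF.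
  have Sx : Num.sqrt (1 + y x ^+ 2) != 0 by rewrite gt_eqF // sqrtr_gt0 sq1_gt0.
  rewrite VxE /c1; move: (m x) mn (Num.sqrt (1 + y x ^+ 2)) Sx (Num.sqrt _) Sn => a an S Sn S' Sn'.
  by field; rewrite !(an, Sn, Sn', V0n) gt_eqF.
have m1 : m t0 = 1 by rewrite /m yt0 subrr mulr0 expR0.
have c1n : c1 != 0 by rewrite gt_eqF.
have -> : Phi (m t) = Phi 1 - c1 * t0 + c1 * t by rewrite -m1 -e; ring.
by field.
Qed.

(** The affine clock [c1 (t + T0)] vanishes at [- T0], the time down to which the explicit solution
    extends. *)
Let T0 := Phi 1 / c1 - t0.

Let m_gt0 t : 0 < m t. Proof. exact: expR_gt0. Qed.

Let T0_ge0 : 0 <= T0.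
Proof.
rewrite leNgt; apply/negP => T00.
(* A time of the development not later than [- T0]: there the affine clock is not positive, although
   [Phi (m t) >= m t > 0]. *)
have Dt : D (Num.min t0 (- T0)).
  split; first by rewrite lte_fin lt_min t00 oppr_gt0.
  by apply: le_lt_trans t0b; rewrite lee_fin ge_min lexx.
have /andP[mP _] := clock_bounds k0 Phi0 dPhi (m_gt0 (Num.min t0 (- T0))).
have := lt_le_trans (m_gt0 _) mP; rewrite clock_advance // -/T0 pmulr_rgt0 //.
have : Num.min t0 (- T0) <= - T0 by rewrite ge_min lexx orbT.
by lra.
Qed.

Section Extension.
Variable Psi : R -> R.
Hypothesis PsiP : forall v, 0 < v ->
  [/\ 0 < Psi v, Phi (Psi v) = v & is_derive v 1 Psi (clock_rate y0 k (Psi v))^-1].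
(** The solution read from time to geometry: the inverse clock recovers [m], and [ye] inverts
    [m = (y / y0)^k]. Both make sense on the larger interval starting at [- T0]. *)
Let M t := Psi (c1 * (t + T0)).
Let ye t := y0 * expR (k^-1 * ln (M t)).
Local Notation D' := (within_dom (- T0)%:E b).

Let arg_gt0 t : D' t -> 0 < c1 * (t + T0).
Proof. by move=> [+ _]; rewrite lte_fin => Tt; rewrite mulr_gt0 //; lra. Qed.

Let ye_gt0 t : 0 < ye t. Proof. by rewrite mulr_gt0 ?expR_gt0. Qed.

Let ln_ye t : ln (ye t) - ln y0 = k^-1 * ln (M t).
Proof. by rewrite /ye lnM ?posrE ?expR_gt0 // expRK; ring. Qed.

Let dye t : D' t -> is_derive t 1 ye (E * ye t / prof_V V0 u y0 (ye t)).
Proof.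
move=> Dt; have [Mp _ dPsi] := PsiP (arg_gt0 Dt); rewrite -/(M t) in Mp dPsi.
have darg : is_derive t 1 (fun t => c1 * (t + T0)) c1.
  apply: is_derive_val1 (is_deriveM1 (is_derive_cst1 c1 t)
    (is_deriveD1 (is_derive_id t 1) (is_derive_cst1 T0 t))) _; ring.
have dM : is_derive t 1 M (c1 * (clock_rate y0 k (M t))^-1) by exact: is_derive_comp1 darg dPsi.
have := is_deriveM1 (is_derive_cst1 y0 t) (is_derive_expR1
  (is_deriveM1 (is_derive_cst1 k^-1 t) (is_derive_ln1 Mp dM))).
move=> /is_derive_val1; apply.
have kn : k != 0 by rewrite gt_eqF.
have mE : expR (k * (ln (ye t) - ln y0)) = M t.
  by rewrite ln_ye mulrA mulfV // mul1r lnK.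
rewrite -[in clock_rate _ _ _]mE clock_rateE // prof_VS mE /c1.
rewrite mul0r add0r mulrCA -/(ye t) mul0r add0r.
have Mn : M t != 0 by rewrite gt_eqF.
have Sn : Num.sqrt (1 + y0 ^+ 2) != 0 by rewrite gt_eqF.
have Sx : Num.sqrt (1 + ye t ^+ 2) != 0 by rewrite gt_eqF // sqrtr_gt0 sq1_gt0.
move: (k) kn (M t) Mn (Num.sqrt (1 + ye t ^+ 2)) Sx (Num.sqrt _) Sn => k' k'n a an S Sn S' Sn'.
by field; rewrite !(an, Sn, Sn', V0n).
Qed.

(** The clock is injective, so the continued [y] must agree with the one of the given development;
    this takes the place of a uniqueness theorem. *)
Let yeE t : D t -> ye t = y t.
Proof.
move=> Dt; have Dt' : D' t.
  split; last exact: Dt.2.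
  by apply: le_lt_trans Dt.1; rewrite lee_fin oppr_le0 T0_ge0.
have [Mp PM _] := PsiP (arg_gt0 Dt').
have MmE : M t = m t.
  apply: (clock_inj dPhi (ltW Mp) (ltW (m_gt0 t))).
  by rewrite PM clock_advance.
have kn : k != 0 by rewrite gt_eqF.
rewrite /ye MmE /m expRK mulrA mulVf // mul1r expRB !lnK ?posrE ?yp //.
by rewrite mulrCA mulfV ?mulr1 // gt_eqF.
Qed.

Local Notation Q := (coframe Xm Xp).
Local Notation B := (frame Xm Xp).
Let hext := diag_metric (fun t => prof_g E (ye t)) (fun t => prof_f y0 ((q - c) / E) (ye t))
  (fun t => prof_f y0 ((q + c) / E) (ye t)) Q.

Let hextE t : D t -> hext t = h_ t.
Proof.
move=> Dt; rewrite /hext /diag_metric yeE // kmE kpE -fmE // -fpE // -gE //.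
by rewrite -(diagonal_metric dev D0 um' up' mp' Lm Lp Dt).
Qed.

Let detQ : \det Q ^+ 2 * (V0 * n) = V0 ^+ 2.
Proof.
have <- : \det h = V0 ^+ 2 by rewrite /V0 /vol h0 sqr_sqrtr // ltW // inner_det_gt0.
rewrite [in RHS](metric_coframe hp um up mp) !detM det_tr det_diag3 -[in RHS]h0 g0E; ring.
Qed.

Lemma extension_absurd : 0 < T0 -> False.
Proof.
move=> T00.
have sysx t : D' t -> taub_system q c (fun x => prof_V V0 u y0 (ye x)) (fun x => prof_g E (ye x))
  (fun x => prof_be E (ye x)) (fun x => prof_f y0 ((q - c) / E) (ye x))
  (fun x => prof_f y0 ((q + c) / E) (ye x)) t.
  by move=> Dt; exact: (prof_taub c V00 E0 (erefl q) (ye_gt0 t) (dye Dt)).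
have Be2 : B *m (@e2 R) = (@e2 R).
  by apply/matrixP; elim/ord3P => j; rewrite ord1 !mxE sum3 !mxE /= ?mxE /=; ring.
have Vdet t : D' t -> prof_V V0 u y0 (ye t) ^+ 2 = \det (hext t).
  move=> _; rewrite /hext /diag_metric !detM det_tr det_diag3 kmE kpE.
  have -> : \det Q * (prof_f y0 (u - r) (ye t) * prof_f y0 (u + r) (ye t) * prof_g E (ye t)) * \det Q
    = \det Q ^+ 2 * (V0 * n) * (prof_f y0 (u - r) (ye t) * prof_f y0 (u + r) (ye t) * prof_g E (ye t)) / (V0 * n).
    by field; rewrite V0n nn.
  rewrite detQ.
  (* At the slice of the datum the central entry is itself a profile value, so both sides become
     exponentials and only exponents are compared. *)
  have -> : V0 * n = prof_g E y0 by rewrite -g0E -yt0; exact: gE D0.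
  have fE (k' : R) : prof_f y0 k' (ye t) = expR ((k' - 1) * (ln (ye t) - ln y0)
       + (ln (1 + ye t ^+ 2) - ln (1 + y0 ^+ 2))).
    by rewrite /prof_f expRD expRB !lnK ?posrE ?sq1_gt0 // mulrA.
  have gEx (z : R) : 0 < z -> prof_g E z = expR (ln (2 * E) + ln z - ln (1 + z ^+ 2)).
    move=> z0; have E20 : 0 < 2 * E by rewrite mulr_gt0.
    by rewrite expRB expRD !lnK ?posrE ?sq1_gt0.
  rewrite prof_VE !fE !gEx // -expRN exprMn -mulrA -mulrA; congr (_ * _).
  rewrite -!expRD -expRM_natl -mulr_natl; congr expR.
  by field.
have energy t : D' t -> q ^+ 2 = 4 * prof_be E (ye t) ^+ 2 + prof_g E (ye t) ^+ 2 + c ^+ 2.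
  move=> _; have -> : q ^+ 2 = E ^+ 2 * (1 + r ^+ 2) by rewrite -datum_u_sq /q; ring.
  by rewrite /c /prof_be /prof_g; field; exact: sq1_neq0.
have vac := diag_metric_vacuum sysx (coframeM hp um up mp) Be2 Vdet energy.
have [_ /(_ (- T0)%:E b hext)] := maxdev.
case=> //; first by rewrite lee_fin oppr_le0 ltW.
  by move=> t t1 t2; exact: hextE.
by move=> [T00'] _; move: T00; rewrite -oppr_lt0 T00' ltxx.
Qed.
End Extension.

Lemma clock_ratio t : D t -> Phi (m t) / Phi 1 = t / t0.
Proof.
have T0E : T0 = 0.
  apply/eqP; rewrite eq_le T0_ge0 andbT leNgt; apply/negP => T00.
  have [Psi PsiP] := clock_inverse k0 Phi0 dPhi.
  exact: extension_absurd PsiP T00.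
have P1 : Phi 1 = c1 * t0.
  move: T0E => /eqP; rewrite subr_eq0 => /eqP <-.
  by rewrite mulrC mulfVK // gt_eqF.
move=> Dt; rewrite clock_advance // -/T0 T0E addr0 P1.
by field; rewrite !gt_eqF.
Qed.

(** All that the estimates use of the dynamics. The values [F = Phi (m t)] and [F0 = Phi 1] are
    released only through two-sided bounds, with [z = y t]. *)
Lemma datum_profile_clock t : 0 < t <= t0 ->
  exists z F F0, [/\ 0 < z <= y0, form (h_ t) Xm Xm = prof_f y0 (u - r) z,
    form (h_ t) Xp Xp = prof_f y0 (u + r) z, t / t0 = F / F0 &
    expR (k * (ln z - ln y0)) <= F <= expR (k * (ln z - ln y0)) * Num.sqrt (1 + z ^+ 2)
    /\ 1 <= F0 <= Num.sqrt (1 + y0 ^+ 2)].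
Proof.
move=> /andP[tp tt0].
have Dt : D t by split; rewrite ?lte_fin //; apply: le_lt_trans t0b; rewrite lee_fin.
exists (y t), (Phi (m t)), (Phi 1); split; rewrite ?fmE ?fpE ?clock_ratio //.
  (* The clock increases with [y], so [y t > y0] would mean [t > t0]. *)
  rewrite yp //= leNgt; apply/negP => y0y.
  have m1 : 1 < m t.
    by rewrite -expR0 ltr_expR mulr_gt0 // subr_gt0 ltr_ln ?posrE ?yp.
  have P1 : 0 < Phi 1.
    have /andP[P1 _] := clock_bounds k0 Phi0 dPhi ltr01.
    exact: lt_le_trans P1.
  have := clock_lt dPhi ler01 m1; rewrite -(ltr_pM2r (_ : 0 < (Phi 1)^-1)) ?invr_gt0 //.
  by rewrite mulfV ?gt_eqF // clock_ratio // ltr_pdivlMr // mul1r ltNge tt0.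
have one : clock_rate y0 k 1 = Num.sqrt (1 + y0 ^+ 2).
  by rewrite -(clock_rateE y00 k0 y00) subrr mulr0 expR0.
split.
  have := clock_bounds k0 Phi0 dPhi (m_gt0 t).
  by rewrite -[X in clock_rate _ _ X]/(m t) /m clock_rateE ?yp.
by have := clock_bounds k0 Phi0 dPhi ltr01; rewrite one mul1r.
Qed.

End Datum.

Section DevelopmentProfile.
Variable R : realType.

Lemma development_profile (h : 'M[R]_3) s A t0 h_ Xm Xp :
  inner_product h -> 0 < s -> tracefree_selfadjoint h A ->
  development_of h s A t0 h_ -> principal_pair h A Xm Xp ->
  let y0 := datum_y h s A in let u := datum_u h s A in let k := u - 2^-1 in
  let r := rpar h s A in
  exists mu : R, [/\ 0 <= mu, hs_norm h A = Num.sqrt 2 * mu, r = 2 * mu / datum_rho h s A &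
  forall t, 0 < t <= t0 ->
  exists z F F0, [/\ 0 < z <= y0, form (h_ t) Xm Xm = prof_f y0 (u - r) z,
    form (h_ t) Xp Xp = prof_f y0 (u + r) z, t / t0 = F / F0 &
    expR (k * (ln z - ln y0)) <= F <= expR (k * (ln z - ln y0)) * Num.sqrt (1 + z ^+ 2)
    /\ 1 <= F0 <= Num.sqrt (1 + y0 ^+ 2)]].
Proof.
move=> hp s0 tf [b [K [md [t00 t0b] sff h0 dh0]]] pp y0 u k r.
have [mu mu0 [Am Ap mp An]] := principal_basis hp tf pp.
have [um upl _ _] := pp.
have rE : r = 2 * mu / datum_rho h s A.
  rewrite /r /rpar An mulrA -/(datum_rho h s A); congr (_ * _ / _).
  by rewrite -expr2 sqr_sqrtr.
exists mu; split=> // t tt.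
have k0 : 0 < k by have := datum_u_ge1 hp s0 An; rewrite /k /u; lra.
have [Phi [Phi0 dPhi]] := continuous_primitive (@clock_rate_continuous R y0 k k0).
rewrite rE; exact: (datum_profile_clock s0 md t00 t0b sff h0 dh0 um upl mp Am Ap An Phi0 dPhi tt).
Qed.
End DevelopmentProfile.

(** * Estimates *)

Section Exponents.
Variables (R : realType) (r : R).
Hypothesis r0 : 0 <= r.
Hypothesis r1 : r <= 1.
Local Notation u := (Num.sqrt (1 + r ^+ 2)).

Let u2 : u ^+ 2 = 1 + r ^+ 2. Proof. by rewrite sqr_sqrtr // ltW // sq1_gt0. Qed.
Lemma sqrt1_ge1 : 1 <= u.
Proof.
rewrite -[leLHS]sqrtr1; apply: ler_wsqrtr.
by rewrite lerDl sqr_ge0.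
Qed.

Lemma sqrt1_sub1_le : u - 1 <= r ^+ 2 / 2.
Proof. by have := u2; have := sqr_ge0 (u - 1); rewrite [(u - 1) ^+ 2]expr2 => *; lra. Qed.

Lemma sqrt1_le : u <= 3 / 2.
Proof.
have r21 : r ^+ 2 <= 1 by rewrite expr_le1.
by have := sqrt1_sub1_le; lra.
Qed.

Let den : 0 < 2 * u - 1. Proof. by have := sqrt1_ge1; lra. Qed.

Let quot_le (x b : R) : 0 <= b -> `|x| <= b -> `|x / (2 * u - 1)| <= b.
Proof.
move=> b0 xb; rewrite normf_div [`|2 * u - 1|]gtr0_norm // ler_pdivrMr //.
by apply: le_trans xb _; rewrite ler_peMr //; have := sqrt1_ge1; lra.
Qed.

Lemma p_minus_norm : `|p_minus r| <= 2 * r.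
Proof.
apply: quot_le; first by rewrite mulr_ge0.
have := sqrt1_ge1; have := sqrt1_sub1_le; have := r0; have := r1.
by move=> *; rewrite ler_norml; apply/andP; split; nra.
Qed.

Lemma p_plus_norm : `|p_plus r| <= 2 * r.
Proof.
apply: quot_le; first by rewrite mulr_ge0.
have := sqrt1_ge1; have := sqrt1_sub1_le; have := r0; have := r1.
by move=> *; rewrite ler_norml; apply/andP; split; nra.
Qed.

(** The difference carries the factor [u - 1], which is of order [r^2]. Second order is required
    because the exponent is later multiplied by a logarithm of size [l / r]. *)
Lemma p_minus_approx : `|p_minus r + r| <= 2 * r ^+ 2.
Proof.
have -> : p_minus r + r = (u - 1) * (1 + 2 * r) / (2 * u - 1).
  by rewrite /p_minus; field; rewrite gt_eqF.
apply: quot_le; first by rewrite mulr_ge0 // sqr_ge0.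
have a := sqrt1_ge1; have b := sqrt1_sub1_le.
rewrite ger0_norm; last by rewrite mulr_ge0 //; move: r0; lra.
have : (u - 1) * (1 + 2 * r) <= r ^+ 2 / 2 * 3.
  by apply: ler_pM => //; move: r0 r1; lra.
by have := sqr_ge0 r; lra.
Qed.

Lemma p_plus_approx : `|p_plus r - r| <= 2 * r ^+ 2.
Proof.
have -> : p_plus r - r = (u - 1) * (1 - 2 * r) / (2 * u - 1).
  by rewrite /p_plus; field; rewrite gt_eqF.
apply: quot_le; first by rewrite mulr_ge0 // sqr_ge0.
have a := sqrt1_ge1; have b := sqrt1_sub1_le.
rewrite normrM ger0_norm; last by lra.
have : (u - 1) * `|1 - 2 * r| <= r ^+ 2 / 2 * 3.
  apply: ler_pM => //; first by lra.
  by rewrite ler_norml; move: r0 r1; lra.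
by have := sqr_ge0 r; lra.
Qed.
End Exponents.

Lemma ln_1D_le (R : realType) (x : R) : 0 <= x -> 0 <= ln (1 + x) <= x.
Proof. by move=> x0; rewrite ln_ge0 ?lerDl //= le_ln1Dx // (lt_le_trans (ltrN10 R)). Qed.

Lemma sqr_homo (R : realType) (x y : R) : 0 <= x -> x <= y -> x ^+ 2 <= y ^+ 2.
Proof. by move=> x0 xy; rewrite !expr2 ler_pM. Qed.

Lemma expR_sub1_le (R : realType) (x : R) : `|expR x - 1| <= `|x| * expR `|x|.
Proof.
case: (lerP 0 x) => x0.
  have l1 : 1 <= expR x by rewrite -[leLHS]expR0 ler_expR.
  rewrite (ger0_norm x0) ger0_norm ?subr_ge0 //.
  have := expR_ge1Dx (- x); rewrite expRN => e.
  have ex := expR_gt0 x.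
  have : (1 + - x) * expR x <= 1 by rewrite -ler_pdivlMr // mul1r.
  by lra.
have e := expR_ge1Dx x.
have l1 : expR x <= 1 by rewrite -[leRHS]expR0 ler_expR; exact: ltW.
have l2 : 1 <= expR (- x) by rewrite -[leLHS]expR0 ler_expR oppr_ge0; exact: ltW.
rewrite (ltr0_norm x0) ler0_norm ?subr_le0 //.
apply: le_trans (_ : - x <= _); first by lra.
by rewrite ler_peMr // oppr_ge0 ltW.
Qed.

Section LengthEstimate.
Variables (R : realType) (y0 y00 u r sg p Bh C1 Y z F F0 tau f : R).
Hypothesis r0 : 0 <= r.
Hypothesis y0p : 0 < y0.
Hypothesis y0le : y0 <= y00.
Hypothesis C10 : 0 <= C1.
Hypothesis Yle : y00 <= Y.
Hypothesis u32 : u <= 3 / 2.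
Hypothesis BhE : ln Bh = - (2^-1 * ln (1 + y00 ^+ 2)).
Hypothesis Bh0 : 0 < Bh.
Hypothesis close : y00 ^+ 2 - y0 ^+ 2 <= C1 * r.
Hypothesis zp : 0 < z.
Hypothesis zy : z <= y0.
Hypothesis fE : f = prof_f y0 (u + sg * r) z.
Hypothesis tauE : tau = F / F0.
Hypothesis tau1 : tau <= 1.
Let k := u - 2^-1.
Let Lam := ln z - ln y0.
Hypothesis Fl : expR (k * Lam) <= F.
Hypothesis Fu : F <= expR (k * Lam) * Num.sqrt (1 + z ^+ 2).
Hypothesis F0l : 1 <= F0.
Hypothesis F0u : F0 <= Num.sqrt (1 + y0 ^+ 2).
Hypothesis pk : p * k = (u + sg * r - 1) / 2.
Hypothesis pn : `|p| <= 2 * r.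

Let k1 : k <= 1. Proof. by rewrite /k; move: u32; lra. Qed.
Let Fp : 0 < F. Proof. exact: lt_le_trans (expR_gt0 _) Fl. Qed.
Let F0p : 0 < F0. Proof. exact: lt_le_trans ltr01 F0l. Qed.
Let Lam0 : Lam <= 0. Proof. by rewrite subr_le0 ler_ln ?posrE. Qed.
Let taup : 0 < tau. Proof. by rewrite tauE divr_gt0. Qed.
Let s1 (x : R) := sq1_gt0 x.
Let d0 : R := 2^-1 * ln (1 + y0 ^+ 2).
Let dz : R := 2^-1 * ln (1 + z ^+ 2).

Let lnsqrt (x : R) : ln (Num.sqrt (1 + x ^+ 2)) = 2^-1 * ln (1 + x ^+ 2).
Proof. by rewrite sqrt_expR ?s1 // expRK. Qed.

Let zsq : z ^+ 2 <= y0 ^+ 2.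
Proof. exact: sqr_homo (ltW zp) zy. Qed.

Let dzd0 : dz <= d0.
Proof. by rewrite ler_pM2l // ler_ln ?posrE ?s1 // lerD2l. Qed.

Let lnF : k * Lam <= ln F <= k * Lam + dz.
Proof.
rewrite -[X in X <= _]expRK ler_ln ?posrE ?expR_gt0 // Fl /=.
rewrite -[k * Lam]expRK /dz -lnsqrt -lnM ?posrE ?expR_gt0 ?sqrtr_gt0 ?s1 //.
by rewrite ler_ln ?posrE ?mulr_gt0 ?expR_gt0 ?sqrtr_gt0 ?s1.
Qed.

Let lnF0 : 0 <= ln F0 <= d0.
Proof.
by rewrite ln_ge0 //= /d0 -lnsqrt ler_ln ?posrE ?sqrtr_gt0 ?s1.
Qed.

Let lnf : ln (Num.sqrt f) = (u + sg * r - 1) / 2 * Lam + dz - d0.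
Proof.
have f0 : 0 < f by rewrite fE /prof_f divr_gt0 ?mulr_gt0 ?expR_gt0 ?s1.
rewrite sqrt_expR // expRK fE /prof_f lnM ?posrE ?invr_gt0 ?mulr_gt0 ?expR_gt0 ?s1 //.
by rewrite lnV ?posrE ?s1 // lnM ?posrE ?expR_gt0 ?s1 // expRK /dz /d0 /Lam; field.
Qed.

Let y0Y : y0 ^+ 2 <= Y ^+ 2.
Proof. exact: sqr_homo (ltW y0p) (le_trans y0le Yle). Qed.

(** From [Lam <= 0] and [k <= 1], [expR Lam <= expR (k * Lam) <= F = tau * F0], so [z] itself is of
    order [tau]. One factor [tau <= 1] is given away, and this bound is what allows the exponent
    [eta = 1]. *)
Let z_tau : z ^+ 2 <= Y ^+ 2 * (1 + Y ^+ 2) * tau.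
Proof.
have zE : z = y0 * expR Lam by rewrite /Lam expRB !lnK ?posrE // mulrCA mulfV ?mulr1 ?gt_eqF.
have : expR Lam <= tau * F0.
  rewrite tauE mulfVK ?gt_eqF //; apply: le_trans Fl; rewrite ler_expR.
  by move: Lam0 k1; nra.
move=> e; have e2 : expR Lam ^+ 2 <= tau ^+ 2 * (1 + Y ^+ 2).
  apply: le_trans (_ : (tau * F0) ^+ 2 <= _).
    by apply: sqr_homo => //; exact: expR_ge0.
  rewrite exprMn ler_pM2l ?exprn_gt0 //.
  apply: le_trans (_ : Num.sqrt (1 + y0 ^+ 2) ^+ 2 <= _).
    exact: sqr_homo (ltW F0p) F0u.
  by rewrite (sqr_sqrtr (ltW (s1 y0))) lerD2l.
rewrite zE exprMn -mulrA; apply: ler_pM => //; rewrite ?sqr_ge0 //.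
apply: le_trans e2 _; rewrite mulrC ler_pM2l ?s1 //.
by rewrite expr2 ler_piMr // ltW.
Qed.

(** By [pk] the unbounded terms in [Lam] cancel. Three errors remain: [dz] of order [z^2], hence
    [tau]; the gap between the values at [y00] and [y0], of order [r] by [close]; and [p] times a
    bounded offset, of order [r] by [pn]. *)
Lemma length_estimate :
  `|ln (Num.sqrt f / Bh) - p * ln tau| <= (Y ^+ 2 * (1 + Y ^+ 2) + Y ^+ 2 + C1) * (r + tau).
Proof.
have f0 : 0 < Num.sqrt f by rewrite sqrtr_gt0 fE /prof_f divr_gt0 ?mulr_gt0 ?expR_gt0 ?s1.
rewrite ln_div ?posrE // lnf BhE.
have lt : ln tau = ln F - ln F0 by rewrite tauE ln_div ?posrE.
(* [de] is the offset between the clock and its leading power; the bounds on [F] and [F0] confine it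
   to [[- d0, d0]]. *)
have [de [deE de0 de1]] : exists de, [/\ ln tau = k * Lam + de, - d0 <= de & de <= d0].
  exists (ln tau - k * Lam); move: lnF lnF0 dzd0 => /andP[? ?] /andP[? ?] ?; split; lra.
rewrite deE.
have pkL : p * (k * Lam) = (u + sg * r - 1) / 2 * Lam by rewrite mulrA pk.
have -> : (u + sg * r - 1) / 2 * Lam + dz - d0 - - (2^-1 * ln (1 + y00 ^+ 2)) - p * (k * Lam + de)
  = dz + (2^-1 * ln (1 + y00 ^+ 2) - d0) - p * de by rewrite -pkL; ring.
have /andP[dza dzb] := ln_1D_le (sqr_ge0 z).
have /andP[d0a d0b] := ln_1D_le (sqr_ge0 y0).
have gap0 : d0 <= 2^-1 * ln (1 + y00 ^+ 2).
  rewrite ler_pM2l // ler_ln ?posrE ?s1 // lerD2l.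
  exact: sqr_homo (ltW y0p) y0le.
have gap1 : ln (1 + y00 ^+ 2) - ln (1 + y0 ^+ 2) <= y00 ^+ 2 - y0 ^+ 2.
  rewrite -ln_div ?posrE ?s1 //.
  have -> : (1 + y00 ^+ 2) / (1 + y0 ^+ 2) = 1 + (y00 ^+ 2 - y0 ^+ 2) / (1 + y0 ^+ 2).
    by field; exact: sq1_neq0.
  have dd : 0 <= y00 ^+ 2 - y0 ^+ 2.
    by rewrite subr_ge0; exact: sqr_homo (ltW y0p) y0le.
  have /andP[_ H] := ln_1D_le (divr_ge0 dd (ltW (s1 y0))).
  by apply: le_trans H _; rewrite ler_pdivrMr ?s1 // ler_peMr // lerDl sqr_ge0.
have pde : `|p * de| <= r * Y ^+ 2.
  rewrite normrM; have : `|de| <= d0 by rewrite ler_norml de0 de1.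
  move=> ded; apply: le_trans (ler_pM _ _ pn ded) _ => //.
  rewrite /d0; have : 2 * r * (2^-1 * ln (1 + y0 ^+ 2)) = r * ln (1 + y0 ^+ 2) by field.
  by move=> ->; rewrite ler_wpM2l // (le_trans d0b).
have tr := z_tau.
have Y2 := sqr_ge0 Y; have Y4 : 0 <= Y ^+ 2 * (1 + Y ^+ 2) by rewrite mulr_ge0 // ltW ?s1.
have C1r : 0 <= C1 * r.
  by apply: le_trans close; rewrite subr_ge0; exact: sqr_homo (ltW y0p) y0le.
move: pde; rewrite ler_norml => /andP[pa pb].
have t1 : 0 <= Y ^+ 2 * (1 + Y ^+ 2) * r by rewrite mulr_ge0.
have tau0 := ltW taup.
have t2 : 0 <= Y ^+ 2 * tau by rewrite mulr_ge0.
have t3 : 0 <= Y ^+ 2 * (1 + Y ^+ 2) * tau by rewrite mulr_ge0.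
have t4 : 0 <= C1 * tau by rewrite mulr_ge0.
have cl := close; have zt := z_tau.
rewrite /d0 in gap0; rewrite ler_norml /dz /d0.
have -> : (Y ^+ 2 * (1 + Y ^+ 2) + Y ^+ 2 + C1) * (r + tau) = Y ^+ 2 * (1 + Y ^+ 2) * r + r * Y ^+ 2
  + C1 * r + Y ^+ 2 * (1 + Y ^+ 2) * tau + Y ^+ 2 * tau + C1 * tau by ring.
move: (p * de) (ln (1 + z ^+ 2)) (ln (1 + y0 ^+ 2)) (ln (1 + y00 ^+ 2)) (r * Y ^+ 2) (C1 * r)
  (Y ^+ 2 * (1 + Y ^+ 2) * tau) (Y ^+ 2 * (1 + Y ^+ 2) * r) (Y ^+ 2 * tau) (C1 * tau)
  (z ^+ 2) (y0 ^+ 2) (y00 ^+ 2) pa pb dza dzb gap0 gap1 cl zt C1r t1 t2 t3 t4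
  => a1 a2 a3 a4 a5 a6 a7 a8 a9 a10 a11 a12 a13 *.
by apply/andP; split; lra.
Qed.
End LengthEstimate.

(** * Constants uniform over a compact parameter set *)

Section UniformConstants.
Variable R : realType.

Lemma compact_pos_bounds (T : topologicalType) (f : T -> R) (K : set T) :
  compact K -> continuous f -> (forall q, K q -> 0 < f q) ->
  exists a b, [/\ 0 < a, 0 < b & forall q, K q -> a <= f q <= b].
Proof.
move=> cK cf fp; have [->|K0] := eqVneq K set0; first by exists 1, 1; split.
have {}K0 : K !=set0 by apply/set0P.
have fK : {within K, continuous f} by apply: continuous_subspaceT.
have [c1 c1K m1] := compact_EVT_min K0 cK fK; have [c2 c2K m2] := compact_EVT_max K0 cK fK.
exists (f c1), (f c2); split; [exact/fp/set_mem|exact/fp/set_mem|].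
by move=> q Kq; rewrite m1 ?m2 // inE.
Qed.

(** Since [nH h = h22 / sqrt (det h)], it suffices to bound the continuous positive functions [h22],
    [det h] and [s]. This is the only use of compactness. *)
Lemma parameter_bounds (KK : set ('M[R]_3 * R)) : compact KK -> KK `<=` @parameter_space R ->
  exists n1 n2 s1 s2, [/\ 0 < n1, 0 < n2, 0 < s1, 0 < s2 &
    forall h s, KK (h, s) -> (n1 <= nH h <= n2) /\ (s1 <= s <= s2)].
Proof.
move=> cK KP.
have ce i j : continuous (fun q : 'M[R]_3 * R => q.1 i j).
  move=> q; apply: (@continuous_comp _ _ _ fst (fun M : 'M[R]_3 => M i j)); first exact: cvg_fst.
  exact: coord_continuous.
have cd : continuous (fun q : 'M[R]_3 * R => \det q.1).
  under eq_fun do rewrite det_mx33.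
  move=> q; apply: cvgD; [apply: cvgB|]; apply: cvgM; try exact: ce;
    apply: cvgB; apply: cvgM; exact: ce.
have cs : continuous (fun q : 'M[R]_3 * R => q.2) by move=> q; exact: cvg_snd.
have [g1 [g2 [g10 g20 gb]]] := compact_pos_bounds cK (ce i2 i2)
   (fun q Kq => inner_h22_gt0 (KP q Kq).1).
have [d1 [d2 [d10 d20 db]]] := compact_pos_bounds cK cd (fun q Kq => inner_det_gt0 (KP q Kq).1).
have [s1 [s2 [s10 s20 sb]]] := compact_pos_bounds cK cs (fun q Kq => (KP q Kq).2).
have q1 : 0 < Num.sqrt d1 by rewrite sqrtr_gt0.
have q2 : 0 < Num.sqrt d2 by rewrite sqrtr_gt0.
exists (g1 / Num.sqrt d2), (g2 / Num.sqrt d1), s1, s2; split; rewrite ?divr_gt0 //.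
move=> h s Khs; split; last exact: sb Khs.
have hp := (KP _ Khs).1; have /= /andP[a1 a2] := gb _ Khs; have /= /andP[b1 b2] := db _ Khs.
have qh : 0 < Num.sqrt (\det h) by rewrite sqrtr_gt0 inner_det_gt0.
have i2_ : (Num.sqrt d2)^-1 <= (Num.sqrt (\det h))^-1.
  by rewrite lef_pV2 ?posrE //; apply: ler_wsqrtr.
have i1_ : (Num.sqrt (\det h))^-1 <= (Num.sqrt d1)^-1.
  by rewrite lef_pV2 ?posrE //; apply: ler_wsqrtr.
rewrite (nHE hp); apply/andP; split; apply: ler_pM => //; rewrite ?invr_ge0; apply: ltW => //.
exact: inner_h22_gt0.
Qed.

Section DatumCloseness.
Variables (h : 'M[R]_3) (s : R) (A : 'M[R]_3) (mu n1 n2 s1 s2 : R).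
Hypothesis hp : inner_product h.
Hypothesis n10 : 0 < n1.
Hypothesis s10 : 0 < s1.
Hypothesis n1n : n1 <= nH h.
Hypothesis nn2 : nH h <= n2.
Hypothesis s1s : s1 <= s.
Hypothesis ss2 : s <= s2.
Hypothesis mu0 : 0 <= mu.
Hypothesis mu1 : mu <= 1.
Hypothesis mun : mu <= n1 / 2.
Hypothesis An : hs_norm h A = Num.sqrt 2 * mu.
Local Notation n := (nH h).
Local Notation al := (alpha h s A).
Local Notation rho := (datum_rho h s A).
Local Notation y0 := (datum_y h s A).
Let y00 := s / n.
Let r := 2 * mu / rho.
Let n0 : 0 < n := nH_gt0 hp.
Let s0 : 0 < s. Proof. exact: lt_le_trans s1s. Qed.
Let rho0 := rho_gt0 s A hp.
Let rho2 := rho_sq h s A.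
Let y0p := datum_y_gt0 s A hp.
Let nn : n != 0. Proof. by rewrite gt_eqF. Qed.
Let sn : s != 0. Proof. by rewrite gt_eqF. Qed.
Let rhon : rho != 0. Proof. by rewrite gt_eqF. Qed.
Let y00p : 0 < y00. Proof. by rewrite divr_gt0. Qed.

Let hs2 : hs_norm h A ^+ 2 = 2 * mu ^+ 2.
Proof. by rewrite An exprMn sqr_sqrtr. Qed.

Lemma datum_r_ge0 : 0 <= r.
Proof. by rewrite divr_ge0 ?mulr_ge0 // ltW. Qed.

(** Since [rho >= n], [mu <= n1 / 2] suffices; this is one of the two sources of the smallness
    threshold. *)
Lemma datum_r_le1 : r <= 1.
Proof.
rewrite ler_pdivrMr // mul1r.
have : n <= rho.
  rewrite -(@ler_pXn2r _ 2) ?nnegrE ?(ltW n0) ?(ltW rho0) // rho2.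
  by rewrite lerDr mulr_ge0 // sqr_ge0.
by move: mun n1n; lra.
Qed.

Let quad : y0 ^+ 2 + 2 * (2 * al / n) * y0 = 1.
Proof.
have -> : y0 ^+ 2 + 2 * (2 * al / n) * y0 = (rho ^+ 2 - 4 * al ^+ 2) / n ^+ 2.
  by rewrite /datum_y; field.
by rewrite rho2; field.
Qed.

(** [y00 = s / n] is [y0] for [A = 0]. Both are roots of [y^2 + x y = 1] with coefficients [x] that
    differ by [4 mu^2 / (s n)]; cross-multiplying the two equations eliminates [x]. *)
Let gap : (y00 - y0) * (1 + y0 * y00) = 4 * mu ^+ 2 / (s * n) * (y0 * y00).
Proof.
have alE : 2 * (2 * al / n) = (n ^+ 2 - s ^+ 2) / (s * n) + 4 * mu ^+ 2 / (s * n).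
  by rewrite /alpha hs2; field; rewrite nn sn.
have q0 : y00 ^+ 2 + (n ^+ 2 - s ^+ 2) / (s * n) * y00 = 1 by rewrite /y00; field; rewrite nn sn.
have := quad; rewrite alE.
move: ((n ^+ 2 - s ^+ 2) / (s * n)) (4 * mu ^+ 2 / (s * n)) q0 => x d q0 q1.
have e1 : d * y0 = 1 - y0 ^+ 2 - x * y0 by rewrite -q1; ring.
have e2 : x * y00 = 1 - y00 ^+ 2 by rewrite -q0; ring.
have -> : d * (y0 * y00) = d * y0 * y00 by ring.
rewrite e1 !mulrBl; have -> : x * y0 * y00 = y0 * (x * y00) by ring.
by rewrite e2; ring.
Qed.

Let dmu : 0 <= 4 * mu ^+ 2 / (s * n).
Proof. by rewrite divr_ge0 ?mulr_ge0 ?sqr_ge0 // ltW. Qed.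

Lemma datum_y_le : y0 <= y00.
Proof.
have p1 : 0 < 1 + y0 * y00 by rewrite addr_gt0 // mulr_gt0.
by rewrite -subr_ge0 -(pmulr_lge0 _ p1) gap mulr_ge0 // ltW // mulr_gt0.
Qed.

Let gap_le : y00 - y0 <= 4 * mu ^+ 2 / (s * n).
Proof.
have yy : 0 < y0 * y00 by rewrite mulr_gt0.
have p1 : 0 < 1 + y0 * y00 by rewrite addr_gt0.
rewrite -(ler_pM2r p1) gap ler_wpM2l //; lra.
Qed.

(** [u >= 1] gives [rho <= s + 2 alpha = (n^2 + s^2 + 4 mu^2) / (2 s)], and [mu <= 1] produces the
    4. In [close_const], [4 mu^2 = rho^2 r^2] rewrites the gap in terms of [r], with one factor
    [r <= 1] dropped. *)
Definition rho_bound := (n2 ^+ 2 + s2 ^+ 2 + 4) / (2 * s1).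
Definition close_const := 2 * (s2 / n1) * rho_bound ^+ 2 / (s1 * n1).

Let rho_le : rho <= rho_bound.
Proof.
have u1 := datum_u_ge1 hp s0 An.
have : rho <= s + 2 * al.
  by move: u1; rewrite /datum_u ler_pdivlMr // mul1r.
move=> /le_trans; apply.
have -> : s + 2 * al = (n ^+ 2 + s ^+ 2 + 4 * mu ^+ 2) / (2 * s).
  by rewrite /alpha hs2; field.
have s20 : 0 < 2 * s by rewrite mulr_gt0.
have m2 : mu ^+ 2 <= 1 by rewrite expr_le1.
apply: ler_pM.
- by have := sqr_ge0 n; have := sqr_ge0 s; have := sqr_ge0 mu; lra.
- by rewrite invr_ge0 ltW.
- by have := sqr_homo (ltW n0) nn2; have := sqr_homo (ltW s0) ss2; lra.
- by rewrite lef_pV2 ?posrE ?mulr_gt0 // ler_pM2l.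
Qed.

Lemma close_const_ge0 : 0 <= close_const.
Proof.
have s20 : 0 <= s2 := le_trans (ltW s0) ss2.
have i1_ : 0 <= (s1 * n1)^-1 by rewrite invr_ge0 mulr_ge0 // ltW.
have i2_ : 0 <= n1^-1 by rewrite invr_ge0 ltW.
exact: mulr_ge0 (mulr_ge0 (mulr_ge0 (ler0n R 2) (mulr_ge0 s20 i2_)) (sqr_ge0 _)) i1_.
Qed.

Lemma datum_y00_le : y00 <= s2 / n1.
Proof. by apply: ler_pM => //; rewrite ?invr_ge0 ?(ltW s0) ?(ltW n0) // lef_pV2 ?posrE. Qed.

Lemma datum_close : y00 ^+ 2 - y0 ^+ 2 <= close_const * r.
Proof.
have r0 := datum_r_ge0; have r1 := datum_r_le1.
have -> : y00 ^+ 2 - y0 ^+ 2 = (y00 - y0) * (y00 + y0) by ring.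
have yl := datum_y_le.
apply: le_trans (_ : 4 * mu ^+ 2 / (s * n) * (2 * y00) <= _).
  by apply: ler_pM; [rewrite subr_ge0|rewrite addr_ge0 // ltW|exact: gap_le|lra].
have -> : 4 * mu ^+ 2 / (s * n) * (2 * y00) = 2 * y00 * rho ^+ 2 / (s * n) * r ^+ 2.
  by rewrite /r; field; rewrite nn sn rhon.
have i1_ : 0 <= (s * n)^-1 by rewrite invr_ge0 ltW // mulr_gt0.
have yy : 0 <= 2 * y00 by rewrite mulr_ge0 // ltW.
have yy2 : 2 * y00 <= 2 * (s2 / n1) by rewrite ler_pM2l // datum_y00_le.
have rr := sqr_ge0 rho; have rl := sqr_homo (ltW rho0) rho_le.
have i2_ : (s * n)^-1 <= (s1 * n1)^-1.
  by rewrite lef_pV2 ?posrE ?mulr_gt0 // ler_pM // ltW.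
have r2 : r ^+ 2 <= r by rewrite expr2 ler_piMr.
have a1 := ler_pM yy rr yy2 rl.
have a2 := ler_pM (mulr_ge0 yy rr) i1_ a1 i2_.
exact: ler_pM (mulr_ge0 (mulr_ge0 yy rr) i1_) (sqr_ge0 r) a2 r2.
Qed.

Lemma BH_gt0 : 0 < BH h s.
Proof. by apply: divr_gt0 => //; rewrite sqrtr_gt0 addr_gt0 ?exprn_gt0. Qed.

Lemma ln_BH : ln (BH h s) = - (2^-1 * ln (1 + y00 ^+ 2)).
Proof.
have d0 : 0 < n ^+ 2 + s ^+ 2 by rewrite addr_gt0 ?exprn_gt0.
have q0 : 0 < Num.sqrt (n ^+ 2 + s ^+ 2) by rewrite sqrtr_gt0.
rewrite /BH ln_div ?posrE // sqrt_expR // expRK.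
have -> : 1 + y00 ^+ 2 = (n ^+ 2 + s ^+ 2) / n ^+ 2 by rewrite /y00; field.
by rewrite ln_div ?posrE ?exprn_gt0 // lnXn // -mulr_natl; field.
Qed.
End DatumCloseness.

Definition estimate_const (n1 n2 s1 s2 : R) :=
  (s2 / n1) ^+ 2 * (1 + (s2 / n1) ^+ 2) + (s2 / n1) ^+ 2 + close_const n1 n2 s1 s2.

Lemma uniform_estimate (KK : set ('M[R]_3 * R)) n1 n2 s1 s2 :
  KK `<=` @parameter_space R -> 0 < n1 -> 0 < s1 ->
  (forall h s, KK (h, s) -> (n1 <= nH h <= n2) /\ (s1 <= s <= s2)) ->
  forall h s A tref h_ Xm Xp, admissible KK (Num.min 1 (n1 / 2)) h s A tref h_ Xm Xp ->
  let r := rpar h s A in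
  [/\ 0 <= r <= 1, 0 < BH h s & forall t, 0 < t <= tref ->
   [/\ 0 < len h_ Xm t, 0 < len h_ Xp t,
     `|ln (len h_ Xm t / BH h s) - p_minus r * ln (t / tref)|
       <= estimate_const n1 n2 s1 s2 * (r + t / tref) &
     `|ln (len h_ Xp t / BH h s) - p_plus r * ln (t / tref)|
       <= estimate_const n1 n2 s1 s2 * (r + t / tref)]].
Proof.
move=> KP n10 s10 bd h s A tref h_ Xm Xp [Khs tf An dv pp] r.
have [hp /= s0] := KP _ Khs; have [/andP[n1n nn2] /andP[s1s ss2]] := bd _ _ Khs.
have [mu [mu0 muE rE prof]] := development_profile hp s0 tf dv pp.
have mule : mu <= Num.min 1 (n1 / 2).
  apply: le_trans An; rewrite muE ler_peMl // -[leLHS]sqrtr1; apply: ler_wsqrtr.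
  by rewrite ler1n.
move: mule; rewrite le_min => /andP[mu1 mun].
have r0 : 0 <= r by rewrite /r rE; exact: datum_r_ge0.
have r1 : r <= 1 by rewrite /r rE; have := datum_r_le1 s A hp n1n mun.
have B0 := BH_gt0 hp s10 s1s.
split=> //; first by rewrite r0.
move=> t tt; have [z [F [F0 [/andP[zp zy] fmE fpE tE [/andP[Fl Fu] /andP[F0l F0u]]]]]] := prof t tt.
have u1 := datum_u_ge1 hp s0 muE.
have uE : datum_u h s A = Num.sqrt (1 + r ^+ 2).
  rewrite /r rE -(datum_u_sq hp s0 muE) sqrtr_sqr ger0_norm //.
  exact: le_trans ler01 u1.
have y0p := datum_y_gt0 s A hp.
have fpos k : 0 < prof_f (datum_y h s A) k z.
  by rewrite /prof_f divr_gt0 ?mulr_gt0 ?expR_gt0 ?sq1_gt0.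
have tau1 : t / tref <= 1.
  by move: tt => /andP[t0 ttr]; rewrite ler_pdivrMr ?mul1r // (lt_le_trans t0).
have den : 2 * Num.sqrt (1 + r ^+ 2) - 1 != 0.
  by rewrite gt_eqF //; have := sqrt1_ge1 r; lra.
have u32 : datum_u h s A <= 3 / 2 by rewrite uE; exact: sqrt1_le.
have est sg p f : f = prof_f (datum_y h s A) (datum_u h s A + sg * r) z ->
  p * (datum_u h s A - 2^-1) = (datum_u h s A + sg * r - 1) / 2 -> `|p| <= 2 * r ->
  `|ln (Num.sqrt f / BH h s) - p * ln (t / tref)| <= estimate_const n1 n2 s1 s2 * (r + t / tref).
  move=> fE pk pn.
  have cl := datum_close hp n10 s10 n1n nn2 s1s ss2 mu0 mu1 mun muE.
  rewrite -rE in cl.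
  exact: (length_estimate r0 y0p (datum_y_le hp s10 s1s mu0 muE)
    (close_const_ge0 n2 n10 s10 s1s ss2) (datum_y00_le hp n10 s10 n1n s1s ss2)
    u32 (ln_BH hp s10 s1s) B0 cl zp zy fE tE tau1 Fl Fu F0l F0u pk pn).
split.
- by rewrite /len sqrtr_gt0 fmE.
- by rewrite /len sqrtr_gt0 fpE.
- apply: (est (-1)); [by rewrite fmE mulN1r|rewrite uE /p_minus; by field|exact: p_minus_norm].
- apply: (est 1); [by rewrite fpE mul1r|rewrite uE /p_plus; by field|exact: p_plus_norm].
Qed.
End UniformConstants.

Lemma estimate_const_gt0 (R : realType) (n1 n2 s1 s2 s : R) : 0 < n1 -> 0 < s1 -> s1 <= s -> s <= s2 ->
  0 < estimate_const n1 n2 s1 s2.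
Proof.
move=> n10 s10 s1s ss2; have c0 := close_const_ge0 n2 n10 s10 s1s ss2.
have Y0 : 0 < (s2 / n1) ^+ 2.
  by rewrite exprn_gt0 // divr_gt0 // (lt_le_trans s10) // (le_trans s1s).
rewrite /estimate_const addrAC; apply: addr_gt0 => //; apply: ltr_pwDl => //.
by rewrite mulr_gt0 ?sq1_gt0.
Qed.

(* The witness is the cross product of the covectors [h X] and [h z]. *)
Lemma horizontal_complement (R : realType) (h : 'M[R]_3) (X : 'cV[R]_3) :
  inner_product h -> unit_horizontal h X ->
  exists2 Z, unit_horizontal h Z & form h X Z = 0.
Proof.
move=> hp [/horizontalP X0 X1]; have hs := hp.1; have g0 := inner_h22_gt0 hp.
pose P i := \sum_j h i j * X j 0.
pose w : 'cV[R]_3 := \col_i nth 0 [:: P i1 * h i2 i2 - P i2 * h i1 i2;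
  P i2 * h i0 i2 - P i0 * h i2 i2; P i0 * h i1 i2 - P i1 * h i0 i2] i.
have wX : form h w X = 0.
  rewrite formE (_ : \sum_i _ = \sum_i w i 0 * P i).
    by rewrite sum3 !mxE /=; ring.
  by apply: eq_bigr => i _; rewrite mulr_sumr; apply: eq_bigr => j _; rewrite mulrA.
have we : form h w (@e2 R) = 0 by rewrite form_e2 sum3 !mxE /=; ring.
(* If the cross product vanished, [h X] would be a multiple of [h e_2], and then [h(X, X)] a
   multiple of [h(X, e_2) = 0]. *)
have w0 : w != 0.
  apply/eqP => /matrixP w0.
  have := w0 i0 0; have := w0 i1 0; rewrite !mxE /= => /eqP; rewrite subr_eq0 => /eqP e1 /eqP.
  rewrite subr_eq0 => /eqP e0.
  have gn : h i2 i2 != 0 by rewrite gt_eqF.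
  have PE i : P i = P i2 / h i2 i2 * h i i2.
    by apply: (mulIf gn); elim/ord3P: i; rewrite -?e1 ?e0; field.
  have XX : form h X X = P i2 / h i2 i2 * form h X (@e2 R).
    rewrite formE form_e2 mulr_sumr; apply: eq_bigr => i _.
    transitivity (X i 0 * P i); last by rewrite PE; ring.
    by rewrite mulr_sumr; apply: eq_bigr => j _; rewrite mulrA.
  by move: XX; rewrite X1 X0 mulr0 => /eqP; rewrite oner_eq0.
have N0 := hp.2 _ w0.
have formZ (a : R) (x y : 'cV[R]_3) : form h (a *: x) y = a * form h x y.
  by rewrite !formE mulr_sumr; apply: eq_bigr => i _; rewrite mulr_sumr; apply: eq_bigr => j _; rewrite !mxE; ring.
exists ((Num.sqrt (form h w w))^-1 *: w).
  split; first by apply/horizontalP; rewrite formZ we mulr0.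
  rewrite formZ form_sym // formZ -{3}[form h w w](sqr_sqrtr (ltW N0)).
  by field; rewrite gt_eqF ?sqrtr_gt0.
by rewrite form_sym // formZ wX mulr0.
Qed.

(** * The limit at the horizon and the rescaled time window *)

Lemma estimate_exp (R : realType) (x l D M : R) : 0 < x -> `|ln x - l| <= D -> D <= M ->
  `|x - expR l| <= expR l * expR M * D.
Proof.
move=> x0 xl DM; have -> : x - expR l = expR l * (expR (ln x - l) - 1).
  by rewrite mulrBr mulr1 -expRD addrCA subrr addr0 lnK.
rewrite normrM ger0_norm ?expR_ge0 // -mulrA ler_pM2l ?expR_gt0 //.
apply: le_trans (expR_sub1_le _) _; rewrite mulrC.
by apply: ler_pM => //; rewrite ?expR_ge0 // ler_expR (le_trans xl).
Qed.

(** The uniform estimate is applied to the one-point parameter set, after completing [X] to an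
    orthonormal pair. For [A = 0] both [r] and the exponent vanish, so [ln (len / BH)] is bounded by
    a multiple of [t / tref]. *)
Lemma horizon_limit (R : realType) (h : 'M[R]_3) (s tref : R) (h_ : R -> 'M[R]_3) (X : 'cV[R]_3) :
  parameter_space (h, s) -> development_of h s 0 tref h_ -> unit_horizontal h X ->
  len h_ X t @[t --> 0^'+] --> BH h s.
Proof.
move=> /[dup] ps [hp /= s0] dv hX.
have [Z hZ XZ] := horizontal_complement hp hX.
have n0 := nH_gt0 hp.
have hs0 : hs_norm h 0 = 0 by rewrite /hs_norm mulmx0 mxtrace0 sqrtr0.
have tf : tracefree_selfadjoint h 0.
  have f0 (v : 'cV[R]_3) : form h 0 v = 0 by rewrite /form trmx0 !mul0mx mxE.
  split=> [z _|v _ z _||v v' _ _]; rewrite ?mul0mx ?f0 ?mxtrace0 //.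
  by rewrite form_sym ?f0 //; exact: hp.1.
have adm : admissible [set (h, s)] (Num.min 1 (nH h / 2)) h s 0 tref h_ X Z.
  split=> //; first by rewrite hs0 le_min ler01 divr_ge0 // ltW.
  by split=> //; rewrite eqxx.
have sub : [set (h, s)] `<=` @parameter_space R by move=> _ ->.
have bd h' s' : [set (h, s)] (h', s') -> (nH h <= nH h' <= nH h) /\ (s <= s' <= s).
  by move=> [-> ->]; rewrite !lexx.
have [_ B0 est] := uniform_estimate sub n0 s0 bd adm.
have C0 := estimate_const_gt0 (nH h) n0 s0 (lexx s) (lexx s).
move: est C0; set C := estimate_const _ _ _ _.
have -> : rpar h s 0 = 0 by rewrite /rpar hs0 mulr0 mul0r.
have p0 : p_minus (0 : R) = 0.
  by apply/eqP; rewrite -normr_eq0 eq_le normr_ge0 andbT; have := @p_minus_norm R 0 (lexx 0) ler01; rewrite mulr0.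
rewrite p0 => est C0.
have [_ [_ [_ [tr0 _] _ _ _]]] := dv.
pose m : R := C / tref.
have m0 : 0 < m by rewrite divr_gt0.
have Bm : 0 < BH h s * expR 1 * m := mulr_gt0 (mulr_gt0 B0 (expR_gt0 1)) m0.
apply/cvgrPdist_lt => e e0; near=> t.
have tp : 0 < t by near: t; exact: nbhs_right_gt.
have tt : t <= tref by near: t; apply: nbhs_right_le.
have t1 : t <= m^-1 by near: t; apply: nbhs_right_le; rewrite invr_gt0.
have t2 : t < e / (BH h s * expR 1 * m).
  by near: t; apply: nbhs_right_lt; rewrite divr_gt0.
have [lp _ + _] := est t (introT andP (conj tp tt)).
rewrite mul0r subr0 add0r => le.
have D1 : C * (t / tref) = m * t by rewrite /m; ring.
rewrite D1 in le.
have mt1 : m * t <= 1 by rewrite mulrC -ler_pdivlMr // mul1r.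
have q0 : 0 < len h_ X t / BH h s by rewrite divr_gt0.
have := @estimate_exp R (len h_ X t / BH h s) 0 (m * t) 1 q0.
rewrite subr0 expR0 mul1r => /(_ le mt1) E.
rewrite distrC (_ : len h_ X t - BH h s = BH h s * (len h_ X t / BH h s - 1)); last first.
  by field; rewrite gt_eqF.
rewrite normrM (gtr0_norm B0).
apply: le_lt_trans (_ : BH h s * (expR 1 * (m * t)) < e); first by rewrite ler_pM2l.
by move: t2; rewrite ltr_pdivlMr // (_ : t * _ = BH h s * (expR 1 * (m * t))) //; ring.
Unshelve. all: by end_near. Qed.

(** Here [ln tau = - l / r], so replacing [p] by [sg * r] costs at most [2 r^2 * l / r = 2 r l].
    Since [D] stays below [2 (2 l1 + C)], returning from logarithms to lengths costs only a constant
    factor. *)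
Lemma window_estimate (R : realType) (sg p r l l0 l1 C x tau : R) :
  0 < r -> r <= 1 -> 0 <= C -> l0 <= l -> l <= l1 -> 0 < l0 -> 0 < x ->
  tau = expR (- l / r) ->
  `|p - sg * r| <= 2 * r ^+ 2 ->
  `|ln x - p * ln tau| <= C * (r + tau) ->
  sg ^+ 2 = 1 ->
  `|x - expR (- sg * l)| <= expR l1 * expR (2 * (2 * l1 + C)) * ((2 * l1 + C) * (r + expR (- l0 / r))).
Proof.
move=> r0 r1 C0 l0l ll1 l00 x0 tE pr est sg2.
have rn : r != 0 by rewrite gt_eqF.
have l10 : 0 < l1 by apply: lt_le_trans l00 (le_trans l0l ll1).
have lp : 0 < l by exact: lt_le_trans l00 l0l.
set D := (2 * l1 + C) * (r + expR (- l0 / r)).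
have te : tau <= expR (- l0 / r) by rewrite tE ler_expR ler_pM2r ?invr_gt0 // lerN2.
have e1 : expR (- l0 / r) <= 1.
  by rewrite -[leRHS]expR0 ler_expR mulNr oppr_le0 divr_ge0 ?ltW.
have e0 := expR_gt0 (- l0 / r).
have DM : D <= 2 * (2 * l1 + C).
  by rewrite /D mulrC ler_wpM2r //; [rewrite addr_ge0 // mulr_ge0 // ltW|lra].
have lD : `|ln x - - sg * l| <= D.
  have lt : ln tau = - l / r by rewrite tE expRK.
  have -> : ln x - - sg * l = (ln x - p * ln tau) - (p - sg * r) * (l / r).
    by rewrite lt; field.
  apply: le_trans (ler_normB _ _) _.
  have b : `|(p - sg * r) * (l / r)| <= 2 * l1 * r.
    rewrite normrM (ger0_norm (divr_ge0 (ltW lp) (ltW r0))).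
    apply: (@le_trans _ _ (2 * r ^+ 2 * (l1 / r))).
      by apply: ler_pM => //; [exact: divr_ge0 (ltW lp) (ltW r0)|rewrite ler_pM2r ?invr_gt0].
    by rewrite le_eqVlt; apply/orP; left; apply/eqP; field.
  have c : C * (r + tau) <= C * (r + expR (- l0 / r)) by rewrite ler_wpM2l // lerD2l.
  have d : 2 * l1 * r <= 2 * l1 * (r + expR (- l0 / r)).
    by rewrite ler_pM2l ?mulr_gt0 // lerDl ltW.
  have -> : D = C * (r + expR (- l0 / r)) + 2 * l1 * (r + expR (- l0 / r)) by rewrite /D; ring.
  by apply: lerD; [exact: le_trans est c|exact: le_trans b d].
apply: le_trans (estimate_exp x0 lD DM) _; apply: ler_wpM2r.
  exact: le_trans (normr_ge0 _) lD.
rewrite ler_pM2r ?expR_gt0 // ler_expR.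
have : `|sg| = 1.
  by apply/eqP; rewrite -(@eqrXn2 _ 2) ?normr_ge0 // real_normK ?num_real // sg2 expr1n.
move=> sg1; apply: le_trans (ler_norm _) _; rewrite normrM normrN sg1 mul1r gtr0_norm //.
Qed.

Theorem proposition9p4 (R : realType) :
  (* BH is the limiting horizontal length at the horizon for A = 0 *)
  (forall (h : 'M[R]_3) (s tref : R) (h_ : R -> 'M[R]_3) (X : 'cV[R]_3),
     parameter_space (h, s) -> development_of h s 0 tref h_ ->
     unit_horizontal h X ->
     len h_ X t @[t --> 0^'+] --> BH h s) /\
  (forall KK : set ('M[R]_3 * R),
     compact KK -> KK `<=` @parameter_space R ->
     exists eps C eta : R,
       [/\ 0 < eps, 0 < C, 0 < eta,
           forall h s A tref h_ Xm Xp,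
             admissible KK eps h s A tref h_ Xm Xp ->
             let r := rpar h s A in
             forall t : R, 0 < t <= tref ->
               `|ln (len h_ Xm t / BH h s) - p_minus r * ln (t / tref)|
                 <= C * (r + (t / tref) `^ eta) /\
               `|ln (len h_ Xp t / BH h s) - p_plus r * ln (t / tref)|
                 <= C * (r + (t / tref) `^ eta)
         & forall l0 l1 : R, 0 < l0 -> l0 < l1 ->
             exists Cl : R,
             forall h s A tref h_ Xm Xp,
               admissible KK eps h s A tref h_ Xm Xp ->
               let r := rpar h s A in
               0 < r ->
               (ereal_sup
                  [set (`|len h_ Xm (tref * expR (- l / r)) / BH h s - expR l|
                        + `|len h_ Xp (tref * expR (- l / r)) / BH h s
                            - expR (- l)|)%:E
                  | l in [set l : R | (l0 <= l <= l1)%R]]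
                <= (Cl * (r + expR (- eta * l0 / r)))%:E)%E]).
Proof.
split; first by move=> h s tref h_ X; exact: horizon_limit.
move=> KK cK KP; have [n1 [n2 [s1 [s2 [n10 n20 s10 s20 bd]]]]] := parameter_bounds cK KP.
(* The maximum with 1 gives positivity without choosing a point of [KK], which may be empty. *)
pose C := Num.max 1 (estimate_const n1 n2 s1 s2).
have C0 : 0 < C by rewrite lt_max ltr01.
have EC : estimate_const n1 n2 s1 s2 <= C by rewrite le_max lexx orbT.
have est h s A tref h_ Xm Xp (adm : admissible KK (Num.min 1 (n1 / 2)) h s A tref h_ Xm Xp) :=
  uniform_estimate KP n10 s10 bd adm.
(* The bound 1 on [mu] controls [rho], the bound [n1 / 2] gives [r <= 1]; [eta = 1] is the power of
   [tau] in the length estimate. *)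
exists (Num.min 1 (n1 / 2)), C, 1; split=> //.
- by rewrite lt_min ltr01 divr_gt0.
- move=> h s A tref h_ Xm Xp adm r t tt.
  have [/andP[r0 _] B0 /(_ t tt) [_ _ em ep]] := est _ _ _ _ _ _ _ adm.
  have t0 : 0 <= t / tref.
    by move: tt => /andP[t0 ttr]; rewrite divr_ge0 ?(ltW t0) // ltW // (lt_le_trans t0).
  by rewrite powRr1 //; split; [apply: le_trans em _|apply: le_trans ep _];
    rewrite ler_wpM2r // addr_ge0.
move=> l0 l1 l00 l01.
pose Q := 2 * l1 + C.
(* The factor 2 counts the two lengths, each contributing the constant of [window_estimate]. *)
exists (2 * (expR l1 * expR (2 * Q) * Q)) => h s A tref h_ Xm Xp adm r r0.
have [/andP[_ r1] B0 est'] := est _ _ _ _ _ _ _ adm.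
have [_ _ _ [b [K [_ [tr0 _] _ _ _]]] _] := adm.
apply: ge_ereal_sup => _ [l /andP[l0l ll1] <-]; rewrite lee_fin.
have tt : 0 < tref * expR (- l / r) <= tref.
  rewrite mulr_gt0 ?expR_gt0 //= ler_piMr ?ltW // -[ltRHS]expR0 ltr_expR.
  by rewrite mulNr oppr_lt0 divr_gt0 // (lt_le_trans l00).
have [lm lp em ep] := est' _ tt.
have tE : tref * expR (- l / r) / tref = expR (- l / r).
  by rewrite mulrC mulKf // gt_eqF.
rewrite !tE in em ep.
have up_ x : x <= estimate_const n1 n2 s1 s2 * (r + expR (- l / r)) -> x <= C * (r + expR (- l / r)).
  by move=> /le_trans; apply; rewrite ler_wpM2r // addr_ge0 ?expR_ge0 // ltW.
have em' := up_ _ em; have ep' := up_ _ ep.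
have xm : 0 < len h_ Xm (tref * expR (- l / r)) / BH h s by rewrite divr_gt0.
have xp : 0 < len h_ Xp (tref * expR (- l / r)) / BH h s by rewrite divr_gt0.
have pm : `|p_minus r - (-1) * r| <= 2 * r ^+ 2.
  by rewrite mulN1r opprK; apply: p_minus_approx => //; exact: ltW.
have pp : `|p_plus r - 1 * r| <= 2 * r ^+ 2.
  by rewrite mul1r; apply: p_plus_approx => //; exact: ltW.
have sq1 : (-1) ^+ 2 = 1 :> R by rewrite sqrrN expr1n.
have wm := window_estimate r0 r1 (ltW C0) l0l ll1 l00 xm erefl pm em' sq1.
have wp := window_estimate r0 r1 (ltW C0) l0l ll1 l00 xp erefl pp ep' (expr1n _ 2).
rewrite opprK mul1r in wm; rewrite mulN1r in wp.
apply: le_trans (lerD wm wp) _; rewrite mulN1r.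
by rewrite le_eqVlt; apply/orP; left; apply/eqP; rewrite /Q; ring.
Qed.
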